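(* Let $D=[0,1]\times[-\pi,\pi]$. The GLT set $\mathscr{G}$ is a maximal element, with respect to inclusion, of the family $\mathscr{S}_D$ of all groups contained in $\mathscr{C}_D$.
   Context: $\mathscr{E}:=\{\{A_n\}_{n\ge1}: A_n\in\mathbb{C}^{n\times n}\}$; $\mathscr{M}_D$ is the set of measurable functions $D\to\mathbb{C}$ modulo a.e. equality. Operations on $\mathscr{E}\times\mathscr{M}_D$ are componentwise (termwise and pointwise). Distances. For $A\in\mathbb{C}^{n\times n}$ let $\sigma_1(A)\ge\dots\ge\sigma_n(A)$ be its singular values, $\sigma_{n+1}(A):=0$, and $p(A):=\min_{i=1,\dots,n+1}\left\{\frac{i-1}{n}+\sigma_i(A)\right\}$. Set $d_{acs}(\{A_n\}_n,\{B_n\}_n):=\limsup_{n\to\infty}p(A_n-B_n)$, a pseudometric on $\mathscr{E}$. On $\mathscr{M}_D$ let $d_m(f,g):=p_m(f-g)$, $p_m(f):=\inf_E\left\{\frac{|D\setminus E|}{|D|}+\operatorname{ess\,sup}_E|f|\right\}$ over all measurable $E\subseteq D$ (with $\operatorname{ess\,sup}_E|f|:=0$ if $|E|=0$); $d_m$ is a complete metric inducing convergence in measure. Spectral symbols. $\{A_n\}_n\sim_\sigma k$ means $\lim_{n\to\infty}\frac1n\sum_{i=1}^nF(\sigma_i(A_n))=\frac1{|D|}\int_DF(|k|)$ for every continuous compactly supported $F:\mathbb{R}\to\mathbb{C}$. $\mathscr{C}_D:=\{(\{A_n\}_n,k)\in\mathscr{E}\times\mathscr{M}_D:\{A_n\}_n\sim_\sigma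 k\}$. $\mathscr{S}_D$ is the set of all additive groups contained in $\mathscr{C}_D$, i.e. nonempty $G\subseteq\mathscr{C}_D$ such that $a,b\in G\Rightarrow a+b\in G$ and $a\in G\Rightarrow -a\in G$. GLT algebra. For $f\in L^1([-\pi,\pi])$ let $T_n(f)=[\hat f_{i-j}]_{i,j=1}^n$ with $\hat f_\ell=\frac1{2\pi}\int_{-\pi}^{\pi}f(\theta)e^{-\mathrm{i}\ell\theta}d\theta$; for Riemann integrable $a:[0,1]\to\mathbb{C}$ let $D_n(a)=\operatorname{diag}_{i=1,\dots,n}a(i/n)$. The set $\mathscr{G}\subseteq\mathscr{E}\times\mathscr{M}_D$ is the closure (for the product of $d_{acs}$ and $d_m$) of the $\mathbb{C}$-subalgebra of $\mathscr{E}\times\mathscr{M}_D$ generated by all pairs $(\{T_n(f)\}_n,(x,\theta)\mapsto f(\theta))$ and $(\{D_n(a)\}_n,(x,\theta)\mapsto a(x))$. Known facts: $\mathscr{G}\subseteq\mathscr{C}_D$; each $\{A_n\}_n$ has at most one $k$ with $(\{A_n\}_n,k)\in\mathscr{G}$; $\mathscr{G}$ is a $\mathbb{C}$-algebra (so $\mathscr{G}\in\mathscr{S}_D$), closed in $\mathscr{E}\times\mathscr{M}_D$; every $k\in\mathscr{M}_D$ is a limit in measure of functions $k_m$ that are second components of elements of $\mathscr{G}$; $(\{C_n\}_n,0)\in\mathscr{G}$ whenever $\{C_n\}_n\sim_\sigma0$. *)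

(* Defs.v *)
From HB Require Import structures.
From mathcomp Require Import all_boot all_order all_algebra.
From mathcomp Require Import generic_quotient spectral complex.
From mathcomp Require Import all_classical all_reals all_analysis.
From mathcomp Require Import measurable_realfun ess_sup_inf.

Set Implicit Arguments.
Unset Strict Implicit.
Unset Printing Implicit Defensive.
Import Order.TTheory GRing.Theory Num.Theory.
Import numFieldNormedType.Exports.
Import ComplexField.Normc.

Local Open Scope classical_set_scope.
Local Open Scope ring_scope.
Local Open Scope complex_scope.
Local Open Scope sesquilinear_scope.
Local Open Scope quotient_scope.

Section complex_measurable.
Variable R : realType.

HB.instance Definition _ := isPointed.Build R[i] (Complex 0 0).

(* The Borel sigma-algebra of C, identified with R * R. *)
Definition complex_borel : set (set R[i]) :=
  g_sigma_preimageU (@complex.Re R : R[i] -> measurableTypeR R)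
                    (@complex.Im R : R[i] -> measurableTypeR R).

Let complex_borel0 : complex_borel set0.
Proof. exact: sigma_algebra0. Qed.

Let complex_borelC A : complex_borel A -> complex_borel (~` A).
Proof. exact: sigma_algebraC. Qed.

Let complex_borel_bigcup (F : (set R[i])^nat) :
  (forall i, complex_borel (F i)) -> complex_borel (\bigcup_i F i).
Proof. exact: sigma_algebra_bigcup. Qed.

HB.instance Definition _ := @isMeasurable.Build default_measure_display R[i]
  complex_borel complex_borel0 complex_borelC complex_borel_bigcup.

Lemma measurable_fun_complexP d (T : measurableType d) (f : T -> R[i]) :
  measurable_fun setT f <->
  measurable_fun setT (fun x => complex.Re (f x)) /\
  measurable_fun setT (fun x => complex.Im (f x)).
Proof.
have mRe : measurable_fun setT (@complex.Re R : R[i] -> R).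
  by move=> _ B mB; apply: sub_sigma_algebra; left; exists B.
have mIm : measurable_fun setT (@complex.Im R : R[i] -> R).
  by move=> _ B mB; apply: sub_sigma_algebra; right; exists B.
split=> [mf|[mr mi]].
  by split; [exact: (measurableT_comp mRe mf)|exact: (measurableT_comp mIm mf)].
apply: (@measurability _ _ _ _ setT f
  (preimage_set_system setT (@complex.Re R : R[i] -> measurableTypeR R) measurable
  `|` preimage_set_system setT (@complex.Im R : R[i] -> measurableTypeR R)
        measurable)) => //.
move=> _ [_ [[B mB <-]|[B mB <-]] <-]; rewrite !setTI -comp_preimage.
  by rewrite -[X in measurable X]setTI; exact: mr.
by rewrite -[X in measurable X]setTI; exact: mi.
Qed.

End complex_measurable.

Section complex_integral.
Context d (T : measurableType d) (R : realType).
Variable mu : {measure set T -> \bar R}.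

Definition cintegrable (D : set T) (f : T -> R[i]) : Prop :=
  mu.-integrable D (fun x => (complex.Re (f x))%:E) /\
  mu.-integrable D (fun x => (complex.Im (f x))%:E).

Definition cintegral (D : set T) (f : T -> R[i]) : R[i] :=
  (\int[mu]_(x in D) complex.Re (f x)) +i*
  (\int[mu]_(x in D) complex.Im (f x)).

End complex_integral.

Section matrix_sequences.
Variable R : realType.

(* [A n] is the matrix A_{n+1} of size n + 1. *)
Definition mxseq : Type := forall n : nat, 'M[R[i]]_n.+1.

HB.instance Definition _ := gen_eqMixin mxseq.
HB.instance Definition _ := gen_choiceMixin mxseq.

Let zero : mxseq := fun n => 0.
Let one : mxseq := fun n => 1%:M.
Let add (A B : mxseq) : mxseq := fun n => A n + B n.
Let opp (A : mxseq) : mxseq := fun n => - A n.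
Let mul (A B : mxseq) : mxseq := fun n => A n *m B n.
Let scale (c : R[i]) (A : mxseq) : mxseq := fun n => c *: A n.

Let ext (A B : mxseq) : (forall n, A n = B n) -> A = B.
Proof. exact: functional_extensionality_dep. Qed.

Let addA : associative add.
Proof. by move=> A B C; apply: ext => n; exact: addrA. Qed.
Let addC : commutative add.
Proof. by move=> A B; apply: ext => n; exact: addrC. Qed.
Let add0 : left_id zero add.
Proof. by move=> A; apply: ext => n; exact: add0r. Qed.
Let addN : left_inverse zero opp add.
Proof. by move=> A; apply: ext => n; exact: addNr. Qed.

HB.instance Definition _ := GRing.isZmodule.Build mxseq addA addC add0 addN.

Let mulA : associative mul.
Proof. by move=> A B C; apply: ext => n; exact: mulmxA. Qed.
Let mul1 : left_id one mul.
Proof. by move=> A; apply: ext => n; exact: mul1mx. Qed.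
Let mulr1 : right_id one mul.
Proof. by move=> A; apply: ext => n; exact: mulmx1. Qed.
Let mulDl : left_distributive mul (@GRing.add mxseq).
Proof. by move=> A B C; apply: ext => n; exact: mulmxDl. Qed.
Let mulDr : right_distributive mul (@GRing.add mxseq).
Proof. by move=> A B C; apply: ext => n; exact: mulmxDr. Qed.

HB.instance Definition _ :=
  GRing.Zmodule_isPzRing.Build mxseq mulA mul1 mulr1 mulDl mulDr.

Let scaleA a b A : scale a (scale b A) = scale (a * b) A.
Proof. by apply: ext => n; exact: scalerA. Qed.
Let scale1 : left_id 1 scale.
Proof. by move=> A; apply: ext => n; exact: scale1r. Qed.
Let scaleDr : right_distributive scale +%R.
Proof. by move=> c A B; apply: ext => n; exact: scalerDr. Qed.
Let scaleDl A : {morph scale^~ A : a b / a + b}.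
Proof. by move=> a b; apply: ext => n; exact: scalerDl. Qed.

HB.instance Definition _ :=
  GRing.Zmodule_isLmodule.Build R[i] mxseq scaleA scale1 scaleDr scaleDl.

End matrix_sequences.

Section ae_classes.
Context d (T : measurableType d) (R : realType).
Variable mu : {measure set T -> \bar R}.

Definition aeclass : Type := {mfun_ mu, T >-> R[i]}.

HB.instance Definition _ := Choice.on aeclass.
HB.instance Definition _ := EqQuotient.on aeclass.

(* The class of a measurable function. *)
Definition aeclass_of (f : T -> R[i]) (mf : measurable_fun setT f) : aeclass :=
  \pi_aeclass (mfun_Sub (mem_set mf)).

Definition aeclass_fun (f : aeclass) : T -> R[i] := repr f.
Coercion aeclass_fun : aeclass >-> Funclass.

Lemma aeclassP (f g : aeclass) :
  f = g <-> (f : T -> R[i]) = g %[ae mu].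
Proof.
split=> [->|fg]; first exact: ae_eq_refl.
by rewrite -[f]reprK -[g]reprK; apply/eqmodP/asboolP.
Qed.

Lemma aeclass_ofE f mf : (@aeclass_of f mf : T -> R[i]) = f %[ae mu].
Proof.
rewrite /aeclass_fun /aeclass_of.
have /eqmodP/asboolP := reprK (\pi_aeclass (mfun_Sub (mem_set mf))).
exact.
Qed.

Let measurable_cst_ (c : R[i]) : measurable_fun setT (fun _ : T => c).
Proof. exact: measurable_cst. Qed.

Let measurable_add (f g : aeclass) : measurable_fun setT (fun x => f x + g x).
Proof.
have [rf jf] := (measurable_fun_complexP f).1 (measurable_funPT (repr f)).
have [rg jg] := (measurable_fun_complexP g).1 (measurable_funPT (repr g)).
apply/measurable_fun_complexP; split.
  by under eq_fun do rewrite raddfD; exact: measurable_funD.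
by under eq_fun do rewrite raddfD; exact: measurable_funD.
Qed.

Let measurable_opp (f : aeclass) : measurable_fun setT (fun x => - f x).
Proof.
have [rf jf] := (measurable_fun_complexP f).1 (measurable_funPT (repr f)).
apply/measurable_fun_complexP; split.
  by under eq_fun do rewrite raddfN; exact: measurableT_comp.
by under eq_fun do rewrite raddfN; exact: measurableT_comp.
Qed.

Let measurable_mul_ (f g : T -> R[i]) : measurable_fun setT f ->
  measurable_fun setT g -> measurable_fun setT (fun x => f x * g x).
Proof.
move=> /measurable_fun_complexP[rf jf] /measurable_fun_complexP[rg jg].
apply/measurable_fun_complexP; split.
  rewrite (_ : (fun _ => _) = fun x => complex.Re (f x) * complex.Re (g x) -
     complex.Im (f x) * complex.Im (g x)); last first.
    by apply/funext => x; case: (f x) (g x) => [? ?] [? ?].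
  by apply: measurable_funB; exact: measurable_realfun.measurable_funM.
rewrite (_ : (fun _ => _) = fun x => complex.Re (f x) * complex.Im (g x) +
   complex.Im (f x) * complex.Re (g x)); last first.
  by apply/funext => x; case: (f x) (g x) => [? ?] [? ?].
by apply: measurable_funD; exact: measurable_realfun.measurable_funM.
Qed.

Let measurable_mul (f g : aeclass) : measurable_fun setT (fun x => f x * g x).
Proof. by apply: measurable_mul_; exact: measurable_funPT. Qed.

Let measurable_scale (c : R[i]) (f : aeclass) :
  measurable_fun setT (fun x => c * f x).
Proof. by apply: measurable_mul_ => //; exact: measurable_funPT. Qed.

Let zero : aeclass := aeclass_of (measurable_cst_ 0).
Let one : aeclass := aeclass_of (measurable_cst_ 1).
Let add (f g : aeclass) : aeclass := aeclass_of (measurable_add f g).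
Let opp (f : aeclass) : aeclass := aeclass_of (measurable_opp f).
Let mul (f g : aeclass) : aeclass := aeclass_of (measurable_mul f g).
Let scale (c : R[i]) (f : aeclass) : aeclass :=
  aeclass_of (measurable_scale c f).

Let zeroE : \forall x \ae mu, zero x = 0.
Proof. by have := aeclass_ofE (measurable_cst_ 0); apply: filterS => x; apply. Qed.
Let oneE : \forall x \ae mu, one x = 1.
Proof. by have := aeclass_ofE (measurable_cst_ 1); apply: filterS => x; apply. Qed.
Let addE f g : \forall x \ae mu, add f g x = f x + g x.
Proof. by have := aeclass_ofE (measurable_add f g); apply: filterS => x; apply. Qed.
Let oppE f : \forall x \ae mu, opp f x = - f x.
Proof. by have := aeclass_ofE (measurable_opp f); apply: filterS => x; apply. Qed.
Let mulE f g : \forall x \ae mu, mul f g x = f x * g x.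
Proof. by have := aeclass_ofE (measurable_mul f g); apply: filterS => x; apply. Qed.
Let scaleE c f : \forall x \ae mu, scale c f x = c * f x.
Proof. by have := aeclass_ofE (measurable_scale c f); apply: filterS => x; apply. Qed.

Let addA : associative add.
Proof.
move=> f g h; apply/aeclassP.
apply: filter_app (addE f g); apply: filter_app (addE (add f g) h);
  apply: filter_app (addE g h); apply: filter_app (addE f (add g h));
  apply: (@nearW _ (almost_everywhere mu)).
by move=> x -> -> -> -> _; rewrite addrA.
Qed.
Let addC : commutative add.
Proof.
move=> f g; apply/aeclassP.
apply: filter_app (addE g f); apply: filter_app (addE f g); apply: (@nearW _ (almost_everywhere mu)).
by move=> x -> -> _; rewrite addrC.
Qed.
Let add0 : left_id zero add.
Proof.
move=> f; apply/aeclassP.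
apply: filter_app (zeroE); apply: filter_app (addE zero f); apply: (@nearW _ (almost_everywhere mu)).
by move=> x -> -> _; rewrite add0r.
Qed.
Let addN : left_inverse zero opp add.
Proof.
move=> f; apply/aeclassP.
apply: filter_app (zeroE); apply: filter_app (oppE f);
  apply: filter_app (addE (opp f) f); apply: (@nearW _ (almost_everywhere mu)).
by move=> x -> -> -> _; rewrite addNr.
Qed.

HB.instance Definition _ := GRing.isZmodule.Build aeclass addA addC add0 addN.

Let mulA : associative mul.
Proof.
move=> f g h; apply/aeclassP.
apply: filter_app (mulE f g); apply: filter_app (mulE (mul f g) h);
  apply: filter_app (mulE g h); apply: filter_app (mulE f (mul g h));
  apply: (@nearW _ (almost_everywhere mu)).
by move=> x -> -> -> -> _; rewrite mulrA.
Qed.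
Let mul1 : left_id one mul.
Proof.
move=> f; apply/aeclassP.
apply: filter_app (oneE); apply: filter_app (mulE one f); apply: (@nearW _ (almost_everywhere mu)).
by move=> x -> -> _; rewrite mul1r.
Qed.
Let mulC : commutative mul.
Proof.
move=> f g; apply/aeclassP.
apply: filter_app (mulE g f); apply: filter_app (mulE f g); apply: (@nearW _ (almost_everywhere mu)).
by move=> x -> -> _; rewrite mulrC.
Qed.
Let mulDl : left_distributive mul (@GRing.add aeclass).
Proof.
move=> f g h; apply/aeclassP.
apply: filter_app (mulE g h); apply: filter_app (mulE f h);
  apply: filter_app (addE (mul f h) (mul g h)); apply: filter_app (addE f g);
  apply: filter_app (mulE (add f g) h); apply: (@nearW _ (almost_everywhere mu)).
by move=> x -> -> -> -> -> _; rewrite mulrDl.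
Qed.

HB.instance Definition _ :=
  GRing.Zmodule_isComPzRing.Build aeclass mulA mulC mul1 mulDl.

Let scaleA a b f : scale a (scale b f) = scale (a * b) f.
Proof.
apply/aeclassP.
apply: filter_app (scaleE (a * b) f); apply: filter_app (scaleE b f);
  apply: filter_app (scaleE a (scale b f)); apply: (@nearW _ (almost_everywhere mu)).
by move=> x -> -> -> _; rewrite mulrA.
Qed.
Let scale1 : left_id 1 scale.
Proof.
move=> f; apply/aeclassP.
apply: filter_app (scaleE 1 f); apply: (@nearW _ (almost_everywhere mu)).
by move=> x -> _; rewrite mul1r.
Qed.
Let scaleDr : right_distributive scale +%R.
Proof.
move=> c f g; apply/aeclassP.
apply: filter_app (scaleE c g); apply: filter_app (scaleE c f);
  apply: filter_app (addE (scale c f) (scale c g));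
  apply: filter_app (addE f g); apply: filter_app (scaleE c (add f g));
  apply: (@nearW _ (almost_everywhere mu)).
by move=> x -> -> -> -> -> _; rewrite mulrDr.
Qed.
Let scaleDl f : {morph scale^~ f : a b / a + b}.
Proof.
move=> a b; apply/aeclassP.
apply: filter_app (scaleE b f); apply: filter_app (scaleE a f);
  apply: filter_app (addE (scale a f) (scale b f));
  apply: filter_app (scaleE (a + b) f); apply: (@nearW _ (almost_everywhere mu)).
by move=> x -> -> -> -> _; rewrite mulrDl.
Qed.

HB.instance Definition _ :=
  GRing.Zmodule_isLmodule.Build R[i] aeclass scaleA scale1 scaleDr scaleDl.

Lemma aeclass0E : \forall x \ae mu, (0 : aeclass) x = 0.
Proof. exact: zeroE. Qed.

Lemma aeclass1E : \forall x \ae mu, (1 : aeclass) x = 1.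
Proof. exact: oneE. Qed.

Lemma aeclassDE (f g : aeclass) : \forall x \ae mu, (f + g : aeclass) x = f x + g x.
Proof. exact: addE. Qed.

Lemma aeclassNE (f : aeclass) : \forall x \ae mu, (- f : aeclass) x = - f x.
Proof. exact: oppE. Qed.

Lemma aeclassME (f g : aeclass) : \forall x \ae mu, (f * g : aeclass) x = f x * g x.
Proof. exact: mulE. Qed.

Lemma aeclassZE (c : R[i]) (f : aeclass) :
  \forall x \ae mu, (c *: f : aeclass) x = c * f x.
Proof. exact: scaleE. Qed.

End ae_classes.

Section singular_values.
Variable R : realType.

(* The square roots of the eigenvalues of A^* A, in nonincreasing order. *)
Definition singular_values n (A : 'M[R[i]]_n) : seq R :=
  sort >=%O [seq Num.sqrt (complex.Re (spectral_diag (A^t* *m A) ord0 i))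
            | i <- enum 'I_n].

(* [sigma A i] is sigma_{i+1}(A); reading past the end of the sequence gives
   sigma_{n+1}(A) = 0. *)
Definition sigma n (A : 'M[R[i]]_n) (i : nat) : R := (singular_values A)`_i.

(* The term of index i = n equals 1 when 0 < n, so that the default value 1
   of the iterated minimum does not change the result. *)
Definition p_acs n (A : 'M[R[i]]_n) : R :=
  \big[Num.min/1]_(i < n.+1) (i%:R / n%:R + sigma A i).

Definition d_acs (A B : mxseq R) : \bar R :=
  limn_esup (fun n => (p_acs (A n - B n))%:E).

End singular_values.

Section domain.
Variable R : realType.

Definition D : set (measurableTypeR R * measurableTypeR R) :=
  `[0, 1] `*` `[- pi, pi].

Lemma measurable_D : measurable D.
Proof. by apply: measurableX; exact: measurable_itv. Qed.

Definition muD : {measure set (measurableTypeR R * measurableTypeR R) -> \bar R} :=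
  mrestr (lebesgue_measure \x lebesgue_measure)%E measurable_D.

End domain.
Arguments D R : clear implicits.
Arguments muD R : clear implicits.

(* Functions are total on the plane and only their values on D matter. Borel
   representatives suffice: every Lebesgue measurable function on D is a.e.
   equal to a Borel one. *)
Notation M_D R := (aeclass (muD R)).
Notation ExM_D R := ((mxseq R * M_D R)%type).

Section spectral_symbols.
Variable R : realType.

(* Since |f| >= 0, extending |f| by 0 outside E does not change ess sup_E |f|
   if |E| > 0, and it implements the convention ess sup_E |f| = 0 if |E| = 0. *)
Definition p_m (f : M_D R) : \bar R :=
  ereal_inf [set ((fine (muD R (D R `\` E)) / fine (muD R (D R)))%:E
                  + ess_sup (muD R) ((fun x => (normc (f x))%:E) \_ E))%E
            | E in [set E | measurable E /\ E `<=` D R]].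

Definition d_m (f g : M_D R) : \bar R := p_m (f - g).

(* C as a [numFieldType], which provides its topology. *)
Local Notation C := (R[i] : numFieldType).

Definition has_symbol (A : mxseq R) (k : M_D R) : Prop :=
  forall F : R -> C, continuous F -> compact (closure [set x | F x != 0]) ->
    (fun n => n.+1%:R^-1 * \sum_(i < n.+1) F (sigma (A n) i)) @ \oo -->
    ((fine (muD R (D R)))^-1%:C
      * cintegral (muD R) (D R) (fun x => F (normc (k x))) : C).

Definition C_D : set (ExM_D R) := [set x : ExM_D R | has_symbol x.1 x.2].

Definition S_D : set (set (ExM_D R)) :=
  [set G | [/\ G !=set0, G `<=` C_D,
    forall a b, G a -> G b -> G (a + b) & forall a, G a -> G (- a)]].

End spectral_symbols.
Arguments C_D R : clear implicits.
Arguments S_D R : clear implicits.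

Section GLT.
Variable R : realType.

(* exp(i t) *)
Definition expi (t : R) : R[i] := cos t +i* sin t.

Definition fourier_coef (f : R -> R[i]) (l : int) : R[i] :=
  (2 * pi)^-1%:C * cintegral (@lebesgue_measure R) `[- pi, pi]
                     (fun t => f t * expi (- (l%:~R * t))).

Definition toeplitz n (f : R -> R[i]) : 'M[R[i]]_n :=
  \matrix_(i, j) fourier_coef f (i%:Z - j%:Z).

Definition diag_sampling n (a : R -> R[i]) : 'M[R[i]]_n :=
  diag_mx (\row_(i < n) a (i.+1%:R / n%:R)).

(* [s] lists the points of the partition after the first point [0]; [t i] is
   the tag chosen in the i-th interval. *)
Definition riemann_sum (a : R -> R[i]) (s : seq R) (t : nat -> R) : R[i] :=
  \sum_(i < size s) (s`_i - (0 :: s)`_i)%:C * a (t i).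

Definition riemann_integrable01 (a : R -> R[i]) : Prop :=
  exists I : R[i], forall eps : R, 0 < eps -> exists2 delta : R, 0 < delta &
    forall (s : seq R) (t : nat -> R), itv_partition 0 1 s ->
      (forall i, (i < size s)%N ->
        (0 :: s)`_i <= t i <= s`_i /\ s`_i - (0 :: s)`_i < delta) ->
      normc (riemann_sum a s t - I) < eps.

Definition toeplitz_pairs : set (ExM_D R) :=
  [set x : ExM_D R | exists f : R -> R[i],
    [/\ cintegrable (@lebesgue_measure R) `[- pi, pi] f,
        x.1 = (fun n => toeplitz n.+1 f) &
        (x.2 : R * R -> R[i]) = (fun p => f p.2) %[ae muD R in D R]]].

(* A Riemann integrable function need not be Borel, but it is a.e. equal to a
   Borel function; hence the second component is specified a.e. *)
Definition sampling_pairs : set (ExM_D R) :=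
  [set x : ExM_D R | exists a : R -> R[i],
    [/\ riemann_integrable01 a,
        x.1 = (fun n => diag_sampling n.+1 a) &
        (x.2 : R * R -> R[i]) = (fun p => a p.1) %[ae muD R in D R]]].

Definition subalgebra (S : set (ExM_D R)) : Prop :=
  [/\ S 0,
      forall (c : R[i]) x y, S x -> S y -> S (c *: x + y) &
      forall x y, S x -> S y -> S (x * y)].

(* Closure for the product of the pseudometrics d_acs and d_m. *)
Definition closure_acs_m (S : set (ExM_D R)) : set (ExM_D R) :=
  [set x : ExM_D R | forall eps : R, 0 < eps ->
    exists y, [/\ S y, (d_acs x.1 y.1 < eps%:E)%E & (d_m x.2 y.2 < eps%:E)%E]].

Definition GLT : set (ExM_D R) :=
  closure_acs_m (smallest subalgebra (toeplitz_pairs `|` sampling_pairs)).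

End GLT.
Arguments GLT R : clear implicits.

(* Main.v *)
(** Cut {0, ..., N-1} into blocks of length about sqrt N and let U be the
block-diagonal discrete Fourier transform. If h is constant on the cells of a
K x K subdivision of D, the matrices U^* diag(h(x_i, theta_i)) U, where x_i is
the position of the block of i and theta_i the frequency of i inside its block,
have symbol h because the points (x_i, theta_i) are equidistributed in D. As U
does not depend on h, these pairs form a subalgebra of E x M_D contained in C_D,
and so does its closure, which contains the generators of the GLT algebra: D_n(a)
differs from the model on few blocks when a is Riemann integrable; T_n(e^(ik.))
differs from the model only near the block edges; and T_n(g) for small g in L^1
is handled by splitting g into positive functions, for which T_n(g) is positive
semidefinite with small normalized trace. Hence GLT is contained in C_D.

Maximality: if (A, k) belongs to a group G with GLT <= G <= C_D, choose (B, h)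
in GLT with h close to k in measure. Then (A - B, k - h) belongs to G, hence to
C_D, so A - B has a symbol that is small in measure and is therefore small for
d_acs. Thus (A, k) lies in the closure of GLT, which is GLT. *)

Require Import Defs.
From HB Require Import structures.
From mathcomp Require Import all_boot all_order all_algebra.
From mathcomp Require Import spectral complex.
From mathcomp Require Import all_classical all_reals all_analysis.
From mathcomp Require Import measurable_realfun ess_sup_inf.
From mathcomp Require Import zify ring lra.

Set Implicit Arguments.
Unset Strict Implicit.
Unset Printing Implicit Defensive.
Import Order.TTheory GRing.Theory Num.Theory.
Import numFieldNormedType.Exports.
Import ComplexField.Normc.
Local Open Scope ring_scope.
Local Open Scope complex_scope.
Local Open Scope sesquilinear_scope.

(** * Singular values *)

Section row_bounded.
Variable C : numClosedFieldType.

Definition vnorm n (u : 'rV[C]_n) : C := sqrtC (dotmx u u).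

Lemma vnorm_ge0 n (u : 'rV[C]_n) : 0 <= vnorm u.
Proof. by rewrite sqrtC_ge0 dnorm_ge0. Qed.

Lemma sqr_vnorm n (u : 'rV[C]_n) : vnorm u ^+ 2 = \sum_i `|u 0 i| ^+ 2.
Proof.
rewrite sqrtCK dotmxE mxE; apply: eq_bigr => i _.
by rewrite !mxE -normCK.
Qed.

Lemma vnormD n (u v : 'rV[C]_n) : vnorm (u + v) <= vnorm u + vnorm v.
Proof. exact: triangle_lerif. Qed.

Lemma vnormZ n c (u : 'rV[C]_n) : vnorm (c *: u) = `|c| * vnorm u.
Proof.
apply/eqP; rewrite -(@eqrXn2 _ 2) ?mulr_ge0 ?vnorm_ge0//.
rewrite exprMn !sqr_vnorm mulr_sumr; apply/eqP/eq_bigr => i _.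
by rewrite mxE normrM exprMn.
Qed.

Lemma vnorm0 n : vnorm (0 : 'rV[C]_n) = 0.
Proof. by rewrite -(scale0r 0) vnormZ normr0 mul0r. Qed.

Lemma vnorm_unitary n (U : 'M[C]_n) (u : 'rV[C]_n) : U \is unitarymx ->
  vnorm (u *m U) = vnorm u.
Proof.
move=> /unitarymxP UU; rewrite /vnorm !dotmxE.
by rewrite trmx_mul map_mxM mulmxA -(mulmxA u) UU mulmx1.
Qed.

(* By the min-max principle, [row_bounded A i t] amounts to sigma_{i+1}(A) <= t. *)
Definition row_bounded n (A : 'M[C]_n) (i : nat) (t : C) : Prop :=
  exists2 V : 'M[C]_n, (n <= \rank V + i)%N &
    forall u : 'rV[C]_n, (u <= V)%MS -> vnorm (u *m A) <= t * vnorm u.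

Lemma row_bounded_le n (A : 'M[C]_n) i j s t : (i <= j)%N -> s <= t ->
  row_bounded A i s -> row_bounded A j t.
Proof.
move=> ij st [V Vr VA]; exists V => [|u uV].
  by apply: leq_trans Vr _; rewrite leq_add2l.
by apply: le_trans (VA u uV) _; rewrite ler_wpM2r ?vnorm_ge0.
Qed.

Lemma rank_cap_codim n (V W : 'M[C]_n) i j : (n <= \rank V + i)%N ->
  (n <= \rank W + j)%N -> (n <= \rank (V :&: W)%MS + (i + j))%N.
Proof.
move=> Vi Wj; have := mxrank_sum_cap V W.
have := rank_leq_col (V + W)%MS; move: (\rank (V + W)%MS) (\rank (V :&: W)%MS).
by move=> *; lia.
Qed.

Lemma row_boundedD n (A B : 'M[C]_n) i j s t :
  row_bounded A i s -> row_bounded B j t -> row_bounded (A + B) (i + j) (s + t).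
Proof.
move=> [V Vr VA] [W Wr WB]; exists (V :&: W)%MS; first exact: rank_cap_codim.
move=> u; rewrite sub_capmx => /andP[uV uW]; rewrite mulmxDr mulrDl.
by apply: le_trans (vnormD _ _) _; rewrite lerD ?VA ?WB.
Qed.

Lemma row_boundedM n (A B : 'M[C]_n) i j s t : 0 <= t ->
  row_bounded A i s -> row_bounded B j t -> row_bounded (A *m B) (i + j) (s * t).
Proof.
move=> t0 [V Vr VA] [W Wr WB].
exists (V :&: kermx (A *m cokermx W))%MS.
  apply: rank_cap_codim => //; rewrite mxrank_ker.
  have := mxrankM_maxr A (cokermx W); rewrite mxrank_coker => le1.
  have := rank_leq_row (A *m cokermx W).
  move: (\rank (A *m cokermx W)) (\rank W) Wr le1 => *; lia.
move=> u; rewrite sub_capmx => /andP[uV /sub_kermxP uK].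
have uW : (u *m A <= W)%MS by rewrite submxE -mulmxA uK.
rewrite mulmxA; apply: le_trans (WB _ uW) _.
by rewrite [s * t]mulrC -mulrA ler_wpM2l ?VA.
Qed.

Lemma row_boundedZ n (A : 'M[C]_n) i c t :
  row_bounded A i t -> row_bounded (c *: A) i (`|c| * t).
Proof.
move=> [V Vr VA]; exists V => // u uV.
by rewrite -scalemxAr vnormZ -mulrA ler_wpM2l ?VA.
Qed.

Lemma row_boundedN n (A : 'M[C]_n) i t :
  row_bounded A i t -> row_bounded (- A) i t.
Proof. by rewrite -scaleN1r => /(row_boundedZ (-1)); rewrite normrN1 mul1r. Qed.

Lemma row_bounded_rank n (A : 'M[C]_n) : row_bounded A (\rank A) 0.
Proof.
exists (kermx A).
  by rewrite mxrank_ker; have := rank_leq_row A; move: (\rank A) => *; lia.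
by move=> u /sub_kermxP ->; rewrite vnorm0 mul0r.
Qed.

Definition coord_proj n (J : {set 'I_n}) : 'M[C]_n :=
  diag_mx (\row_i (i \in J)%:R).

Lemma rank_coord_proj n (J : {set 'I_n}) : \rank (coord_proj J) = #|J|.
Proof.
have half (K : {set 'I_n}) : (\rank (coord_proj K) <= #|K|)%N.
  pose B : 'M[C]_(n, #|K|) := \matrix_(i, j) (i == enum_val j)%:R.
  have -> : coord_proj K = B *m B^T.
    apply/matrixP => i j; rewrite !mxE.
    have [iK|iK] := boolP (i \in K).
      rewrite (bigD1 (enum_rank_in iK i)) //= !mxE enum_rankK_in// eqxx mul1r.
      rewrite big1 ?addr0 ?[j == i]eq_sym; first by [].
      move=> l lr; rewrite !mxE; case: eqP => [iE|_]; last by rewrite mul0r.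
      by case/eqP: lr; apply: enum_val_inj; rewrite enum_rankK_in.
    rewrite mul0rn big1// => l _; rewrite !mxE; case: eqP => [iE|_].
      by case/negP: iK; rewrite iE enum_valP.
    by rewrite mul0r.
  exact: leq_trans (mxrankM_maxr _ _) (rank_leq_row _).
apply/eqP; rewrite eqn_leq half/=.
have : coord_proj J + coord_proj (~: J) = 1%:M.
  apply/matrixP => i j; rewrite !mxE !inE; case: (i == j) => /=; last first.
    by rewrite !mulr0n addr0.
  by case: (i \in J) => /=; rewrite ?addr0 ?add0r.
move=> /(congr1 (@mxrank _ n n)); rewrite mxrank1 => nE.
have := mxrank_add (coord_proj J) (coord_proj (~: J)); rewrite nE => le1.
have cJ := cardsC J; rewrite card_ord in cJ.
have := leq_trans le1 (leq_add (leqnn _) (half (~: J))).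
by rewrite -[X in (X <= _)%N]cJ leq_add2r.
Qed.

Lemma sub_coord_proj n (J : {set 'I_n}) (U : 'M[C]_n) (u : 'rV[C]_n) :
  U \is unitarymx -> (u <= coord_proj J *m U)%MS ->
  forall i, i \notin J -> (u *m U^t*) 0 i = 0.
Proof.
move=> UU /submxP[w ->] i iJ.
rewrite -!mulmxA (unitarymxP UU) mulmx1 /coord_proj mul_mx_diag !mxE.
by rewrite (negbTE iJ) mulr0.
Qed.

Lemma rank_coord_projM n (J : {set 'I_n}) (U : 'M[C]_n) : U \is unitarymx ->
  \rank (coord_proj J *m U) = #|J|.
Proof.
move=> UU; rewrite mxrankMfree ?rank_coord_proj//.
by rewrite row_free_unit unitarymx_unit.
Qed.

Lemma rank_rows n (A : 'M[C]_n) (J : {set 'I_n}) :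
  (forall i, i \notin J -> row i A = 0) -> (\rank A <= #|J|)%N.
Proof.
move=> A0; rewrite -rank_coord_proj; have -> : A = coord_proj J *m A.
  apply/row_matrixP => i; rewrite /coord_proj mul_diag_mx.
  have [iJ|iJ] := boolP (i \in J); last rewrite A0//; apply/rowP => j.
    by rewrite !mxE iJ mul1r.
  by rewrite !mxE (negbTE iJ) mul0r.
exact: mxrankM_maxl.
Qed.

Section gram.
Variables (n : nat) (A P : 'M[C]_n) (sp : 'rV[C]_n).
Hypothesis PU : P \is unitarymx.
Hypothesis gramE : A^t* *m A = P^t* *m diag_mx sp *m P.

Lemma sqr_vnorm_gram (u : 'rV[C]_n) :
  vnorm (u *m A^t*) ^+ 2 = \sum_j sp 0 j * `|(u *m P^t*) 0 j| ^+ 2.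
Proof.
rewrite sqrtCK dotmxE trmx_mul map_mxM /= trmxCK.
have -> : u *m A^t* *m (A *m u^t*) = (u *m P^t*) *m diag_mx sp *m (u *m P^t*)^t*.
  by rewrite trmx_mul map_mxM /= trmxCK mulmxA -(mulmxA u) gramE !mulmxA.
move: (u *m P^t*) => w; rewrite mxE mul_mx_diag; apply: eq_bigr => j _.
by rewrite !mxE normCK mulrA [_ * w 0 j]mulrC.
Qed.

Lemma gram_ge0 j : 0 <= sp 0 j.
Proof.
have := sqr_vnorm_gram (row j P).
have -> : row j P *m P^t* = row j 1%:M.
  by rewrite -row_mul (unitarymxP PU).
rewrite (bigD1 j)//= big1 => [|k kj]; last first.
  by rewrite !mxE eq_sym (negbTE kj) normr0 expr0n mulr0.
by rewrite !mxE eqxx normr1 expr1n mulr1 addr0 => <-; rewrite exprn_ge0 ?vnorm_ge0.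
Qed.

Lemma row_bounded_gramP t i : 0 <= t ->
  row_bounded (A^t*) i t <-> (#|[set j | (t ^+ 2 < sp 0 j)%R]| <= i)%N.
Proof.
move=> t0; pose J := [set j | t ^+ 2 < sp 0 j].
have spN j : j \notin J -> sp 0 j <= t ^+ 2.
  by rewrite inE -real_leNgt// ?ger0_real ?gram_ge0 ?exprn_ge0.
split=> [[V Vi VA]|Ji]; last first.
  apply: (row_bounded_le Ji (lexx t)).
  exists (coord_proj (~: J) *m P).
    by rewrite rank_coord_projM// addnC cardsC card_ord.
  move=> u /(sub_coord_proj PU) u0.
  rewrite -(@ler_pXn2r _ 2) ?nnegrE ?mulr_ge0 ?vnorm_ge0//.
  rewrite sqr_vnorm_gram exprMn -(@vnorm_unitary _ (P^t*) u) ?trmxC_unitary//.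
  rewrite sqr_vnorm mulr_sumr ler_sum// => j _.
  have [jJ|/spN jJ] := boolP (j \in J).
    by rewrite u0 1?inE ?jJ// normr0 expr0n !mulr0.
  by rewrite ler_wpM2r ?exprn_ge0.
rewrite leqNgt; apply/negP => iJ.
have /rowV0Pn[u] : (V :&: (coord_proj J *m P))%MS != 0.
  rewrite -mxrank_eq0; have := mxrank_sum_cap V (coord_proj J *m P).
  rewrite rank_coord_projM//; have := rank_leq_col (V + coord_proj J *m P)%MS.
  move: (\rank (V :&: _)%MS) (\rank (V + _)%MS) (#|J|) iJ => a b c /= *; lia.
rewrite sub_capmx => /andP[uV uJ] u0.
have := VA u uV; apply/negP; rewrite -real_ltNge ?realM ?ger0_real ?vnorm_ge0//.
rewrite -(@ltr_pXn2r _ 2) ?nnegrE ?mulr_ge0 ?vnorm_ge0//.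
rewrite sqr_vnorm_gram exprMn -(@vnorm_unitary _ (P^t*) u) ?trmxC_unitary//.
rewrite sqr_vnorm mulr_sumr.
have uJ0 := sub_coord_proj PU uJ.
have le j : t ^+ 2 * `|(u *m P^t*) 0 j| ^+ 2 <= sp 0 j * `|(u *m P^t*) 0 j| ^+ 2.
  have [jJ|jJ] := boolP (j \in J); last by rewrite uJ0// normr0 expr0n !mulr0.
  by rewrite ler_wpM2r ?exprn_ge0//; apply/ltW; move: jJ; rewrite inE.
have [j wj] : exists j, (u *m P^t*) 0 j != 0.
  apply/existsP; apply: contraNT u0; rewrite negb_exists => /forallP w0.
  have /eqP : u *m P^t* == 0.
    by apply/eqP/rowP => j; rewrite [RHS]mxE; apply/eqP; rewrite -[_ == _]negbK w0.
  by move=> /(congr1 (mulmx^~ P)); rewrite mul0mx mulmxKtV// => ->.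
rewrite (bigD1 j)//= [ltRHS](bigD1 j)//= ltr_leD ?ler_sum//.
rewrite ltr_pM2r ?exprn_gt0 ?normr_gt0//.
suff: j \in J by rewrite inE.
by apply: contraNT wj => /uJ0 ->.
Qed.

End gram.

End row_bounded.

Section singular_value_bounds.
Variable R : realType.

Lemma nth_sort_gt (s : seq R) t i : 0 <= t ->
  (t < (sort >=%O s)`_i) = (i < count (> t) s)%N.
Proof.
move=> t0; rewrite -(permP (permEl (perm_sort >=%O s))).
have := sort_sorted (@ge_total _ R) s; elim: (sort _ s) i => [|x l IH] i.
  by rewrite nth_nil ltNge t0.
move=> /= xl; case: (ltP t x) => [tx|xt].
  case: i => [|i] /=; first by rewrite tx.
  by rewrite add1n ltnS IH// (path_sorted xl).
have lx y : y \in l -> y <= x.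
  by move=> yl; have /allP := order_path_min (@ge_trans _ R) xl; exact.
have -> : count (> t) l = 0%N.
  apply/eqP; rewrite -leqn0 leqNgt -has_count; apply/hasPn => y /lx yx.
  by rewrite /= -leNgt (le_trans yx).
apply/negbTE; rewrite -leNgt; case: i => [|i] //=.
case: (ltnP i (size l)) => il; last by rewrite nth_default.
by apply: le_trans xt; rewrite lx// mem_nth.
Qed.

Variables (n : nat) (A : 'M[R[i]]_n).
Let M := A^t* *m A.

Lemma gram_spectral : M = (spectralmx M)^t* *m diag_mx (spectral_diag M) *m spectralmx M.
Proof.
rewrite -invmx_unitary ?spectral_unitarymx//; apply/orthomx_spectralP.
by apply/normalmxP; rewrite trmx_mul map_mxM /= trmxCK.
Qed.

Let sp_ge0 j : 0 <= spectral_diag M 0 j.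
Proof. exact: gram_ge0 (spectral_unitarymx M) gram_spectral j. Qed.

Lemma sigma_gt t i : 0 <= t ->
  (t < sigma A i) = (i < #|[set j | (t%:C ^+ 2 < spectral_diag M 0 j)%R]|)%N.
Proof.
move=> t0; rewrite /sigma /singular_values nth_sort_gt// count_map.
rewrite cardE /enum_mem size_filter; congr (_ < _)%N.
rewrite count_filter; apply: eq_count => j; rewrite /= !inE andbT -rmorphXn ltcE.
have := sp_ge0 j; rewrite -/M lecE => /andP[-> re0] /=.
rewrite -(@ltr_pXn2r _ 2) ?nnegrE ?sqrtr_ge0// sqr_sqrtr//.
Qed.

Lemma sigma_leP t i : 0 <= t ->
  sigma A i <= t <-> row_bounded (A^t*) i t%:C.
Proof.
move=> t0; rewrite leNgt sigma_gt// -leqNgt.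
by rewrite (row_bounded_gramP (spectral_unitarymx M) gram_spectral) ?ler0c.
Qed.

Lemma sigma_ge0 i : 0 <= sigma A i.
Proof.
rewrite /sigma; have [il|il] := ltnP i (size (singular_values A)); last first.
  by rewrite nth_default.
have := mem_nth 0 il; rewrite mem_sort => /mapP[j _ ->]; exact: sqrtr_ge0.
Qed.

Lemma sigma_nonincreasing i j : (i <= j)%N -> sigma A j <= sigma A i.
Proof.
move=> ij; apply/(sigma_leP _ (sigma_ge0 i)).
by apply: (row_bounded_le ij (lexx _)); apply/sigma_leP; rewrite ?sigma_ge0.
Qed.

End singular_value_bounds.

Section singular_value_calculus.
Variable R : realType.

Lemma normc_ge0 (x : R[i]) : 0 <= normc x.
Proof. by case: x => a b; exact: sqrtr_ge0. Qed.

Lemma sigmaD n (A B : 'M[R[i]]_n) i j :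
  sigma (A + B) (i + j) <= sigma A i + sigma B j.
Proof.
apply/sigma_leP; first by rewrite addr_ge0 ?sigma_ge0.
rewrite linearD /= map_mxD rmorphD.
by apply: row_boundedD; apply/sigma_leP; rewrite ?sigma_ge0.
Qed.

Lemma sigmaM n (A B : 'M[R[i]]_n) i j :
  sigma (A *m B) (i + j) <= sigma A i * sigma B j.
Proof.
apply/sigma_leP; first by rewrite mulr_ge0 ?sigma_ge0.
rewrite trmx_mul map_mxM rmorphM mulrC addnC.
apply: row_boundedM; first by rewrite ler0c sigma_ge0.
  by apply/sigma_leP; rewrite ?sigma_ge0.
by apply/sigma_leP; rewrite ?sigma_ge0.
Qed.

Lemma sigmaN n (A : 'M[R[i]]_n) i : sigma (- A) i = sigma A i.
Proof.
suff le (B : 'M[R[i]]_n) : sigma (- B) i <= sigma B i.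
  by apply/eqP; rewrite eq_le le -[X in sigma X i <= _]opprK le.
apply/sigma_leP; rewrite ?sigma_ge0// linearN map_mxN.
by apply: row_boundedN; apply/sigma_leP; rewrite ?sigma_ge0.
Qed.

Lemma sigma_rank n (A : 'M[R[i]]_n) i : (\rank A <= i)%N -> sigma A i = 0.
Proof.
move=> Ai; apply/eqP; rewrite eq_le sigma_ge0 andbT; apply/sigma_leP => //.
apply: (row_bounded_le Ai (lexx _)).
by rewrite -mxrank_tr -(mxrank_map Num.conj_op); exact: row_bounded_rank.
Qed.

Lemma sigma_size n (A : 'M[R[i]]_n) i : (n <= i)%N -> sigma A i = 0.
Proof. by move=> ni; rewrite sigma_rank// (leq_trans (rank_leq_row _)). Qed.

Lemma sigma_rows n (A : 'M[R[i]]_n) (J : {set 'I_n}) i : (#|J| <= i)%N ->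
  (forall i, i \notin J -> row i A = 0) -> sigma A i = 0.
Proof. by move=> Ji AJ; rewrite sigma_rank// (leq_trans (rank_rows AJ)). Qed.

Lemma unitary_diagM (C : numClosedFieldType) n (U : 'M[C]_n) (u v : 'rV[C]_n) :
  U \is unitarymx ->
  (U^t* *m diag_mx u *m U) *m (U^t* *m diag_mx v *m U) =
  U^t* *m diag_mx (\row_i (u 0 i * v 0 i)) *m U.
Proof.
move=> /unitarymxP UU; rewrite -!mulmxA (mulmxA U) UU mul1mx (mulmxA (diag_mx u)).
by rewrite mulmx_diag.
Qed.

Section diagonal.
Variables (n : nat) (U : 'M[R[i]]_n) (d : 'rV[R[i]]_n).
Hypothesis UU : U \is unitarymx.
Let A := U^t* *m diag_mx d *m U.

Let gramA : A^t* *m A = U^t* *m diag_mx (\row_j `|d 0 j| ^+ 2) *m U.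
Proof.
have -> : A^t* = U^t* *m diag_mx (map_mx Num.conj_op d) *m U.
  rewrite /A !trmx_mul !map_mxM /= trmxCK tr_diag_mx map_diag_mx.
  by rewrite mulmxA.
have -> : \row_j `|d 0 j| ^+ 2 = \row_j (map_mx Num.conj_op d 0 j * d 0 j).
  by apply/rowP => j; rewrite !mxE normCK mulrC.
exact: unitary_diagM.
Qed.

Lemma sigma_unitary_diag i :
  sigma A i = (sort >=%O [seq normc (d 0 j) | j <- enum 'I_n])`_i.
Proof.
have rhs0 : 0 <= (sort >=%O [seq normc (d 0 j) | j <- enum 'I_n])`_i.
  set s := sort _ _; have [il|il] := ltnP i (size s); last by rewrite nth_default.
  have := mem_nth 0 il; rewrite mem_sort => /mapP[j _ ->]; exact: normc_ge0.
have key t : 0 <= t -> (sigma A i <= t) =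
    ((sort >=%O [seq normc (d 0 j) | j <- enum 'I_n])`_i <= t).
  move=> t0; rewrite [RHS]leNgt nth_sort_gt// count_map -leqNgt.
  apply/idP/idP.
    move=> /(sigma_leP _ _ t0)/(row_bounded_gramP UU gramA).
    rewrite ler0c => /(_ t0); rewrite cardE /enum_mem size_filter count_filter.
    apply: leq_trans; rewrite leq_eqVlt; apply/orP; left; apply/eqP.
    apply: eq_count => j; rewrite /= !inE andbT !mxE -rmorphXn.
    rewrite -[`|d 0 j|]/((normc (d 0 j))%:C) -rmorphXn ltcR.
    by rewrite ltr_pXn2r ?nnegrE ?normc_ge0.
  move=> le; apply/(sigma_leP _ _ t0)/(row_bounded_gramP UU gramA).
    by rewrite ler0c.
  apply: leq_trans le; rewrite cardE /enum_mem size_filter count_filter.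
  rewrite leq_eqVlt; apply/orP; left; apply/eqP.
  apply: eq_count => j; rewrite /= !inE andbT !mxE -rmorphXn.
  rewrite -[`|d 0 j|]/((normc (d 0 j))%:C) -rmorphXn ltcR.
  by rewrite ltr_pXn2r ?nnegrE ?normc_ge0.
by apply/eqP; rewrite eq_le key// lexx /= -key ?sigma_ge0.
Qed.

Lemma sum_sigma_unitary_diag (V : nmodType) (F : R -> V) :
  \sum_(i < n) F (sigma A i) = \sum_(i < n) F (normc (d 0 i)).
Proof.
under eq_bigr do rewrite sigma_unitary_diag.
set s := sort _ _.
have sz : size s = n by rewrite size_sort size_map size_enum_ord.
have -> : \sum_(i < n) F s`_i = \sum_(x <- s) F x.
  by rewrite (big_nth 0) sz big_mkord.
rewrite (perm_big [seq normc (d 0 j) | j <- enum 'I_n]) ?perm_sort//=.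
by rewrite big_map big_enum.
Qed.

Lemma sigma_unitary_diag_le (J : {set 'I_n}) i t : 0 <= t -> (#|J| <= i)%N ->
  (forall j, j \notin J -> normc (d 0 j) <= t) -> sigma A i <= t.
Proof.
move=> t0 Ji dt; rewrite leNgt sigma_unitary_diag nth_sort_gt// count_map -leqNgt.
apply: leq_trans Ji; rewrite cardE /enum_mem size_filter count_filter.
apply: sub_count => j /=; rewrite !inE andbT; apply: contraTT => /dt.
by rewrite -leNgt.
Qed.

End diagonal.

End singular_value_calculus.

Section clipped_sums.
Variable R : realType.

Lemma sum_shift_le (a : nat -> R) M n k : (forall i, 0 <= a i <= M) ->
  \sum_(i < n) (a i - a (i + k)%N) <= k%:R * M.
Proof.
move=> aM; rewrite sumrB lerBlDl.
have M0 : 0 <= M by case/andP: (aM 0) => /le_trans; apply.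
have -> : \sum_(i < n) a (i + k)%N = \sum_(k <= i < k + n) a i.
  by rewrite -[X in index_iota X _]add0n big_addn addKn big_mkord.
have -> : \sum_(i < n) a i = \sum_(0 <= i < n) a i by rewrite big_mkord.
have key : \sum_(0 <= i < n) a i <= \sum_(0 <= i < k + n) a i.
  rewrite (big_cat_nat (n := n) (p := k + n))//= ?leq_addl// lerDl sumr_ge0//.
  by move=> i _; case/andP: (aM i).
apply: le_trans key _; rewrite (big_cat_nat (n := k)) ?leq_addr//= addrC lerD2l.
rewrite (_ : k%:R * M = \sum_(0 <= i < k) M) ?ler_sum// => [i _|].
  by case/andP: (aM i).
by rewrite sumr_const_nat subn0 mulr_natl.
Qed.

Lemma sum_clipped_le (s r : nat -> R) (M e : R) n k : 0 <= M -> 0 <= e ->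
  (forall i, 0 <= s i) -> (forall i, 0 <= r i) ->
  {homo s : i j / (i <= j)%N >-> j <= i} -> {homo r : i j / (i <= j)%N >-> j <= i} ->
  (forall i, s (i + k)%N <= r i + e) -> (forall i, r (i + k)%N <= s i + e) ->
  \sum_(i < n) `|Num.min (s i) M - Num.min (r i) M| <= k%:R * (2 * M) + n%:R * e.
Proof.
move=> M0 e0 s0 r0 sd rd sr rs.
pose a (s : nat -> R) i := Num.min (s i) M.
have aM (s' : nat -> R) : (forall i, 0 <= s' i) -> forall i, 0 <= a s' i <= M.
  by move=> s'0 i; rewrite /a le_min s'0 M0 ge_min lexx orbT.
have ad (s' : nat -> R) : {homo s' : i j / (i <= j)%N >-> j <= i} ->
    forall i, a s' (i + k)%N <= a s' i.
  by move=> s'd i; rewrite /a le_min !ge_min s'd ?leq_addr// lexx orbT.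
have le (s' r' : nat -> R) i : (forall i, r' (i + k)%N <= s' i + e) ->
    a r' (i + k)%N <= a s' i + e.
  move=> h; rewrite /a; have := h i; case: (leP (s' i) M) => sM; case: (leP (r' (i + k)%N) M) => rM; lra.
apply: (@le_trans _ _ (\sum_(i < n) (((a s i - a s (i + k)%N) + (a r i - a r (i + k)%N)) + e))).
  apply: ler_sum => i _; rewrite -/(a s i) -/(a r i) ler_norml.
  have := le _ _ i sr; have := le _ _ i rs; have := ad _ sd i; have := ad _ rd i.
  lra.
rewrite big_split/= big_split/= sumr_const card_ord -[e *+ n]mulr_natl lerD2r.
apply: le_trans (lerD (sum_shift_le n k (aM _ s0)) (sum_shift_le n k (aM _ r0))) _.
by rewrite (_ : _ + _ = k%:R * (2 * M))//; ring.
Qed.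

End clipped_sums.

(** * The block Fourier transform *)

Section windows.

Lemma big_window (V : nmodType) (F : nat -> V) (P : pred nat) n a c :
  (a <= c <= n)%N -> (forall i, (i < n)%N -> P i = (a <= i < c)%N) ->
  \sum_(i < n | P i) F i = \sum_(a <= i < c) F i.
Proof.
move=> /andP[ac cn] PE; rewrite (@big_nat_widenl _ _ _ a 0)// (big_nat_widen _ _ _ _ _ cn).
rewrite big_mkord; apply: eq_bigl => i.
by rewrite PE// andbC.
Qed.

Lemma card_le_mul n (J : {set 'I_n}) a c (f g : nat -> nat) :
  (forall i : 'I_n, i \in J -> f i < a /\ g i < c)%N ->
  (forall i j : 'I_n, i \in J -> j \in J -> f i = f j -> g i = g j -> i = j) ->
  (#|J| <= a * c)%N.
Proof.
move=> fg inj; have [->|[i0 i0J]] := set_0Vmem J; first by rewrite cards0.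
have [fa gc] := fg _ i0J; case: a c fa gc fg => // a [//|c] _ _ fg.
pose h (i : 'I_n) : 'I_a.+1 * 'I_c.+1 := (inord (f i), inord (g i)).
have hinj : {in J &, injective h}.
  move=> i j iJ jJ [/(congr1 val) /= + /(congr1 val) /= +].
  by rewrite !inordK ?(fg _ iJ).1 ?(fg _ iJ).2 ?(fg _ jJ).1 ?(fg _ jJ).2//; exact: inj.
rewrite -(card_in_imset hinj); apply: leq_trans (max_card _) _.
by rewrite card_prod !card_ord.
Qed.

End windows.

Section grid.
Local Open Scope nat_scope.
Variables (n b : nat).
Hypothesis b_gt0 : 0 < b.

(* Rows are grouped into consecutive blocks of size [b]; the last block may be
   smaller. *)
Definition blk i := i %/ b.
Definition pos i := i %% b.
Definition bsize i := minn b (n - blk i * b).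

Lemma blk_pos i : blk i * b + pos i = i. Proof. by rewrite -divn_eq. Qed.

Lemma pos_lt i : i < n -> pos i < bsize i.
Proof.
move=> i_n; rewrite leq_min ltn_mod b_gt0 /=.
by have := blk_pos i; lia.
Qed.

Lemma bsize_gt0 i : i < n -> 0 < bsize i.
Proof. by move=> /pos_lt; exact: leq_ltn_trans. Qed.

Lemma bsize_le i : bsize i <= b.
Proof. exact: geq_minl. Qed.

Lemma big_block (V : nmodType) (F : nat -> V) i : i < n ->
  (\sum_(j < n | blk j == blk i) F (pos j) = \sum_(s < bsize i) F s)%R.
Proof.
move=> i_n; have := pos_lt i_n; have := blk_pos i.
set q := blk i; set m := bsize i => ie pm.
have qn : q * b <= n by lia.
have mE : m = minn b (n - q * b) by [].
rewrite (@big_window _ (F \o pos) (fun j => blk j == q) n (q * b) (q * b + m)); last 2 first.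
- by rewrite leq_addr /= mE; lia.
- move=> j jn /=; rewrite /blk eqn_leq -ltnS ltn_divLR// leq_divRL// andbC mulSn addnC.
  rewrite mE; lia.
rewrite -[X in index_iota X _]add0n big_addn addKn big_mkord.
apply: eq_bigr => s _; rewrite /= /pos addnC modnMDl modn_small//.
exact: leq_trans (ltn_ord s) (bsize_le i).
Qed.

Lemma blk_bsize i j : blk i = blk j -> bsize i = bsize j.
Proof. by rewrite /bsize => ->. Qed.

Lemma blk_pos_inj i j : blk i = blk j -> pos i = pos j -> i = j.
Proof. by move=> e1 e2; rewrite -(blk_pos i) -(blk_pos j) e1 e2. Qed.

Lemma card_block_edges r (J : {set 'I_n}) :
  (forall i : 'I_n, i \in J -> pos i < r \/ bsize i <= pos i + r) ->
  #|J| <= 2 * (r * (n %/ b).+1).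
Proof.
move=> Jr; pose J1 := [set i : 'I_n in J | pos i < r].
pose J2 := [set i : 'I_n in J | bsize i <= pos i + r].
have -> : J = J1 :|: J2.
  apply/setP => i; rewrite !inE -andb_orr; case: (boolP (i \in J)) => //= /Jr h.
  by apply/esym/orP.
apply: leq_trans (leq_card_setU _ _) _; rewrite mul2n -addnn leq_add//.
  apply: (@card_le_mul _ _ _ _ pos blk) => [i|i j _ _ pE bE].
    by rewrite inE => /andP[_ ir]; split=> //; rewrite ltnS leq_div2r// ltnW.
  exact/val_inj/blk_pos_inj.
apply: (@card_le_mul _ _ _ _ (fun i => (bsize i).-1 - pos i) blk) => [i|i j _ _ pE bE].
  rewrite inE => /andP[_ ir]; split; last by rewrite ltnS leq_div2r// ltnW.
  by have := pos_lt (ltn_ord i); lia.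
apply/val_inj/blk_pos_inj => //=; have := blk_bsize bE.
have := pos_lt (ltn_ord i); have := pos_lt (ltn_ord j); lia.
Qed.

Lemma card_cell_edges K e (J : {set 'I_n}) : e <= 1 ->
  (forall i : 'I_n, i \in J -> (K * (blk i * b)) %/ n <> (K * (i + e)) %/ n) ->
  #|J| <= K.+1 * b.+1.
Proof.
move=> e1 Jne.
pose r i := (K * (i + e)) %/ n.
pose g i := i + e - (r i * n + K.-1) %/ K.
have key (i : 'I_n) : i \in J ->
   [/\ r i < K.+1, g i < b.+1 & (r i * n + K.-1) %/ K <= i + e].
  move=> iJ; have i_n := ltn_ord i; have n0 : 0 < n by lia.
  have K0 : 0 < K.
    by rewrite lt0n; apply/negP => /eqP K0; apply: (Jne i iJ); rewrite K0 !mul0n.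
  have rK : r i < K.+1.
    by rewrite ltnS -(mulnK K n0) leq_div2r// leq_mul2l; apply/orP; right; lia.
  have r1 : r i * n <= K * (i + e) by exact: leq_divM.
  have r2 : K * (blk i * b) < r i * n.
    rewrite -ltn_divLR// ltn_neqAle (introN eqP (Jne i iJ))//=.
    by rewrite leq_div2r// leq_mul2l; apply/orP; right; have := blk_pos i; lia.
  have c1 : (r i * n + K.-1) %/ K <= i + e.
    by rewrite -ltnS ltn_divLR// mulSn; lia.
  have c2 : blk i * b < (r i * n + K.-1) %/ K.
    by rewrite leq_divRL// mulSn; lia.
  split=> //; rewrite /g; have := blk_pos i.
  have : pos i < b by rewrite ltn_mod.
  lia.
apply: (@card_le_mul _ _ _ _ r g) => [i /key[]//|i j /key[_ _ i1] /key[_ _ j1] rE].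
rewrite /g rE; rewrite rE in i1 => gE; apply/val_inj => /=; lia.
Qed.

End grid.

Lemma count_cell_bounds m K r : (0 < m)%N -> (r < K)%N ->
  let c := #|[set s : 'I_m | ((K * s) %/ m == r)%N]| in
  (c * K <= m + K)%N && (m <= c * K + K)%N.
Proof.
move=> m0 rK; have K0 : (0 < K)%N by lia.
pose a r := ((r * m + K.-1) %/ K)%N.
have a1 u : (a u * K <= u * m + K.-1)%N by exact: leq_divM.
have a2 u : (u * m <= a u * K)%N.
  have := ltn_ceil (u * m + K.-1) K0; rewrite -/(a u) mulSn; lia.
have a_le u i : (a u <= i)%N = (u * m <= K * i)%N.
  by rewrite -ltnS ltn_divLR// mulSn; apply/idP/idP; lia.
have -> : #|[set s : 'I_m | ((K * s) %/ m == r)%N]| = (a r.+1 - a r)%N.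
  rewrite -sum1_card; under eq_bigl do rewrite inE.
  rewrite (@big_window nat (fun _ => 1%N) (fun s => (K * s) %/ m == r)%N _ (a r) (a r.+1)).
  - by rewrite sum_nat_const_nat muln1.
  - by rewrite (a_le r) (a_le r.+1) leq_mul2r rK orbT andbT; have := a2 r.+1; rewrite mulSn; lia.
  - move=> i im; rewrite a_le [(i < _)%N]ltnNge a_le -ltnNge eqn_leq andbC.
    by rewrite leq_divRL// -[(_ %/ m <= r)%N]ltnS ltn_divLR.
have := a1 r; have := a1 r.+1; have := a2 r; have := a2 r.+1.
rewrite mulSn; move: (a r) (a r.+1) => x y *; apply/andP; split; rewrite mulnBl; lia.
Qed.

Section expi_theory.
Variable R : realType.
Implicit Types x y : R.

Lemma expiD x y : expi (x + y) = expi x * expi y.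
Proof.
rewrite /expi cosD sinD; apply/eqP; rewrite eq_complex /= eqxx /=.
by apply/eqP; ring.
Qed.

Lemma expi0 : expi (0 : R) = 1.
Proof. by rewrite /expi cos0 sin0. Qed.

Lemma expiMn x k : expi (k%:R * x) = expi x ^+ k.
Proof.
elim: k => [|k IH]; first by rewrite mul0r expi0 expr0.
by rewrite -addn1 natrD mulrDl mul1r expiD IH exprD expr1.
Qed.

Lemma expi_conj x : (expi x)^* = expi (- x).
Proof. by rewrite /expi cosN sinN. Qed.

Lemma normc_expi x : normc (expi x) = 1.
Proof. by rewrite /normc /expi cos2Dsin2 sqrtr1. Qed.

Lemma expi_2pi_int (d : int) : expi (2 * pi * d%:~R : R) = 1.
Proof.
have e1 : expi (2 * pi : R) = 1 by rewrite /expi mulr_natl cos2pi sin2pi.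
case: d => k; first by rewrite mulrC expiMn e1 expr1n.
by rewrite NegzE mulrNz mulrN -expi_conj mulrC expiMn e1 expr1n conjc1.
Qed.

Lemma expi_neq1 x : 0 < `|x| < 2 * pi -> expi x != 1.
Proof.
wlog x0 : x / 0 < x => [H|] hx.
  have [x0|x0] := ltP 0 x; first exact: H.
  have : expi (- x) != 1.
    apply: H; rewrite ?normrN// oppr_gt0 lt_neqAle x0 andbT.
    by apply: contraTneq hx => ->; rewrite normr0 ltxx.
  by apply: contraNneq => xE; rewrite -expi_conj xE conjc1.
rewrite gtr0_norm// in hx; case/andP: hx => _ x2.
rewrite eq_complex negb_and; apply/orP; left => /=.
have -> : x = (x / 2) *+ 2 by rewrite -mulr_natr; field.
rewrite cos_mulr2n cos2sin2.
have : 0 < sin (x / 2) by rewrite sin_gt0_pi// divr_gt0//= ltr_pdivrMr// mulrC.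
move: (sin _) => s s0; have : 0 < s ^+ 2 by rewrite exprn_gt0.
by move: (s ^+ 2) => t t0; apply/eqP; lra.
Qed.

Lemma sum_expi m (d : int) : (0 < m)%N -> (`|d| < m)%N ->
  \sum_(s < m) expi (s%:R * (2 * pi * d%:~R / m%:R) : R) = (m * (d == 0))%:R.
Proof.
move=> m0 dm; have mR : m%:R != 0 :> R by rewrite pnatr_eq0 -lt0n.
have [->|d0] := eqVneq d 0.
  under eq_bigr do rewrite mulr0z mulr0 mul0r mulr0 expi0.
  by rewrite sumr_const card_ord muln1.
rewrite muln0; under eq_bigr do rewrite expiMn.
set z := expi _; have z1 : z != 1.
  apply: expi_neq1; rewrite !normrM normfV [`|2|]ger0_norm// [`|pi|]ger0_norm ?pi_ge0//.
  rewrite [`|m%:R|]ger0_norm//; apply/andP; split.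
    rewrite !mulr_gt0 ?pi_gt0 ?invr_gt0 ?ltr0n// normr_gt0 intr_eq0//.
  rewrite ltr_pdivrMr ?ltr0n// ltr_pM2l ?mulr_gt0 ?pi_gt0//.
  by rewrite -intr_norm -[m%:R]/(m%:~R) ltr_int; lia.
have := subrX1 z m; rewrite -expiMn mulrC divfK// expi_2pi_int subrr.
move=> /esym/eqP; rewrite mulf_eq0 subr_eq0 (negbTE z1) /=.
by move=> /eqP.
Qed.

End expi_theory.

Section block_dft.
Variables (R : realType) (n b : nat).
Hypothesis b_gt0 : (0 < b)%N.

Definition angle i : R := - pi + 2 * pi * (pos b i)%:R / (bsize n b i)%:R.

Definition block_dft : 'M[R[i]]_n := \matrix_(i, j)
  (if blk b j == blk b i then
    expi ((pos b j)%:R * angle i) / (Num.sqrt (bsize n b i)%:R)%:C else 0).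

Let bR i : (i < n)%N -> (bsize n b i)%:R != 0 :> R.
Proof. by move=> i_n; rewrite pnatr_eq0 -lt0n bsize_gt0. Qed.

Let sqrtb i : (i < n)%N ->
  (Num.sqrt (bsize n b i)%:R)%:C^-1 * (Num.sqrt (bsize n b i)%:R)%:C^-1 = (bsize n b i)%:R^-1 :> R[i].
Proof.
by move=> i_n; rewrite -invfM -rmorphM -expr2 sqr_sqrtr// rmorph_nat.
Qed.

Lemma block_dft_unitary : block_dft \is unitarymx.
Proof.
apply/unitarymxP/matrixP => i k; rewrite !mxE.
have [bik|bik] := eqVneq (blk b i) (blk b k); last first.
  have -> : (i == k) = false by apply/negP => /eqP ik; rewrite ik eqxx in bik.
  rewrite big1// => j _; rewrite !mxE; case: (eqVneq (blk b j) (blk b i)) => [->|_].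
    by rewrite (negbTE bik) conjC0 mulr0.
  by rewrite mul0r.
have ebs : bsize n b k = bsize n b i by apply: blk_bsize.
pose d : int := (pos b i)%:Z - (pos b k)%:Z.
transitivity (\sum_(j < n | blk b j == blk b i)
    (bsize n b i)%:R^-1 * expi ((pos b j)%:R * (2 * pi * d%:~R / (bsize n b i)%:R)) : R[i]).
  rewrite [RHS]big_mkcond /=; apply: eq_bigr => j _; rewrite !mxE -bik ebs.
  case: ifP => [_|_]; last by rewrite mul0r.
  rewrite rmorphM /= fmorphV /= -[Num.conj_op (expi _)]/((expi _)^*) expi_conj.
  rewrite -[Num.conj_op _%:C]/(_%:C^*) conjc_real mulrACA -expiD sqrtb// mulrC.
  congr (_ * expi _); rewrite /angle ebs /d rmorphB /= -mulrBr.
  by congr (_ * _); field; exact: bR.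
rewrite -mulr_sumr (@big_block n b b_gt0 _ (fun s => expi (s%:R * (2 * pi * d%:~R / (bsize n b i)%:R))) i)//.
rewrite sum_expi ?bsize_gt0//; last first.
  by rewrite /d; have := pos_lt b_gt0 (ltn_ord i); have := pos_lt b_gt0 (ltn_ord k); rewrite ebs; lia.
have -> : (d == 0) = (i == k).
  rewrite /d; apply/idP/eqP => [|->]; last by rewrite subrr.
  by rewrite subr_eq0 => /eqP[p]; apply/val_inj/(@blk_pos_inj b).
case: (i == k); last by rewrite muln0 mulr0.
by rewrite muln1 mulVf// pnatr_eq0 -lt0n bsize_gt0.
Qed.

Definition shift_mx (l : int) : 'M[R[i]]_n :=
  \matrix_(i, j) (i%:Z - j%:Z == l)%:R.

Definition dft_diag (d : 'rV[R[i]]_n) : 'M[R[i]]_n :=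
  block_dft^t* *m diag_mx d *m block_dft.

(* Away from the block edges, the block circulant with symbol [exp(i l theta)]
   coincides with the shift. *)
Lemma dft_diag_expi_row (l : int) (p : 'I_n) :
  (`|l| <= pos b p)%N -> (pos b p + `|l| < bsize n b p)%N ->
  row p (dft_diag (\row_i expi (l%:~R * angle i))) = row p (shift_mx l).
Proof.
move=> l1 l2; apply/rowP => j; rewrite mxE [RHS]mxE /dft_diag mul_mx_diag mxE.
have pj := pos_lt b_gt0 (ltn_ord j); have pp := pos_lt b_gt0 (ltn_ord p).
pose d : int := (pos b j)%:Z - (pos b p)%:Z + l.
have [bpj|bpj] := eqVneq (blk b j) (blk b p); last first.
  rewrite big1 => [|i _]; last first.
    rewrite !mxE; case: (eqVneq (blk b p) (blk b i)) => [pi|_].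
      by rewrite -pi (negbTE bpj) mulr0.
    by rewrite conjC0 !mul0r.
  rewrite mxE; case: eqP => // e; case/eqP: bpj.
  have := blk_pos b j; have := blk_pos b p => ep ej.
  have pos_le : (pos b p < b)%N by rewrite ltn_mod.
  have le : (bsize n b p <= b)%N := bsize_le n b p.
  have : (blk b p * b <= j < (blk b p).+1 * b)%N by rewrite mulSn; lia.
  by case/andP => h1 h2; apply/eqP; rewrite eqn_leq -ltnS ltn_divLR// h2 leq_divRL.
have ebs : bsize n b j = bsize n b p by apply: blk_bsize.
transitivity (\sum_(i < n | blk b i == blk b p)
    (bsize n b p)%:R^-1 * (expi (- pi * d%:~R) * expi ((pos b i)%:R * (2 * pi * d%:~R / (bsize n b p)%:R))) : R[i]).
  rewrite [RHS]big_mkcond /=; apply: eq_bigr => i _; rewrite !mxE bpj eq_sym.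
  case: eqP => [bi|_]; last by rewrite conjC0 !mul0r.
  have ei : bsize n b i = bsize n b p by apply: blk_bsize.
  rewrite rmorphM /= fmorphV /= -[Num.conj_op (expi _)]/((expi _)^*) expi_conj.
  rewrite -[Num.conj_op _%:C]/(_%:C^*) conjc_real -mulrA mulrACA ei.
  rewrite [_^-1 * (_ / _)]mulrCA sqrtb// [LHS]mulrA [LHS]mulrC; congr (_ * _).
  rewrite -!expiD; congr expi; rewrite /angle ei /d rmorphD rmorphB /=.
  by field; exact: bR.
rewrite -mulr_sumr -mulr_sumr (@big_block n b b_gt0 _ (fun s => expi (s%:R * (2 * pi * d%:~R / (bsize n b p)%:R))) p)//.
rewrite sum_expi ?bsize_gt0//; last by rewrite /d; lia.
rewrite mxE; have -> : (p%:Z - j%:Z == l) = (d == 0).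
  rewrite /d; have := blk_pos b j; have := blk_pos b p; rewrite bpj => ep ej.
  by apply/eqP/eqP; lia.
case: (eqVneq d 0) => [->|_]; last by rewrite muln0 !mulr0.
by rewrite mulr0 expi0 mul1r muln1 mulVf// pnatr_eq0 -lt0n bsize_gt0.
Qed.

End block_dft.

Local Open Scope classical_set_scope.
Local Open Scope ring_scope.
Local Open Scope complex_scope.
Local Open Scope sesquilinear_scope.

(** * Smallness of sequences and of symbols *)

Section smallness.
Variable R : realType.
Local Notation area := (fine (muD R (D R))).

Lemma muDE : muD R (D R) = (2 * pi)%:E.
Proof.
rewrite /muD /= /mrestr setIid /D product_measure1E ?measurable_itv//.
rewrite /= !lebesgue_measure_itv/= !lte_fin ltr01 gtrN ?pi_gt0//.
by rewrite -!EFinB -EFinM; congr EFin; rewrite subr0 mul1r opprK; ring.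
Qed.

Lemma area_gt0 : 0 < area.
Proof. by rewrite muDE /= mulr_gt0 ?pi_gt0. Qed.

Lemma muD_setT : muD R setT = muD R (D R).
Proof. by rewrite /muD /= /mrestr setTI setIid. Qed.

Lemma muD_le_area A : measurable A -> (muD R A <= area%:E)%E.
Proof.
by move=> mA; rewrite muDE /= -muDE -muD_setT le_measure ?inE.
Qed.

Lemma muD_fin_num A : measurable A -> muD R A \is a fin_num.
Proof.
move=> mA; rewrite ge0_fin_numE// (le_lt_trans (muD_le_area mA))//.
by rewrite ltry.
Qed.

Lemma ae_muD : \forall x \ae muD R, D R x.
Proof.
exists (~` D R); split => //; first by apply: measurableC; exact: measurable_D.
by rewrite /muD /= /mrestr setICl measure0.
Qed.

Lemma ae_muDP (P : R * R -> Prop) :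
  (\forall x \ae muD R, D R x -> P x) -> \forall x \ae muD R, P x.
Proof. by move=> h; apply: filterS2 h ae_muD => x; apply. Qed.

(* [acs_small A e e] corresponds to d_acs(A, 0) <= e; a bound [t] separate from
   the exceptional fraction [a] is needed for products. *)
Definition acs_small (A : mxseq R) (a t : R) : Prop :=
  \forall n \near \oo,
    exists2 i : nat, i%:R <= a * n.+1%:R & sigma (A n) i <= t.

Definition measure_small (f : M_D R) (a t : R) : Prop :=
  exists B, [/\ measurable B, (muD R B <= (a * area)%:E)%E &
    \forall x \ae muD R, ~ B x -> normc (f x) <= t].

Definition small (z : ExM_D R) (a t : R) : Prop :=
  acs_small z.1 a t /\ measure_small z.2 a t.

Lemma small_le z a t a' t' : a <= a' -> t <= t' -> small z a t -> small z a' t'.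
Proof.
move=> aa tt [h [B [mB B1 B2]]]; split.
  apply: filterS h => n [i i1 i2]; exists i; last exact: le_trans tt.
  by apply: le_trans i1 _; rewrite ler_wpM2r.
exists B; split=> //; first by apply: le_trans B1 _; rewrite lee_fin ler_wpM2r// ltW ?area_gt0.
by apply: filterS B2 => x h2 /h2 /le_trans; apply.
Qed.

Lemma acs_smallD A B a t b s : acs_small A a t -> acs_small B b s ->
  acs_small (A + B) (a + b) (t + s).
Proof.
move=> hA hB; apply: filterS2 hA hB => n [i i1 i2] [j j1 j2]; exists (i + j)%N.
  by rewrite natrD mulrDl lerD.
exact: le_trans (sigmaD _ _ _ _) (lerD i2 j2).
Qed.

Lemma acs_smallZ c A a t : acs_small A a t -> acs_small (c *: A) a (normc c * t).
Proof.
apply: filterS => n [i i1 i2]; exists i => //.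
rewrite -[(c *: A) n]/(c *: A n) -mul_scalar_mx -(add0n i).
apply: le_trans (sigmaM _ _ _ _) _; rewrite ler_pM ?sigma_ge0//.
have -> : c%:M = (1%:M)^t* *m diag_mx (const_mx c) *m 1%:M :> 'M[R[i]]_n.+1.
  by rewrite trmx1 map_mx1 mul1mx mulmx1 diag_const_mx.
apply: (@sigma_unitary_diag_le _ _ _ _ _ finset.set0); rewrite ?cards0 ?normc_ge0//.
  by apply/unitarymxP; rewrite trmx1 map_mx1 mulmx1.
by move=> j _; rewrite mxE.
Qed.

Lemma smallD x y a t b s : small x a t -> small y b s -> small (x + y) (a + b) (t + s).
Proof.
move=> [hx [B [mB B1 B2]]] [hy [B' [mB' B1' B2']]]; split.
  exact: acs_smallD.
exists (B `|` B'); split; first exact: measurableU.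
  apply: le_trans (measureU2 _ _ _) _ => //.
  by rewrite mulrDl EFinD leeD.
apply: filterS3 (aeclassDE x.2 y.2) B2 B2' => p /= -> h h' /not_orP[/h h1 /h' h2].
exact: le_trans (le_normcD _ _) (lerD h1 h2).
Qed.

Lemma smallM x y a t b s : 0 <= t -> 0 <= s ->
  small x a t -> small y b s -> small (x * y) (a + b) (t * s).
Proof.
move=> t0 s0 [hx [B [mB B1 B2]]] [hy [B' [mB' B1' B2']]]; split.
  apply: filterS2 hx hy => n [i i1 i2] [j j1 j2]; exists (i + j)%N.
    by rewrite natrD mulrDl lerD.
  by apply: le_trans (sigmaM _ _ _ _) _; rewrite ler_pM ?sigma_ge0.
exists (B `|` B'); split; first exact: measurableU.
  apply: le_trans (measureU2 _ _ _) _ => //.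
  by rewrite mulrDl EFinD leeD.
apply: filterS3 (aeclassME x.2 y.2) B2 B2' => p /= -> h h' /not_orP[/h h1 /h' h2].
by rewrite normcM ler_pM ?normc_ge0.
Qed.

Lemma smallZ c x a t : small x a t -> small (c *: x) a (normc c * t).
Proof.
move=> [hx [B [mB B1 B2]]]; split.
  exact: acs_smallZ.
exists B; split=> //.
apply: filterS2 (aeclassZE c x.2) B2 => p -> h /h h1.
by rewrite normcM ler_wpM2l ?normc_ge0.
Qed.

Lemma p_acs_le n (A : 'M[R[i]]_n.+1) i : (i <= n.+1)%N ->
  p_acs A <= i%:R / n.+1%:R + sigma A i.
Proof.
move=> i_n; have i_n2 : (i < n.+2)%N by [].
exact: (bigmin_le_cond _ _ (j := Ordinal i_n2)).
Qed.

Lemma p_acs_le1 n (A : 'M[R[i]]_n.+1) : p_acs A <= 1.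
Proof. exact: bigmin_le_id. Qed.

Lemma p_acs_lt n (A : 'M[R[i]]_n.+1) e : p_acs A < e ->
  exists2 i, (i <= n.+1)%N & i%:R / n.+1%:R + sigma A i < e.
Proof.
move=> /bigmin_ltP[h|[i _ h]]; last by exists i => //; rewrite -ltnS.
by exists n.+1 => //; rewrite divff ?pnatr_eq0// sigma_size// addr0.
Qed.

Lemma d_acs_lt_small A B e : (d_acs A B < e%:E)%E -> acs_small (A - B) e e.
Proof.
rewrite /d_acs /limn_esup /limf_esup => /ereal_inf_lt[_ [V Voo <-] Ve].
apply: filterS Voo => n Vn.
have : ((p_acs (A n - B n))%:E < e%:E)%E.
  by apply: le_lt_trans Ve; apply: ereal_sup_ubound; exists n.
rewrite lte_fin => /p_acs_lt[i i_n ie]; exists i.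
  rewrite -ler_pdivrMr ?ltr0n//; apply/ltW.
  by apply: le_lt_trans ie; rewrite lerDl sigma_ge0.
by apply/ltW; apply: le_lt_trans ie; rewrite lerDr divr_ge0.
Qed.

Lemma small_d_acs_le A B e : 0 <= e -> acs_small (A - B) e e ->
  (d_acs A B <= (e *+ 2)%:E)%E.
Proof.
move=> e0 h; rewrite /d_acs /limn_esup /limf_esup.
apply: ge_ereal_inf; exists (ereal_sup ((fun n => (p_acs (A n - B n))%:E) @`
  [set n | exists2 i : nat, i%:R <= e * n.+1%:R & sigma ((A - B) n) i <= e])).
  by eexists; [exact: h|].
apply: ge_ereal_sup => _ [n [i i1 i2] <-]; rewrite lee_fin.
have [i_n|i_n] := leqP i n.+1.
  apply: le_trans (p_acs_le _ i_n) _; rewrite mulr2n lerD//.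
  by rewrite ler_pdivrMr ?ltr0n.
apply: le_trans (p_acs_le1 _) _.
have : 1 <= e.
  rewrite -(ler_pM2r (x := n.+1%:R)) ?ltr0n// mul1r (le_trans _ i1)//.
  by rewrite ler_nat ltnW.
by rewrite mulr2n => /le_trans; apply; rewrite lerDl.
Qed.

Lemma p_m_lt_small (f : M_D R) e : (p_m f < e%:E)%E -> measure_small f e e.
Proof.
move=> /ereal_inf_lt[_ [E [mE ED] <-] h].
have ess0 : (0 <= ess_sup (muD R) ((fun x => (normc (f x))%:E) \_ E))%E.
  apply: ess_sup_gee; first by rewrite muD_setT muDE lte_fin mulr_gt0 ?pi_gt0.
  by apply: nearW => x; rewrite patchE; case: ifP; rewrite // lee_fin normc_ge0.
have q0 : 0 <= fine (muD R (D R `\` E)) / area.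
  by rewrite divr_ge0 ?fine_ge0.
have mDE : measurable (D R `\` E) by apply: measurableD => //; exact: measurable_D.
exists (D R `\` E); split=> //.
  rewrite -[muD R _]fineK ?muD_fin_num// lee_fin -ler_pdivrMr ?area_gt0//.
  rewrite -lee_fin; apply/ltW; apply: le_lt_trans h.
  by rewrite leeDl.
have : (ess_sup (muD R) ((fun x => (normc (f x))%:E) \_ E) <= e%:E)%E.
  by apply/ltW; apply: le_lt_trans h; rewrite leeDr// lee_fin.
move=> /ess_supP h1; apply: ae_muDP; apply: filterS h1 => x + Dx nDE.
by rewrite patchE ifT ?lee_fin// inE; apply: contrapT => nE; apply: nDE.
Qed.

Lemma small_p_m_le (f : M_D R) e : 0 <= e -> measure_small f e e ->
  (p_m f <= (e *+ 2)%:E)%E.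
Proof.
move=> e0 [B [mB B1 B2]]; apply: ge_ereal_inf.
have mDB : measurable (D R `\` B) by apply: measurableD => //; exact: measurable_D.
have mDDB : measurable (D R `\` (D R `\` B)) by apply: measurableD => //; exact: measurable_D.
eexists; first by exists (D R `\` B); [split; [exact: mDB|exact: subDsetl]|reflexivity].
rewrite mulr2n EFinD leeD//.
  rewrite lee_fin ler_pdivrMr ?area_gt0// -lee_fin fineK ?muD_fin_num//.
  apply: le_trans B1; apply: le_measure; rewrite ?inE// => x [Dx nDB].
  by apply: contrapT => nB; apply: nDB.
apply/ess_supP; apply: filterS B2 => x h; rewrite patchE.
case: ifPn; rewrite lee_fin// inE => -[_ /h]; exact.
Qed.

Lemma small_closureP (S : set (ExM_D R)) x : closure_acs_m S x <->
  forall e, 0 < e -> exists2 y, S y & small (x - y) e e.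
Proof.
split=> h e e0.
  have [y [Sy h1 h2]] := h _ e0; exists y => //; split; first exact: d_acs_lt_small.
  exact: p_m_lt_small.
have e4 : 0 < e / 4 by rewrite divr_gt0.
have [y Sy [h1 h2]] := h _ e4; exists y; split=> //.
  apply: le_lt_trans (small_d_acs_le (ltW e4) h1) _; rewrite lte_fin; lra.
by apply: le_lt_trans (small_p_m_le (ltW e4) h2) _; rewrite lte_fin; lra.
Qed.

End smallness.

(** * The model algebra *)

Section block_size.
Variable R : realType.

(* The block size is about the square root of the matrix size, so that both the
   blocks and their number grow. *)
Definition bsz n : nat := \max_(i < n.+2 | (i * i <= n.+1)%N) i.

Lemma bsz_bounds n : (bsz n * bsz n <= n.+1)%N && (n.+1 < (bsz n).+1 * (bsz n).+1)%N.
Proof.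
apply/andP; split.
  have [|i i1 i2] := @eq_bigmax_cond _ [pred i : 'I_n.+2 | (i * i <= n.+1)%N] (@nat_of_ord _).
    by apply/card_gt0P; exists ord0; rewrite inE.
  by rewrite /bsz i2; exact: i1.
rewrite ltnNge; apply/negP => h.
have bn : ((bsz n).+1 < n.+2)%N by rewrite ltnS; nia.
have := @leq_bigmax_cond _ [pred i : 'I_n.+2 | (i * i <= n.+1)%N] (@nat_of_ord _) (Ordinal bn) h.
by rewrite /= -/(bsz n) ltnn.
Qed.

Lemma bsz_gt0 n : (0 < bsz n)%N.
Proof. by case/andP: (bsz_bounds n); case: (bsz n). Qed.

Lemma bsz_cvg L : \forall n \near \oo, (L <= bsz n)%N.
Proof.
exists (L * L)%N => // n /= Ln; rewrite leqNgt; apply/negP => bL.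
case/andP: (bsz_bounds n) => _; nia.
Qed.

Lemma block_count_small (C : nat) (e : R) : 0 < e ->
  \forall n \near \oo, (C * (n.+1 %/ bsz n + bsz n + 2))%:R <= e * n.+1%:R.
Proof.
move=> e0; apply: filterS (bsz_cvg (Num.truncn ((6 * C)%:R / e)).+1) => n Lb.
case/andP: (bsz_bounds n) => b1 b2; have b0 := bsz_gt0 n.
have le1 : (n.+1 %/ bsz n <= bsz n + 2)%N.
  by rewrite -ltnS ltn_divLR//; nia.
apply: (@le_trans _ _ ((6 * C)%:R * (bsz n)%:R)).
  by rewrite -natrM ler_nat; nia.
have le2 : (6 * C)%:R <= e * (bsz n)%:R.
  rewrite mulrC -ler_pdivrMr//; apply: le_trans (_ : (Num.truncn ((6 * C)%:R / e)).+1%:R <= _).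
    by rewrite ltW// truncnS_gt.
  by rewrite ler_nat.
apply: (@le_trans _ _ (e * (bsz n)%:R * (bsz n)%:R)); first by rewrite ler_wpM2r.
by rewrite -mulrA -natrM ler_wpM2l ?(ltW e0)// ler_nat.
Qed.

End block_size.

Section step_model.
Variable R : realType.
Implicit Types (c : nat -> nat -> R[i]) (K : nat).

Lemma measurable_fun_nat2 d (T : measurableType d) d' (T' : measurableType d')
    (g h : T -> nat) (F : nat -> nat -> T') :
  (forall i, measurable [set x | g x = i]) -> (forall i, measurable [set x | h x = i]) ->
  measurable_fun setT (fun x => F (g x) (h x)).
Proof.
move=> mg mh _ B mB; rewrite setTI.
rewrite (_ : _ @^-1` _ = \bigcup_i \bigcup_j
   (if `[< B (F i j) >] then [set x | g x = i] `&` [set x | h x = j] else set0)).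
  apply: bigcup_measurable => i _; apply: bigcup_measurable => j _.
  by case: ifP => // _; exact: measurableI.
apply/seteqP; split => [x Bx|x [i _ [j _]]].
  by exists (g x) => //; exists (h x) => //; rewrite asboolT.
by case: ifP => // /asboolP Bij [/= -> ->].
Qed.

Lemma truncn_eqE (x : R) i : (Num.truncn x == i) = ((i == 0) && (x < 1)) || (i%:R <= x < i.+1%:R).
Proof.
have [x0|x0] := leP 0 x; last first.
  have -> : Num.truncn x = 0%N by apply/eqP; rewrite -leqn0 truncn_le_nat (lt_trans x0).
  rewrite eq_sym (lt_trans x0)// andbT; case: i => [|i] //=.
  by rewrite leNgt (lt_le_trans x0).
rewrite truncn_eq//; case: eqP => //= ->.
by rewrite x0 orbb.
Qed.

Lemma measurable_truncn_fiber d (T : measurableType d) (f : T -> R) i :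
  measurable_fun setT f -> measurable [set x | Num.truncn (f x) = i].
Proof.
move=> mf; rewrite (_ : [set x | _] = f @^-1` [set` if i == 0%N then `]-oo, 1%R[ else `[i%:R, i.+1%:R[]).
  by rewrite -[X in measurable X]setTI; apply: mf => //; exact: measurable_itv.
apply/seteqP; split => x /=.
  move=> /eqP; rewrite truncn_eqE; case: ifP => [/eqP ->|_] /=; rewrite in_itv //=.
  by case/orP => // /andP[].
case: ifP => [/eqP ->|i0]; rewrite /= in_itv /= => h; apply/eqP; rewrite truncn_eqE.
  by rewrite h.
by rewrite h orbT.
Qed.

Definition cellx K (p : R * R) : nat := Num.truncn (K%:R * p.1).
Definition cellt K (p : R * R) : nat := Num.truncn (K%:R * ((p.2 + pi) / (2 * pi))).

Lemma measurable_cellx K i :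
  measurable [set p : measurableTypeR R * measurableTypeR R | cellx K p = i].
Proof.
by apply: measurable_truncn_fiber; apply: measurable_funM.
Qed.

Lemma measurable_cellt K i :
  measurable [set p : measurableTypeR R * measurableTypeR R | cellt K p = i].
Proof.
apply: measurable_truncn_fiber; apply: measurable_funM => //.
by apply: measurable_funM => //; apply: measurable_funD => //; exact: measurable_snd.
Qed.

Definition step_fun K c (p : measurableTypeR R * measurableTypeR R) : R[i] :=
  c (cellx K p) (cellt K p).

Lemma measurable_step_fun K c : measurable_fun setT (step_fun K c).
Proof.
exact: (measurable_fun_nat2 _ (@measurable_cellx K) (@measurable_cellt K)).
Qed.

Definition step_class K c : M_D R :=
  @aeclass_of _ _ R (muD R) _ (measurable_step_fun K c).

Lemma step_classE K c : \forall p \ae muD R, step_class K c p = step_fun K c p.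
Proof.
by apply: filterS (aeclass_ofE (muD R) (measurable_step_fun K c)) => p; apply.
Qed.

Definition sample K c n : 'rV[R[i]]_n.+1 := \row_i
  c ((K * (blk (bsz n) i * bsz n)) %/ n.+1)%N
    ((K * pos (bsz n) i) %/ bsize n.+1 (bsz n) i)%N.

Definition step_mx K c : mxseq R := fun n => dft_diag (bsz n) (sample K c n).

Definition step_pair K c : ExM_D R := (step_mx K c, step_class K c).

Definition step_pairs : set (ExM_D R) :=
  [set z | exists K c, (0 < K)%N /\ z = step_pair K c].

Lemma dft_diagZD n b (a : R[i]) (u v : 'rV[R[i]]_n) :
  dft_diag b (a *: u + v) = a *: dft_diag b u + dft_diag b v.
Proof.
rewrite /dft_diag linearD linearZ /= mulmxDr mulmxDl.
by rewrite -scalemxAr -scalemxAl.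
Qed.

Lemma dft_diagM n b (u v : 'rV[R[i]]_n) : (0 < b)%N ->
  dft_diag b u *m dft_diag b v = dft_diag b (\row_i (u 0 i * v 0 i)).
Proof.
by move=> b0; apply: unitary_diagM; exact: block_dft_unitary.
Qed.

Lemma step_class_ext (f : M_D R) K c :
  (\forall p \ae muD R, f p = step_fun K c p) -> f = step_class K c.
Proof.
move=> h; apply/aeclassP; apply: filterS2 h (step_classE K c) => p -> -> _ //.
Qed.

Lemma step_pairZD K c c' (a : R[i]) :
  a *: step_pair K c + step_pair K c' = step_pair K (fun i j => a * c i j + c' i j).
Proof.
congr pair.
  apply: functional_extensionality_dep => n; rewrite /step_mx.
  rewrite -[LHS]/(a *: dft_diag (bsz n) (sample K c n) + dft_diag (bsz n) (sample K c' n)).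
  have -> : sample K (fun i j => a * c i j + c' i j) n = a *: sample K c n + sample K c' n.
    by apply/rowP => i; rewrite !mxE.
  exact/esym/dft_diagZD.
apply: step_class_ext; have := step_classE K c'.
by apply: filterS3 (step_classE K c) (filterI (aeclassDE (a *: step_class K c) (step_class K c')) (aeclassZE a (step_class K c))) => p e1 [-> ->] ->; rewrite e1.
Qed.

Lemma step_pairM K c c' :
  step_pair K c * step_pair K c' = step_pair K (fun i j => c i j * c' i j).
Proof.
congr pair.
  apply: functional_extensionality_dep => n; rewrite /step_mx.
  rewrite -[LHS]/(dft_diag (bsz n) (sample K c n) *m dft_diag (bsz n) (sample K c' n)).
  have -> : sample K (fun i j => c i j * c' i j) n = \row_i (sample K c n 0 i * sample K c' n 0 i).
    by apply/rowP => i; rewrite !mxE.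
  exact/dft_diagM/bsz_gt0.
apply: step_class_ext.
by apply: filterS3 (step_classE K c) (step_classE K c') (aeclassME (step_class K c) (step_class K c')) => p e1 e2 ->; rewrite e1 e2.
Qed.

Lemma truncn_refine (x : R) K L : (0 < L)%N ->
  Num.truncn (K%:R * x) = (Num.truncn ((K * L)%:R * x) %/ L)%N.
Proof.
move=> L0; rewrite natrM mulrAC; move: (K%:R * x) => y {x}.
have L0R : 0 < L%:R :> R by rewrite ltr0n.
have [y0|y0] := leP 0 y; last first.
  have -> : Num.truncn y = 0%N by apply/eqP; rewrite -leqn0 truncn_le_nat (lt_trans y0).
  have -> : Num.truncn (y * L%:R) = 0%N; last by rewrite div0n.
  by apply/eqP; rewrite -leqn0 truncn_le_nat (lt_trans _ ltr01)// pmulr_llt0.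
have yL : 0 <= y * L%:R by rewrite mulr_ge0.
apply/eqP; rewrite truncn_eq//; have /andP[h1 h2] := truncn_itv yL.
apply/andP; split.
  rewrite -(ler_pM2r L0R) -natrM; apply: le_trans h1; rewrite ler_nat.
  exact: leq_divM.
rewrite -(ltr_pM2r L0R) -natrM; apply: lt_le_trans h2 _; rewrite ler_nat.
by rewrite ltn_ceil.
Qed.

Lemma step_pair_refine K L c : (0 < L)%N ->
  step_pair K c = step_pair (K * L) (fun i j => c (i %/ L)%N (j %/ L)%N).
Proof.
move=> L0; congr pair.
  apply: functional_extensionality_dep => n; rewrite /step_mx.
  have -> // : sample K c n = sample (K * L) (fun i j => c (i %/ L)%N (j %/ L)%N) n.
  apply/rowP => i; rewrite !mxE.
  by rewrite -!divnMA !(mulnC K L) -!mulnA ![(_ * L)%N]mulnC !divnMl.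
apply: step_class_ext; apply: filterS (step_classE K c) => p ->.
by rewrite /step_fun /cellx /cellt -!truncn_refine.
Qed.

Lemma step_pairs_subalgebra : subalgebra step_pairs.
Proof.
split.
- exists 1%N, (fun _ _ => -1 * 0 + 0); split => //.
  by rewrite -step_pairZD scaleN1r addNr.
- move=> a _ _ [K [c [K0 ->]]] [L [c' [L0 ->]]].
  exists (K * L)%N; eexists; split; first by rewrite muln_gt0 K0.
  by rewrite (step_pair_refine K c L0) (step_pair_refine L c' K0) [(L * K)%N]mulnC step_pairZD.
- move=> _ _ [K [c [K0 ->]]] [L [c' [L0 ->]]].
  exists (K * L)%N; eexists; split; first by rewrite muln_gt0 K0.
  by rewrite (step_pair_refine K c L0) (step_pair_refine L c' K0) [(L * K)%N]mulnC step_pairM.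
Qed.

End step_model.

Section equidistribution.
Variable R : realType.
Variable K : nat.
Hypothesis K_gt0 : (0 < K)%N.

Let KR : K%:R != 0 :> R. Proof. by rewrite pnatr_eq0 -lt0n. Qed.

Lemma cell_lt m s : (0 < m)%N -> (s < m)%N -> ((K * s) %/ m < K)%N.
Proof. by move=> m0 sm; rewrite ltn_divLR// ltn_pmul2l. Qed.

Lemma sum_cells_bound (g : nat -> R) m : (0 < m)%N ->
  `|\sum_(s < m) g ((K * s) %/ m)%N - m%:R / K%:R * \sum_(r < K) g r|
    <= \sum_(r < K) `|g r|.
Proof.
move=> m0; pose c r := #|finset (fun s : 'I_m => ((K * s) %/ m == r)%N)|.
have -> : \sum_(s < m) g ((K * s) %/ m)%N = \sum_(r < K) (c r)%:R * g r.
  rewrite (partition_big (fun s : 'I_m => Ordinal (cell_lt m0 (ltn_ord s))) xpredT)//=.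
  apply: eq_bigr => r _; transitivity (\sum_(s < m | ((K * s) %/ m == r)%N) g r).
    by apply: eq_big => [s|s /eqP <-] //; rewrite -val_eqE.
  by rewrite sumr_const mulr_natl; congr (_ *+ _); apply: eq_card => s; rewrite [RHS]inE.
rewrite mulr_sumr -sumrB; apply: le_trans (ler_norm_sum _ _ _) _.
apply: ler_sum => r _; rewrite -mulrBl normrM ler_piMl//.
have := count_cell_bounds m0 (ltn_ord r); rewrite -/(c r) => /andP[].
rewrite -!(ler_nat R) !natrD !natrM => h1 h2.
have K0 : 0 < K%:R :> R by rewrite ltr0n.
rewrite ler_norml; apply/andP; split.
  by rewrite -(ler_pM2r K0) mulrBl divfK//; lra.
by rewrite -(ler_pM2r K0) mulrBl divfK//; lra.
Qed.

Lemma sum_block_cells_bound (G : nat -> nat -> R) n b : (0 < n)%N -> (0 < b)%N ->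
  `|\sum_(i < n) G ((K * (blk b i * b)) %/ n)%N ((K * pos b i) %/ bsize n b i)%N -
    \sum_(i < n) K%:R^-1 * \sum_(r < K) G ((K * (blk b i * b)) %/ n)%N r|
  <= (n %/ b).+1%:R * \sum_(p < K) \sum_(r < K) `|G p r|.
Proof.
move=> n0 b0.
have bn i : (i < n)%N -> (blk b i < (n %/ b).+1)%N.
  by move=> i_n; rewrite ltnS leq_div2r// ltnW.
rewrite -sumrB (partition_big (fun i : 'I_n => Ordinal (bn i (ltn_ord i))) xpredT)//=.
apply: le_trans (ler_norm_sum _ _ _) _.
rewrite -[X in X%:R * _]card_ord mulr_natl -sumr_const; apply: ler_sum => q _.
rewrite (eq_bigl (fun i : 'I_n => blk b i == q)); last by move=> i; rewrite -val_eqE.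
have [i0 /eqP i0q|no] := pickP (fun i : 'I_n => blk b i == q); last first.
  rewrite big_pred0// normr0; do 2! (apply: sumr_ge0 => ? _); exact: normr_ge0.
set p := ((K * (q * b)) %/ n)%N; set m := bsize n b i0.
have m0 : (0 < m)%N by exact: bsize_gt0.
have pK : (p < K)%N.
  by rewrite cell_lt// -i0q; have := blk_pos b i0; have := ltn_ord i0; lia.
have -> : \sum_(i < n | blk b i == q)
    (G ((K * (blk b i * b)) %/ n)%N ((K * pos b i) %/ bsize n b i)%N -
     K%:R^-1 * \sum_(r < K) G ((K * (blk b i * b)) %/ n)%N r) =
  \sum_(s < m) (G p ((K * s) %/ m)%N - K%:R^-1 * \sum_(r < K) G p r).
  rewrite -i0q -(@big_block n b b0 _ (fun s => G p ((K * s) %/ m)%N - K%:R^-1 * \sum_(r < K) G p r))//.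
  apply: eq_bigr => i /eqP bi; have e : bsize n b i = m by apply: blk_bsize.
  by rewrite bi i0q e.
rewrite sumrB sumr_const card_ord -[_ *+ m]mulr_natl mulrA.
apply: le_trans (sum_cells_bound (G p) m0) _.
rewrite [leRHS](bigD1 (Ordinal pK))//= lerDl; do 2! (apply: sumr_ge0 => ? _); exact: normr_ge0.
Qed.

Lemma sum_block_shift_bound (g : nat -> R) n b : (0 < n)%N -> (0 < b)%N ->
  `|\sum_(i < n) g ((K * (blk b i * b)) %/ n)%N - \sum_(i < n) g ((K * i) %/ n)%N|
  <= (K.+1 * b.+1)%:R * (2 * \sum_(p < K) `|g p|).
Proof.
move=> n0 b0; rewrite -sumrB.
pose J := finset (fun i : 'I_n => ((K * (blk b i * b)) %/ n != (K * i) %/ n)%N).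
rewrite (bigID (mem J))/= [X in _ + X]big1 ?addr0 => [|i]; last first.
  by rewrite inE negbK => /eqP ->; rewrite subrr.
have gB p : (p < K)%N -> `|g p| <= \sum_(p < K) `|g p|.
  by move=> pK; rewrite (bigD1 (Ordinal pK))//= lerDl sumr_ge0.
apply: le_trans (ler_norm_sum _ _ _) _.
apply: (@le_trans _ _ (\sum_(i in J) (2 * \sum_(p < K) `|g p|))).
  apply: ler_sum => i _; apply: le_trans (ler_normB _ _) _; rewrite mulr_natl mulr2n.
  by rewrite lerD// gB// cell_lt//; have := blk_pos b i; have := ltn_ord i; lia.
rewrite sumr_const -[leLHS]mulr_natl ler_wpM2r//; first by rewrite mulr_ge0 ?sumr_ge0.
rewrite ler_nat; apply: (@card_cell_edges n b b0 K 0) => // i.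
by rewrite inE addn0 => /eqP.
Qed.

Lemma block_equidistribution (G : nat -> nat -> R) :
  (fun n => n.+1%:R^-1 * \sum_(i < n.+1) G ((K * (blk (bsz n) i * bsz n)) %/ n.+1)%N
      ((K * pos (bsz n) i) %/ bsize n.+1 (bsz n) i)%N) @ \oo -->
  (K ^ 2)%:R^-1 * \sum_(p < K) \sum_(r < K) G p r.
Proof.
pose g p := K%:R^-1 * \sum_(r < K) G p r.
pose B1 := \sum_(p < K) \sum_(r < K) `|G p r|.
pose B2 := \sum_(p < K) `|g p|.
have B10 : 0 <= B1 by do 2! (apply: sumr_ge0 => ? _); exact: normr_ge0.
have B20 : 0 <= B2 by apply: sumr_ge0.
pose C := (Num.truncn (B1 + K.+1%:R * (2 * B2) + B2)).+1.
have C1 : B1 + K.+1%:R * (2 * B2) + B2 <= C%:R by rewrite ltW// truncnS_gt.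
apply/cvgrPdist_le => e e0; apply: filterS (block_count_small C e0) => n Cn.
set N := n.+1; set b := bsz n; have b0 : (0 < b)%N := bsz_gt0 n.
have N0 : 0 < N%:R :> R by rewrite ltr0n.
rewrite distrC -(ler_pM2l N0) -[X in X * _]gtr0_norm// -normrM mulrBr mulrA mulfV ?gt_eqF// mul1r.
pose s1 := \sum_(i < N) G ((K * (blk b i * b)) %/ N)%N ((K * pos b i) %/ bsize N b i)%N.
pose s2 := \sum_(i < N) g ((K * (blk b i * b)) %/ N)%N.
pose s3 := \sum_(i < N) g ((K * i) %/ N)%N.
pose s4 := N%:R / K%:R * \sum_(r < K) g r.
have h1 : `|s1 - s2| <= (N %/ b).+1%:R * B1 by exact: sum_block_cells_bound.
have h2 : `|s2 - s3| <= (K.+1 * b.+1)%:R * (2 * B2) by exact: sum_block_shift_bound.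
have h3 : `|s3 - s4| <= B2 by exact: sum_cells_bound.
have -> : N%:R * ((K ^ 2)%:R^-1 * \sum_(p < K) \sum_(r < K) G p r) =
    N%:R / K%:R * \sum_(r < K) g r.
  by rewrite /g -mulr_sumr !mulrA; congr (_ * _); rewrite natrX; field.
rewrite -/s1 -/s4.
apply: le_trans (_ : (C * (N %/ b + b + 2))%:R <= _); last by rewrite mulrC.
have -> : s1 - s4 = (s1 - s2) + (s2 - s3) + (s3 - s4) by ring.
apply: le_trans (ler_normD _ _) _; apply: le_trans (lerD (ler_normD _ _) (lexx _)) _.
apply: le_trans (lerD (lerD h1 h2) h3) _.
pose X : R := (N %/ b + b + 2)%:R.
have X1 : (N %/ b).+1%:R <= X by rewrite ler_nat -addnA addn2 addnS ltnS leq_addr.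
have X2 : b.+1%:R <= X by rewrite ler_nat addn2 ltnS leqW ?leq_addl.
have X3 : 1 <= X by rewrite /X addn2 ler1n.
apply: (@le_trans _ _ ((B1 + K.+1%:R * (2 * B2) + B2) * X)); last by rewrite natrM ler_wpM2r.
rewrite (mulrDl _ B2) (mulrDl B1) lerD ?lerD//; first by rewrite mulrC ler_wpM2l.
  by rewrite natrM mulrAC ler_wpM2l// !mulr_ge0.
by rewrite -[leLHS]mulr1 ler_wpM2l.
Qed.

End equidistribution.

(** * Stability and computation of symbols *)

Section vanishing_functions.
Variable R : realType.

(* One-sided, because singular values and moduli are nonnegative. *)
Definition vanishing (f : R -> R) : Prop :=
  continuous f /\ exists M, forall x, M <= x -> f x = 0.

Lemma uniform_continuity_segment (f : R -> R) (a b e : R) : continuous f -> 0 < e ->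
  exists2 d, 0 < d & forall x y, a <= x <= b -> `|x - y| < d -> `|f x - f y| < e.
Proof.
move=> cf e0.
have := (compact_near_coveringP `[a, b]).1 (@segment_compact R a b) R 0^'+
  (fun d x => forall y, `|x - y| < d -> `|f x - f y| < e) _.
case=> [x _|].
  have e2 : 0 < e / 2 by rewrite divr_gt0.
  have /cvgrPdist_lt/(_ _ e2)/nbhs_ballP[r /= r0 rf] := cf x.
  have r2 : 0 < r / 2 by rewrite divr_gt0.
  exists (ball x (r / 2), [set d | d < r / 2]) => /=.
    split; first exact: nbhsx_ballx.
    exact: nbhs_right_lt.
  move=> [x' d] /= [xx' dr] y yd.
  have h1 : `|f x - f x'| < e / 2.
    apply: rf; rewrite /ball /= in xx' *; lra.
  have h2 : `|f x - f y| < e / 2.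
    apply: rf; rewrite /ball /= in xx' *.
    have -> : x - y = (x - x') + (x' - y) by ring.
    apply: le_lt_trans (ler_normD _ _) _; lra.
  have -> : f x' - f y = (f x - f y) - (f x - f x') by ring.
  apply: le_lt_trans (ler_normB _ _) _; lra.
move=> d /= d0 h; exists (d / 2) => [|x y xab]; first by rewrite divr_gt0.
move=> xy; apply: (h (d / 2)) => //=; rewrite ?divr_gt0//.
  by rewrite sub0r normrN gtr0_norm ?divr_gt0//; lra.
Qed.

Lemma vanishing_clip (f : R -> R) (e : R) : vanishing f -> 0 < e ->
  exists L M : R, [/\ 0 <= L, 0 <= M & forall x y, 0 <= x -> 0 <= y ->
    `|f x - f y| <= e + L * `|Num.min x M - Num.min y M|].
Proof.
move=> [cf [M0 fM0]] e0; pose M := Num.max M0 0.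
have M_ge0 : 0 <= M by rewrite le_max lexx orbT.
have fM x : f x = f (Num.min x M).
  case: leP => // Mx; rewrite !fM0// ?le_max ?lexx//.
  by apply: le_trans (ltW Mx); rewrite le_max lexx.
have [d d0 df] := uniform_continuity_segment 0 M cf e0.
have [B Bf] : exists B, forall x, 0 <= x <= M -> `|f x| <= B.
  have [c cM fc] := @EVT_max R (fun x => `|f x|) 0 M M_ge0
    (continuous_subspaceT (fun x => continuous_comp (cf x) (@norm_continuous _ _ _))).
  by exists `|f c| => x xM; apply: fc; rewrite in_itv.
have B0 : 0 <= B by apply: le_trans (normr_ge0 _) (Bf 0 _); rewrite lexx.
exists (2 * B / d), M; split => //; first by rewrite divr_ge0 ?mulr_ge0// ltW.
move=> x y x0 y0; rewrite (fM x) (fM y).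
have xM : 0 <= Num.min x M <= M by rewrite le_min x0 M_ge0 ge_min lexx orbT.
have yM : 0 <= Num.min y M <= M by rewrite le_min y0 M_ge0 ge_min lexx orbT.
move: (Num.min x M) (Num.min y M) xM yM => u v uM vM.
have [uv|uv] := ltP `|u - v| d.
  apply: le_trans (ltW (df _ _ uM uv)) _; rewrite lerDl !mulr_ge0// ?invr_ge0 ?ltW//.
apply: (@le_trans _ _ (2 * B)).
  by apply: le_trans (ler_normB _ _) _; rewrite mulr_natl mulr2n lerD ?Bf.
rewrite -[leLHS]add0r lerD ?(ltW e0)// mulrAC ler_pdivlMr// ler_wpM2l// mulr_ge0//.
Qed.

Lemma vanishing_bounded (f : R -> R) : vanishing f ->
  exists B, forall x, 0 <= x -> `|f x| <= B.
Proof.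
move=> vf; have [_ [M0 fM0]] := vf; have [L [M [L0 M_ge0 h]]] := vanishing_clip vf ltr01.
exists (1 + L * M) => x x0; have y0 : 0 <= Num.max M0 0 by rewrite le_max lexx orbT.
have := h _ _ x0 y0; rewrite (fM0 (Num.max M0 0)) ?le_max ?lexx// subr0.
move=> /le_trans; apply; rewrite lerD2l ler_wpM2l// ler_norml.
have : 0 <= Num.min x M <= M by rewrite le_min x0 M_ge0 ge_min lexx orbT.
have : 0 <= Num.min (Num.max M0 0) M <= M by rewrite le_min y0 M_ge0 ge_min lexx orbT.
move: (Num.min _ _) (Num.min _ _) => u v /andP[u1 u2] /andP[v1 v2]; lra.
Qed.

End vanishing_functions.

Section integrals_on_D.
Variable R : realType.
Local Notation T := (measurableTypeR R * measurableTypeR R)%type.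
Local Notation area := (fine (muD R (D R))).
Implicit Types g : T -> R.

Lemma integrable_bounded g B : measurable_fun setT g -> (forall x, `|g x| <= B) ->
  (muD R).-integrable (D R) (EFin \o g).
Proof.
move=> mg gB; apply: measurable_bounded_integrable.
- exact: measurable_D.
- by rewrite muDE ltry.
- exact: measurable_funS mg.
- exists B; split; first exact: num_real.
  by move=> M BM x _ /=; apply: le_trans (gB x) (ltW BM).
Qed.

Lemma Rintegral_dist g1 g2 B1 B2 (A : set T) e M b :
  measurable_fun setT g1 -> measurable_fun setT g2 ->
  (forall x, `|g1 x| <= B1) -> (forall x, `|g2 x| <= B2) ->
  measurable A -> (muD R A <= b%:E)%E -> 0 <= e -> 0 <= M ->
  (\forall x \ae muD R, `|g1 x - g2 x| <= e + M * \1_A x) ->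
  `|\int[muD R]_(x in D R) g1 x - \int[muD R]_(x in D R) g2 x| <= e * area + M * b.
Proof.
move=> m1 m2 h1 h2 mA Ab e0 M0 h.
have mD := @measurable_D R.
have i1 := integrable_bounded m1 h1; have i2 := integrable_bounded m2 h2.
have m12 : measurable_fun setT (fun x => g1 x - g2 x) by apply: measurable_funB.
rewrite -RintegralB//; apply: le_trans (le_normr_Rintegral _ _) _ => //.
  by apply: (@integrable_bounded _ (B1 + B2)) => // x; exact: le_trans (ler_normB _ _) (lerD _ _).
have iA x : 0 <= (\1_A x : R) <= 1 by rewrite indicE; case: (x \in A); rewrite ?ler01 ?lexx.
have iA0 x : 0 <= (\1_A x : R) by case/andP: (iA x).
have iA1 x : (\1_A x : R) <= 1 by case/andP: (iA x).
have mi : measurable_fun setT (fun x => e + M * \1_A x).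
  by apply: measurable_funD => //; apply: measurable_funM => //; exact: measurable_indic.
have ii : (muD R).-integrable (D R) (EFin \o \1_A).
  apply: (@integrable_bounded _ 1); first exact: measurable_indic.
  by move=> x; rewrite ger0_norm.

apply: (@le_trans _ _ (\int[muD R]_(x in D R) (e + M * \1_A x))).
  rewrite /Rintegral fine_le//.
  - apply: integrable_fin_num => //.
    apply: (@integrable_bounded (fun x => `|g1 x - g2 x|) (B1 + B2)); first exact: measurableT_comp.
    by move=> x; rewrite normr_id; exact: le_trans (ler_normB _ _) (lerD _ _).
  - apply: integrable_fin_num => //; apply: (@integrable_bounded _ (e + M)) => // x.
    by rewrite ger0_norm ?addr_ge0 ?mulr_ge0// lerD2l ler_piMr.
  apply: (ae_ge0_le_integral mD).
  - by move=> x _; rewrite lee_fin.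
  - by apply/measurable_EFinP; apply: measurable_funS (measurableT_comp _ m12) => //.
  - by move=> x _; rewrite lee_fin addr_ge0 ?mulr_ge0.
  - by apply/measurable_EFinP; apply: measurable_funS mi => //.
  - by apply: filterS h => x + _; rewrite lee_fin.
rewrite RintegralD//; last 2 first.
- by apply: (@integrable_bounded _ `|e|).
- apply: (@integrable_bounded _ M) => [|x]; first by apply: measurable_funM => //; exact: measurable_indic.
  by rewrite ger0_norm ?mulr_ge0// ler_piMr.
rewrite Rintegral_cst// RintegralZl// lerD2l ler_wpM2l//.
rewrite /Rintegral integral_indic// -lee_fin fineK; last first.
  by rewrite muD_fin_num//; exact: measurableI.
by apply: le_trans Ab; apply: le_measure; rewrite ?inE//; exact: measurableI.
Qed.

End integrals_on_D.

Section real_symbols.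
Variable R : realType.
Local Notation T := (measurableTypeR R * measurableTypeR R)%type.
Local Notation area := (fine (muD R (D R))).

Lemma measurable_normc (k : T -> R[i]) : measurable_fun setT k ->
  measurable_fun setT (fun x => normc (k x)).
Proof.
move=> /measurable_fun_complexP[mr mi].
rewrite (_ : (fun _ => _) = fun x => Num.sqrt (complex.Re (k x) ^+ 2 + complex.Im (k x) ^+ 2)); last first.
  by apply/funext => x; case: (k x).
apply: (measurableT_comp (continuous_measurable_fun (@sqrt_continuous R))).
by apply: measurable_funD; exact: measurable_funX.
Qed.

Lemma measurable_aeclass (k : M_D R) : measurable_fun setT (k : T -> R[i]).
Proof. exact: measurable_funPT. Qed.

Lemma measurable_vanishing (f : R -> R) (k : M_D R) : vanishing f ->
  measurable_fun setT (fun x : T => f (normc (k x))).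
Proof.
move=> [cf _]; apply: (measurableT_comp (continuous_measurable_fun cf)).
by apply: measurable_normc; exact: measurable_aeclass.
Qed.

Definition real_mean (f : R -> R) (A : mxseq R) n : R :=
  n.+1%:R^-1 * \sum_(i < n.+1) f (sigma (A n) i).

Definition real_integral (f : R -> R) (k : M_D R) : R :=
  area^-1 * \int[muD R]_(x in D R) f (normc (k x)).

Definition real_symbol (A : mxseq R) (k : M_D R) : Prop :=
  forall f, vanishing f -> real_mean f A @ \oo --> real_integral f k.

Lemma normc_dist (x y : R[i]) : `|normc x - normc y| <= normc (x - y).
Proof.
rewrite ler_norml; apply/andP; split.
  rewrite lerNl opprB lerBlDr -(normcN (x - y)) opprB.
  by apply: le_trans (le_normcD _ _); rewrite subrK.
by rewrite lerBlDr; apply: le_trans (le_normcD _ _); rewrite subrK.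
Qed.

Lemma min_dist (x y M : R) : `|Num.min x M - Num.min y M| <= `|x - y|.
Proof.
rewrite ler_norml; have := ler_norm (x - y); have := ler_norm (y - x).
rewrite distrC; case: (leP x M) => xM; case: (leP y M) => yM *; lra.
Qed.

Lemma real_mean_dist (f : R -> R) (A B : mxseq R) a t e L M :
  0 <= a -> 0 <= t -> 0 <= L -> 0 <= M ->
  (forall x y, 0 <= x -> 0 <= y ->
    `|f x - f y| <= e + L * `|Num.min x M - Num.min y M|) ->
  acs_small (A - B) a t ->
  \forall n \near \oo, `|real_mean f A n - real_mean f B n| <= e + L * (2 * M * a + t).
Proof.
move=> a0 t0 L0 M0 fL; apply: filterS => n [k k1 k2].
have N0 : 0 < n.+1%:R :> R by rewrite ltr0n.
rewrite /real_mean -mulrBr -sumrB normrM gtr0_norm ?invr_gt0//.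
rewrite ler_pdivrMl//; apply: le_trans (ler_norm_sum _ _ _) _.
apply: (@le_trans _ _ (\sum_(i < n.+1)
   (e + L * `|Num.min (sigma (A n) i) M - Num.min (sigma (B n) i) M|))).
  by apply: ler_sum => i _; apply: fL; exact: sigma_ge0.
rewrite big_split /= sumr_const card_ord -[e *+ _]mulr_natl -mulr_sumr mulrDr lerD2l.
rewrite [leRHS]mulrCA ler_wpM2l//.
have le1 : \sum_(i < n.+1) `|Num.min (sigma (A n) i) M - Num.min (sigma (B n) i) M|
   <= k%:R * (2 * M) + n.+1%:R * t.
  apply: sum_clipped_le => // [i|i|i j|i j|i|i].
  - exact: sigma_ge0.
  - exact: sigma_ge0.
  - exact: sigma_nonincreasing.
  - exact: sigma_nonincreasing.
  - have -> : A n = B n + (A - B) n by rewrite addrC subrK.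
    by apply: le_trans (sigmaD _ _ _ _) _; rewrite lerD2l.
  - have -> : B n = A n + (- (A - B)) n.
      by rewrite opprB -[RHS]/(A n + (B n - A n)) addrC subrK.
    by apply: le_trans (sigmaD _ _ _ _) _; rewrite lerD2l sigmaN.
apply: le_trans le1 _; rewrite mulrDr lerD2r.
have -> : n.+1%:R * (2 * M * a) = a * n.+1%:R * (2 * M) by ring.
by rewrite ler_wpM2r ?mulr_ge0.
Qed.

Lemma real_integral_dist (f : R -> R) (k h : M_D R) a t e L M :
  vanishing f -> 0 <= t -> 0 <= L -> 0 <= M -> 0 <= e ->
  (forall x y, 0 <= x -> 0 <= y ->
    `|f x - f y| <= e + L * `|Num.min x M - Num.min y M|) ->
  measure_small (k - h) a t ->
  `|real_integral f k - real_integral f h| <= e + L * t + L * M * a.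
Proof.
move=> vf t0 L0 M0 e0 fL [A [mA A1 A2]].
have [B fB] := vanishing_bounded vf.
rewrite /real_integral -mulrBr normrM gtr0_norm ?invr_gt0 ?area_gt0//.
rewrite ler_pdivrMl ?area_gt0//.
have -> : area * (e + L * t + L * M * a) = (e + L * t) * area + L * M * (a * area) by ring.
apply: (@Rintegral_dist R _ _ B B A) => //.
- exact: measurable_vanishing.
- exact: measurable_vanishing.
- by move=> x; apply: fB; exact: normc_ge0.
- by move=> x; apply: fB; exact: normc_ge0.
- by rewrite addr_ge0 ?mulr_ge0.
- by rewrite mulr_ge0.
apply: filterS2 (filterI (aeclassDE k (- h)) (aeclassNE h)) A2 => x [e1 e2] hx.
apply: le_trans (fL _ _ (normc_ge0 _) (normc_ge0 _)) _.
rewrite -addrA lerD2l; rewrite indicE; have [xA|xA] := boolP (x \in A).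
  rewrite mulr1 -[leLHS]add0r lerD ?mulr_ge0// ler_wpM2l// ler_norml.
  have : 0 <= Num.min (normc (k x)) M <= M by rewrite le_min normc_ge0 M0 ge_min lexx orbT.
  have : 0 <= Num.min (normc (h x)) M <= M by rewrite le_min normc_ge0 M0 ge_min lexx orbT.
  move: (Num.min _ _) (Num.min _ _) => u v /andP[u1 u2] /andP[v1 v2]; lra.
rewrite mulr0 addr0 ler_wpM2l//; apply: le_trans (min_dist _ _ _) _.
apply: le_trans (normc_dist _ _) _; rewrite -e2 -e1; apply: hx.
by rewrite notin_setE in xA.
Qed.

Lemma real_symbol_closed (S : set (ExM_D R)) x :
  (forall y, S y -> real_symbol y.1 y.2) ->
  (forall e, 0 < e -> exists2 y, S y & small (x - y) e e) ->
  real_symbol x.1 x.2.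
Proof.
move=> Ssym cl f vf; apply/cvgrPdist_le => e e0.
have e4 : 0 < e / 8 by rewrite divr_gt0.
have [L [M [L0 M0 fL]]] := vanishing_clip vf e4.
pose d := e / 8 / (L * (2 * M + 1) + 1).
have q0 : 0 < L * (2 * M + 1) + 1 by rewrite ltr_wpDl// mulr_ge0// addr_ge0// mulr_ge0.
have d0 : 0 < d by rewrite divr_gt0.
have dE : d * (L * (2 * M + 1) + 1) = e / 8 by rewrite divfK// gt_eqF.
have [y Sy [s1 s2]] := cl d d0.
have h1 := real_mean_dist (ltW d0) (ltW d0) L0 M0 fL s1.
have h2 := real_integral_dist vf (ltW d0) L0 M0 (ltW e4) fL s2.
have /cvgrPdist_le/(_ _ e4) h3 := Ssym y Sy f vf.
apply: filterS2 h1 h3 => n h1 h3.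
have -> : real_integral f x.2 - real_mean f x.1 n =
  (real_integral f x.2 - real_integral f y.2) +
  (real_integral f y.2 - real_mean f y.1 n) -
  (real_mean f x.1 n - real_mean f y.1 n) by ring.
apply: le_trans (ler_normB _ _) _; apply: le_trans (lerD (ler_normD _ _) (lexx _)) _.
apply: le_trans (lerD (lerD h2 h3) h1) _.
have LMd : 0 <= L * M * d by exact: mulr_ge0 (mulr_ge0 L0 M0) (ltW d0).
have Ld : 0 <= L * d by exact: mulr_ge0 L0 (ltW d0).
move: d0 dE LMd Ld; move: (d) => u *.
lra.
Qed.

End real_symbols.

Section step_symbols.
Variable R : realType.
Local Notation T := (measurableTypeR R * measurableTypeR R)%type.
Local Notation area := (fine (muD R (D R))).
Local Notation leb := (@lebesgue_measure R).

Lemma muD_rect (A B : set (measurableTypeR R)) : measurable A -> measurable B ->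
  muD R (A `*` B) = (leb (A `&` `[0%R, 1%R]%classic) * leb (B `&` `[(- pi)%R, pi]%classic))%E.
Proof.
move=> mA mB; rewrite /muD /= /mrestr /D -setXI.
by rewrite product_measure1E//=; apply: measurableI => //; exact: measurable_itv.
Qed.

Lemma ae_fst (P : R -> Prop) : {ae leb, forall x, P x} ->
  {ae muD R, forall x : T, P x.1}.
Proof.
move=> [N [mN N0 PN]]; exists (N `*` setT); split.
- exact: measurableX.
- rewrite muD_rect// (_ : leb (N `&` _) = 0%E) ?mul0e//.
  apply/eqP; rewrite -measure_le0 -N0 le_measure ?inE//.
  by apply: measurableI => //; exact: measurable_itv.
- by move=> x /= nPx; split => //; exact: PN.
Qed.

Lemma ae_snd (P : R -> Prop) : {ae leb, forall x, P x} ->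
  {ae muD R, forall x : T, P x.2}.
Proof.
move=> [N [mN N0 PN]]; exists (setT `*` N); split.
- exact: measurableX.
- rewrite muD_rect// (_ : leb (N `&` _) = 0%E) ?mule0//.
  apply/eqP; rewrite -measure_le0 -N0 le_measure ?inE//.
  by apply: measurableI => //; exact: measurable_itv.
- by move=> x /= nPx; split => //; exact: PN.
Qed.

Lemma ae_leb_neq (a : R) : {ae leb, forall x, x <> a}.
Proof.
exists [set a]; split => //; first exact: lebesgue_measure_set1.
by move=> x /= /contrapT.
Qed.

Section cells.
Variable K : nat.
Hypothesis K_gt0 : (0 < K)%N.

Definition cell p r : set T := [set x | cellx K x = p] `&` [set x | cellt K x = r].

Lemma measurable_cell p r : measurable (cell p r).
Proof. by apply: measurableI; [exact: measurable_cellx|exact: measurable_cellt]. Qed.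

Lemma muD_cell p r : (p < K)%N -> (r < K)%N ->
  muD R (cell p r) = (area / (K ^ 2)%:R)%:E.
Proof.
move=> pK rK; have K0 : 0 < K%:R :> R by rewrite ltr0n.
have pi0 := pi_gt0 R; have tpi : 0 < 2 * pi :> R by rewrite mulr_gt0.
have le1 (q : nat) : (q < K)%N -> q.+1%:R / K%:R <= 1 :> R.
  by move=> qK; rewrite ler_pdivrMr// mul1r ler_nat.
pose I : set (measurableTypeR R) := `[p%:R / K%:R, p.+1%:R / K%:R[%classic.
pose J : set (measurableTypeR R) := `[- pi + 2 * pi * (r%:R / K%:R), - pi + 2 * pi * (r.+1%:R / K%:R)[%classic.
have mI : measurable I by exact: measurable_itv.
have mJ : measurable J by exact: measurable_itv.
have ID : I `&` `[0%R, 1%R]%classic = I.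
  apply: setIidl => x; rewrite /I /= !in_itv /= => /andP[h1 h2].
  have := le1 p pK; have : 0 <= p%:R / K%:R :> R by rewrite divr_ge0.
  lra.
have JD : J `&` `[(- pi)%R, pi]%classic = J.
  apply: setIidl => x; rewrite /J /= !in_itv /= => /andP[h1 h2].
  have h3 : 0 <= 2 * pi * (r%:R / K%:R) :> R by rewrite mulr_ge0 ?divr_ge0// ltW.
  have h4 : 2 * pi * (r.+1%:R / K%:R) <= 2 * pi :> R by rewrite ler_piMr ?le1// ltW.
  lra.
have cx (x : T) : D R x -> (cellx K x = p) <-> I x.1.
  move=> [/=]; rewrite in_itv /= => /andP[x0 x1] _; rewrite /I /= in_itv /=.
  rewrite ler_pdivrMr// ltr_pdivlMr// mulrC -truncn_eq ?mulr_ge0//.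
  by split=> /eqP.
have ct (x : T) : D R x -> (cellt K x = r) <-> J x.2.
  move=> [_ /=]; rewrite in_itv /= => /andP[x0 x1]; rewrite /J /= in_itv /=.
  have y0 : 0 <= (x.2 + pi) / (2 * pi) by apply: divr_ge0 (ltW tpi); lra.
  rewrite -lerBrDl -ltrBlDl opprK ![2 * pi * _]mulrC.
  rewrite -ler_pdivlMr// -ltr_pdivrMr// ler_pdivrMr// ltr_pdivlMr// mulrC -truncn_eq; last exact: mulr_ge0 (ler0n _ _) y0.
  by split=> /eqP.
transitivity (muD R (I `*` J)).
  rewrite /muD /= /mrestr; congr (_ _); apply/seteqP; split => x [[h1 h2] Dx]; split => //.
    by split; [apply/cx|apply/ct].
  by split; [apply/cx|apply/ct].
rewrite muD_rect// ID JD !lebesgue_measure_itv /= !lte_fin.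
rewrite ltr_pM2r ?invr_gt0// ltr_nat ltnSn ltrD2l ltr_pM2l// ltr_pM2r ?invr_gt0// ltr_nat ltnSn.
rewrite -!EFinB -EFinM muDE /= natrX; congr EFin; rewrite -[p.+1]addn1 -[r.+1]addn1 !natrD.
by field; rewrite gt_eqF.
Qed.

Lemma ae_cell_lt : \forall x \ae muD R, (cellx K x < K)%N /\ (cellt K x < K)%N.
Proof.
apply: filterS3 (ae_fst (ae_leb_neq 1)) (ae_snd (ae_leb_neq pi)) (ae_muD R) => x x1 x2 [/=].
rewrite !in_itv /= => /andP[h1 h2] /andP[h3 h4].
have K0 : 0 < K%:R :> R by rewrite ltr0n.
have tpi : 0 < 2 * pi :> R by rewrite mulr_gt0 ?pi_gt0.
have y0 : 0 <= (x.2 + pi) / (2 * pi) by apply: divr_ge0 (ltW tpi); lra.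
have h2' : x.1 < 1 by rewrite lt_neqAle h2 andbT; apply/eqP.
have h4' : x.2 < pi by rewrite lt_neqAle h4 andbT; apply/eqP.
have z0 : 0 <= K%:R * ((x.2 + pi) / (2 * pi)) by exact: mulr_ge0 (ler0n _ _) y0.
rewrite /cellx /cellt truncn_lt_nat ?mulr_ge0// truncn_lt_nat ?z0//; split.
  by rewrite -[ltRHS]mulr1 ltr_pM2l.
by rewrite -[ltRHS]mulr1 ltr_pM2l// ltr_pdivrMr//; lra.
Qed.

Lemma Rintegral_bounded_sum (I : Type) (s : seq I) (F : I -> T -> R) (B : I -> R) :
  (forall i, measurable_fun setT (F i)) -> (forall i x, `|F i x| <= B i) ->
  \int[muD R]_(x in D R) (\sum_(i <- s) F i x) = \sum_(i <- s) \int[muD R]_(x in D R) F i x.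
Proof.
move=> mF FB; have mD := @measurable_D R; elim: s => [|i s IH].
  under eq_Rintegral do rewrite big_nil.
  by rewrite Rintegral_cst// mul0r big_nil.
under eq_Rintegral do rewrite big_cons.
rewrite big_cons RintegralD//; first by rewrite IH.
  exact: (integrable_bounded (mF i) (FB i)).
apply: (@integrable_bounded _ _ (\sum_(i <- s) B i)); first exact: measurable_sum.
by move=> x; apply: le_trans (ler_norm_sum _ _ _) _; apply: ler_sum.
Qed.

Lemma Rintegral_cells (G : nat -> nat -> R) B (g : T -> R) :
  measurable_fun setT g -> (forall x, `|g x| <= B) ->
  (\forall x \ae muD R, g x = G (cellx K x) (cellt K x)) ->
  \int[muD R]_(x in D R) g x = area / (K ^ 2)%:R * \sum_(p < K) \sum_(r < K) G p r.
Proof.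
move=> mg gB gG; have mD := @measurable_D R.
pose F (pr : 'I_K * 'I_K) (x : T) : R := G pr.1 pr.2 * \1_(cell pr.1 pr.2) x.
have mF pr : measurable_fun setT (F pr).
  by apply: measurable_funM => //; apply: measurable_indic; exact: measurable_cell.
have FB pr x : `|F pr x| <= `|G pr.1 pr.2|.
  by rewrite normrM ler_piMr// indicE; case: (x \in _); rewrite ?normr1 ?normr0.
transitivity (\int[muD R]_(x in D R) (\sum_(pr : 'I_K * 'I_K) F pr x)).
  apply/eqP; rewrite -subr_eq0 -normr_le0.
  apply: (@le_trans _ _ (0 * area + 0 * area)); last by rewrite !mul0r addr0.
  have := @Rintegral_dist R g (fun x => \sum_(pr : 'I_K * 'I_K) F pr x) B
    (\sum_(pr : 'I_K * 'I_K) `|G pr.1 pr.2|) setT 0 0 area mg.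
  apply=> //.
  - exact: measurable_sum.
  - by move=> x; apply: le_trans (ler_norm_sum _ _ _) _; apply: ler_sum.
  - exact: muD_le_area.
  apply: filterS2 gG ae_cell_lt => x -> [c1 c2]; rewrite mul0r addr0.
  rewrite (bigD1 (Ordinal c1, Ordinal c2))//= big1 => [|[p r] pr].
    by rewrite addr0 /F /= indicE mem_set// mulr1 subrr normr0.
  rewrite /F /= indicE memNset ?mulr0// => -[/= e1 e2].
  by case/eqP: pr; congr pair; apply/val_inj.
rewrite (Rintegral_bounded_sum _ mF FB) mulr_sumr.
rewrite (eq_bigr (fun p : 'I_K => \sum_(r < K) area / (K ^ 2)%:R * G p r)); last first.
  by move=> p _; rewrite mulr_sumr.
rewrite pair_big /=; apply: eq_bigr => -[p r] _ /=; rewrite /F /= RintegralZl//; last first.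
  apply: (@integrable_bounded _ _ 1); first by apply: measurable_indic; exact: measurable_cell.
  by move=> x; rewrite indicE; case: (x \in _); rewrite ?normr1 ?normr0.
rewrite /Rintegral integral_indic//; last exact: measurable_cell.
rewrite mulrC; congr (_ * _).
have -> : muD R (cell p r `&` D R) = muD R (cell p r).
  by rewrite /muD /= /mrestr -setIA setIid.
by rewrite muD_cell.
Qed.

Lemma step_real_symbol c : real_symbol (step_mx K c) (step_class (R := R) K c).
Proof.
move=> f vf; have [B fB] := vanishing_bounded vf.
have -> : real_integral f (step_class K c) =
    (K ^ 2)%:R^-1 * \sum_(p < K) \sum_(r < K) f (normc (c p r)).
  rewrite /real_integral (@Rintegral_cells (fun p r => f (normc (c p r))) B).
  - by rewrite mulrA mulrA mulVf ?mul1r// gt_eqF// area_gt0.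
  - exact: measurable_vanishing.
  - by move=> x; apply: fB; exact: normc_ge0.
  - by apply: filterS (step_classE K c) => x ->.
have := @block_equidistribution R K K_gt0 (fun p r => f (normc (c p r))).
apply: cvg_trans; apply: near_eq_cvg; apply: nearW => n.
rewrite /real_mean /step_mx /dft_diag sum_sigma_unitary_diag ?block_dft_unitary ?bsz_gt0//.
by congr (_ * _); apply: eq_bigr => i _; rewrite mxE.
Qed.

End cells.

Definition table_bound (c : nat -> nat -> R[i]) K : R :=
  \sum_(p < K) \sum_(r < K) normc (c p r).

Lemma table_bound_ge0 c K : 0 <= table_bound c K.
Proof. by do 2! (apply: sumr_ge0 => ? _); exact: normc_ge0. Qed.

Lemma step_pair_bounded K c : (0 < K)%N -> small (step_pair K c) 0 (table_bound c K).
Proof.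
move=> K0; have bound p r : (p < K)%N -> (r < K)%N -> normc (c p r) <= table_bound c K.
  move=> pK rK; rewrite /table_bound (bigD1 (Ordinal pK))//= (bigD1 (Ordinal rK))//= -addrA lerDl.
  by rewrite addr_ge0//; [|apply: sumr_ge0 => ? _]; apply: sumr_ge0 => ? _; exact: normc_ge0.
split.
  apply: nearW => n; exists 0%N; first by rewrite mul0r.
  apply: (@sigma_unitary_diag_le _ _ _ _ _ finset.set0); rewrite ?cards0 ?table_bound_ge0//.
    by rewrite block_dft_unitary ?bsz_gt0.
  move=> i _; rewrite mxE; apply: bound; apply: cell_lt => //.
  - by have := blk_pos (bsz n) i; have := ltn_ord i; lia.
  - by rewrite bsize_gt0 ?bsz_gt0.
  - by rewrite pos_lt ?bsz_gt0.
exists set0; split => //; first by rewrite measure0 mul0r.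
apply: filterS2 (step_classE K c) (ae_cell_lt K0) => x -> [c1 c2] _.
exact: bound.
Qed.

End step_symbols.

Section complex_symbols.
Variable R : realType.
Local Notation C := (R[i] : numFieldType).
Local Notation T := (measurableTypeR R * measurableTypeR R)%type.
Local Notation area := (fine (muD R (D R))).

Lemma ReB (z w : R[i]) : complex.Re (z - w) = complex.Re z - complex.Re w.
Proof. by case: z w => ? ? []. Qed.

Lemma ImB (z w : R[i]) : complex.Im (z - w) = complex.Im z - complex.Im w.
Proof. by case: z w => ? ? []. Qed.

Lemma Re_sum (I : Type) (s : seq I) (F : I -> R[i]) :
  complex.Re (\sum_(i <- s) F i) = \sum_(i <- s) complex.Re (F i).
Proof.
elim: s => [|i s IH]; rewrite ?big_nil// !big_cons -IH.
by case: (F i) (\sum_(j <- s) F j) => ? ? [].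
Qed.

Lemma Im_sum (I : Type) (s : seq I) (F : I -> R[i]) :
  complex.Im (\sum_(i <- s) F i) = \sum_(i <- s) complex.Im (F i).
Proof.
elim: s => [|i s IH]; rewrite ?big_nil// !big_cons -IH.
by case: (F i) (\sum_(j <- s) F j) => ? ? [].
Qed.

Lemma Re_realM (a : R) (w : R[i]) : complex.Re (a%:C * w) = a * complex.Re w.
Proof. by case: w => ? ? /=; rewrite mul0r subr0. Qed.

Lemma Im_realM (a : R) (w : R[i]) : complex.Im (a%:C * w) = a * complex.Im w.
Proof. by case: w => ? ? /=; rewrite mul0r addr0. Qed.

Lemma normc_Re (z : R[i]) : `|complex.Re z| <= normc z.
Proof. by case: z => a b /=; rewrite -sqrtr_sqr ler_wsqrtr// lerDl sqr_ge0. Qed.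

Lemma normc_Im (z : R[i]) : `|complex.Im z| <= normc z.
Proof. by case: z => a b /=; rewrite -sqrtr_sqr ler_wsqrtr// lerDr sqr_ge0. Qed.

Lemma normc_le_ReIm (z : R[i]) : normc z <= `|complex.Re z| + `|complex.Im z|.
Proof.
case: z => a b /=; rewrite -[leRHS]ger0_norm ?addr_ge0// -sqrtr_sqr ler_wsqrtr//.
rewrite sqrrD !real_normK ?num_real// addrAC lerDl.
by rewrite mulrn_wge0 ?mulr_ge0.
Qed.

Lemma normc_real (a : R) : normc a%:C = `|a|.
Proof. by rewrite /= expr0n addr0 sqrtr_sqr. Qed.

Lemma continuous_part (F : R -> C) (p : R[i] -> R) :
  (forall z w, `|p z - p w| <= normc (z - w)) -> continuous F -> continuous (fun x => p (F x)).
Proof.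
move=> pF cF x; apply/cvgrPdist_lt => e e0.
have eC : 0 < (e%:C : C) by rewrite ltcR.
have /cvgrPdist_lt/(_ _ eC) := cF x; apply: filterS => y.
rewrite -[`|F x - F y|]/((normc (F x - F y))%:C) ltcR.
exact: le_lt_trans (pF _ _).
Qed.

Lemma vanishing_part (F : R -> C) (p : R[i] -> R) : p 0 = 0 ->
  (forall z w, `|p z - p w| <= normc (z - w)) -> continuous F ->
  compact (closure [set x | F x != 0]) -> vanishing (fun x => p (F x)).
Proof.
move=> p0 pF cF cpt; split; first exact: continuous_part.
have [M [_ MF]] := compact_bounded (cpt : compact (closure [set x | F x != 0] : set R^o)).
exists (M + 2) => x Mx; have [->//|Fx] := eqVneq (F x) 0; exfalso.
have := MF (M + 1); rewrite ltrDl ltr01 => /(_ isT x).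
move=> /(_ (@subset_closure _ [set x | F x != 0] x Fx)) /= xM.
by have := le_trans (ler_norm x) xM; lra.
Qed.

Lemma real_symbol_has_symbol (A : mxseq R) (k : M_D R) :
  real_symbol A k -> has_symbol A k.
Proof.
move=> sym F cF cpt.
have pRe (z w : R[i]) : `|complex.Re z - complex.Re w| <= normc (z - w).
  by rewrite -ReB normc_Re.
have pIm (z w : R[i]) : `|complex.Im z - complex.Im w| <= normc (z - w).
  by rewrite -ImB normc_Im.
have hr := sym _ (vanishing_part (erefl : complex.Re 0 = 0) pRe cF cpt).
have hi := sym _ (vanishing_part (erefl : complex.Im 0 = 0) pIm cF cpt).
apply/cvgrPdist_lt => e; rewrite ltcE => /andP[/eqP ei e0].
have e2 : 0 < complex.Re e / 2 by rewrite divr_gt0.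
move/cvgrPdist_lt: hr => /(_ _ e2) hr; move/cvgrPdist_lt: hi => /(_ _ e2) hi.
apply: filterS2 hr hi => n hr hi.
set z := (X in `|X|); rewrite -[`|z|]/((normc z)%:C).
rewrite ltcE /= ei eqxx /=; apply: le_lt_trans (normc_le_ReIm _) _.
have nE : n.+1%:R^-1 = (n.+1%:R^-1)%:C :> R[i] by rewrite fmorphV rmorph_nat.
have -> : complex.Re z = real_integral (fun x => complex.Re (F x)) k -
    real_mean (fun x => complex.Re (F x)) A n.
  by rewrite /z ReB nE !Re_realM Re_sum.
have -> : complex.Im z = real_integral (fun x => complex.Im (F x)) k -
    real_mean (fun x => complex.Im (F x)) A n.
  by rewrite /z ImB nE !Im_realM Im_sum.
lra.
Qed.

Definition plateau (t x : R) : R := Num.min 1 (Num.max 0 (2 - `|x| / t)).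

Lemma plateau_bounds t x : 0 <= plateau t x <= 1.
Proof. by rewrite /plateau le_min ler01 le_max lexx ge_min lexx. Qed.

Lemma plateau1 t x : 0 < t -> `|x| <= t -> plateau t x = 1.
Proof.
move=> t0 xt; rewrite /plateau; have : `|x| / t <= 1 by rewrite ler_pdivrMr// mul1r.
by move=> h; rewrite min_l// le_max; apply/orP; right; lra.
Qed.

Lemma plateau0 t x : 0 < t -> 2 * t <= `|x| -> plateau t x = 0.
Proof.
move=> t0 xt; rewrite /plateau; have : 2 <= `|x| / t by rewrite ler_pdivlMr.
by move=> h; rewrite (max_l (_ : _ <= 0)) ?min_r//; lra.
Qed.

Lemma continuous_plateau t : continuous (plateau t).
Proof.
move=> x; pose l (y : R) : R^o := 2 - `|y| / t.
have cl : {for x, continuous l}.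
  apply: cvgB; first exact: cvg_cst.
  by apply: cvgMr_tmp; exact: norm_continuous.
have cc (a : R) : {for x, continuous (cst a : R -> R^o)} by apply: cvg_cst.
have cm := @continuous_max R R (cst 0) l x (cc 0) cl.
exact: (@continuous_min R R (cst 1) _ x (cc 1) cm).
Qed.

Lemma symbol_acs_small (A : mxseq R) (k : M_D R) a t e : 0 < t -> 0 < e ->
  has_symbol A k -> measure_small k a t -> acs_small A (a + e) (2 * t).
Proof.
move=> t0 e0 sym [B [mB B1 B2]].
pose f := plateau t.
have fB x : `|f x| <= 1.
  by have /andP[h1 h2] := plateau_bounds t x; rewrite ger0_norm.
pose F (x : R) : C := (f x)%:C.
have cF : continuous F.
  move=> x; apply/cvgrPdist_lt => d; rewrite ltcE => /andP[/eqP di d0].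
  have /cvgrPdist_lt/(_ _ d0) := @continuous_plateau t x; apply: filterS => y.
  have -> : d = (complex.Re d)%:C by case: d di {d0} => ? ? /= ->.
  rewrite -[`|F x - F y|]/((normc (F x - F y))%:C) ltcR.
  have -> : F x - F y = (f x - f y)%:C by rewrite rmorphB.
  by rewrite normc_real.
have cpt : compact (closure [set x | F x != 0]).
  apply: (@subclosed_compact _ _ `[- (2 * t), 2 * t]); first exact: closed_closure.
    exact: segment_compact.
  have cI : closed (`[- (2 * t), 2 * t]%classic : set R) by exact: interval_closed.
  rewrite [X in _ `<=` X]((closure_id _).1 cI).
  apply: closureS => x /= Fx; rewrite in_itv /= -ler_norml leNgt.
  by apply: contra_neqN Fx => /ltW tx; rewrite /F /f plateau0.
have := sym F cF cpt.
move=> /cvgrPdist_lt/(_ e%:C); rewrite ltcR => /(_ e0); apply: filterS => n.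
set z := (X in `|X|); rewrite -[`|z|]/((normc z)%:C) ltcR => ze.
have {}ze : `|real_integral f k - real_mean f A n| < e.
  apply: le_lt_trans ze; apply: le_trans (normc_Re z).
  have nE : n.+1%:R^-1 = (n.+1%:R^-1)%:C :> R[i] by rewrite fmorphV rmorph_nat.
  by rewrite /z ReB nE !Re_realM Re_sum.
have vf : vanishing f.
  split; first exact: continuous_plateau.
  exists (2 * t) => x tx; apply: plateau0 => //.
  by apply: le_trans tx (ler_norm x).
have I1 : 1 - a <= real_integral f k.
  rewrite /real_integral lerBlDr -(ler_pM2l (area_gt0 R)) mulr1 mulrDr mulrA.
  rewrite mulfV ?gt_eqF ?area_gt0// mul1r.
  have mf := measurable_vanishing k vf.
  have := @Rintegral_dist R (fun=> 1) (fun x => f (normc (k x))) 1 1 B 0 1 (a * area).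
  rewrite Rintegral_cst; last exact: measurable_D.
  move=> /(_ _ mf) h; have {}h := h (measurable_cst _) _ (fun x => fB _) mB B1 (lexx _) ler01.
  rewrite !mul1r mul0r add0r in h.
  have : area - \int[muD R]_(x in D R) f (normc (k x)) <= a * area.
    apply: le_trans (ler_norm _) (h _ _); first by move=> x; rewrite normr1.
    apply: filterS B2 => x hx; rewrite add0r mul1r indicE.
    have [xB|xB] := boolP (x \in B).
      by have /andP[h1 h2] := plateau_bounds t (normc (k x)); rewrite ger0_norm /f ?subr_ge0// lerBlDr lerDl.
    rewrite /f plateau1 ?subrr ?normr0// ger0_norm ?normc_ge0//; apply: hx.
    by rewrite notin_setE in xB.
  by rewrite [area * a]mulrC -lerBlDl.
pose c := #|finset (fun i : 'I_n.+1 => 2 * t < sigma (A n) i)|.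
have N0 : 0 < n.+1%:R :> R by rewrite ltr0n.
exists c.
  have le1 : real_mean f A n <= 1 - c%:R / n.+1%:R.
    rewrite /real_mean ler_pdivrMl// mulrBr mulr1 mulrCA mulfV ?gt_eqF// mulr1.
    rewrite (bigID (fun i : 'I_n.+1 => 2 * t < sigma (A n) i))/= big1 ?add0r => [|i ti]; last first.
      by apply: plateau0 => //; rewrite ger0_norm ?sigma_ge0// ltW.
    have -> : n.+1%:R - c%:R = \sum_(i < n.+1 | ~~ (2 * t < sigma (A n) i)) (1 : R).
      rewrite sumr_const -[X in X%:R - _]card_ord -(cardC (finset (fun i : 'I_n.+1 => 2 * t < sigma (A n) i))).
      rewrite natrD -/c addrAC subrr add0r; congr (_%:R); apply: eq_card => i.
      by rewrite !inE.
    by apply: ler_sum => i _; have /andP[] := plateau_bounds t (sigma (A n) i).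
  rewrite -ler_pdivrMr//; move: le1 ze I1.
  move: (real_mean f A n) (real_integral f k) (c%:R / n.+1%:R) => u v w h1 h2 h3.
  have := ler_norm (v - u); lra.
rewrite leNgt; apply/negP => h.
have cn : (c < n.+1)%N.
  rewrite ltnNge; apply/negP => nc; move: h; rewrite sigma_size// ltNge.
  by rewrite mulr_ge0// ltW.
have : (c < c)%N; last by rewrite ltnn.
pose J := finset (fun i : 'I_n.+1 => (i <= c)%N).
have cJ : #|J| = c.+1.
  rewrite -sum1_card; under eq_bigl do rewrite inE.
  rewrite (@big_window nat (fun _ => 1%N) (fun i => i <= c)%N _ 0 c.+1)//.
  by rewrite sum_nat_const_nat muln1 subn0.
rewrite -[X in (X <= _)%N]cJ; apply: subset_leq_card; apply/fintype.subsetP => i.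
rewrite !inE => ic; apply: lt_le_trans h _; exact: sigma_nonincreasing.
Qed.

End complex_symbols.

Section closure_algebra.
Variable R : realType.
Implicit Types (S : set (ExM_D R)) (x y : ExM_D R).

Lemma small0 : small (0 : ExM_D R) 0 0.
Proof.
split.
  by apply: nearW => n; exists 0%N; rewrite ?mul0r// sigma_rank// mxrank0.
exists set0; split; rewrite ?measure0 ?mul0r//.
by apply: filterS (aeclass0E (muD R)) => p -> _; rewrite normc0.
Qed.

Lemma sub_closure S : S `<=` closure_acs_m S.
Proof.
move=> x Sx; apply/small_closureP => e e0; exists x => //; rewrite subrr.
by apply: small_le small0; exact: ltW.
Qed.

Lemma closure_idem S : closure_acs_m (closure_acs_m S) `<=` closure_acs_m S.
Proof.
move=> x /small_closureP h; apply/small_closureP => e e0.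
have e2 : 0 < e / 2 by rewrite divr_gt0.
have [y /small_closureP/(_ _ e2)[z Sz yz] xy] := h _ e2; exists z => //.
have -> : x - z = (x - y) + (y - z) by rewrite addrA subrK.
have -> : e = e / 2 + e / 2 by rewrite -splitr.
exact: smallD.
Qed.

Lemma closure_sub S S' : S `<=` S' -> closure_acs_m S `<=` closure_acs_m S'.
Proof.
move=> SS x /small_closureP h; apply/small_closureP => e /h[y Sy xy].
by exists y => //; exact: SS.
Qed.

Lemma closureZD S c x y : subalgebra S -> closure_acs_m S x -> closure_acs_m S y ->
  closure_acs_m S (c *: x + y).
Proof.
move=> [_ SZD _] /small_closureP hx /small_closureP hy; apply/small_closureP => e e0.
pose d := e / 2 / (normc c + 1).
have q0 : 0 < normc c + 1 by rewrite ltr_wpDl// normc_ge0.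
have d0 : 0 < d by rewrite !divr_gt0.
have e2 : 0 < e / 2 by rewrite divr_gt0.
have [x' Sx' xx'] := hx _ d0; have [y' Sy' yy'] := hy _ e2.
exists (c *: x' + y'); first exact: SZD.
have -> : c *: x + y - (c *: x' + y') = c *: (x - x') + (y - y').
  by rewrite scalerBr addrACA opprD.
have -> : e = e / 2 + e / 2 by rewrite -splitr.
apply: smallD => //; apply: small_le (smallZ c xx').
  by rewrite ler_pdivrMr// ler_peMr ?(ltW e2)// lerDr normc_ge0.
by rewrite mulrA ler_pdivrMr// mulrC ler_wpM2l ?(ltW e2)// lerDl.
Qed.

Lemma closureM S x y : subalgebra S ->
  (forall z, S z -> exists2 M, 0 <= M & small z 0 M) ->
  closure_acs_m S x -> closure_acs_m S y -> closure_acs_m S (x * y).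
Proof.
move=> [_ _ SM] Sb /small_closureP hx /small_closureP hy; apply/small_closureP => e e0.
pose d := Num.min (e / 4) 1.
have d0 : 0 < d by rewrite lt_min divr_gt0 ?ltr01.
have d1 : d <= 1 by rewrite ge_min lexx orbT.
have de : d <= e / 4 by rewrite ge_min lexx.
have [x0 Sx0 xx0] := hx _ d0; have [M0 M00 bx0] := Sb _ Sx0.
have q0 : 0 < M0 + 1 by rewrite ltr_wpDl.
have [y1 Sy1 yy1] := hy _ (divr_gt0 d0 q0); have [M1 M10 by1] := Sb _ Sy1.
have q1 : 0 < M1 + 1 by rewrite ltr_wpDl.
have [x1 Sx1 xx1] := hx _ (divr_gt0 d0 q1).
exists (x1 * y1); first exact: SM.
have -> : x * y - x1 * y1 = (x - x0) * (y - y1) + x0 * (y - y1) + (x - x1) * y1.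
  by rewrite -mulrDl subrK mulrBr mulrBl addrA subrK.
have r0 : d / (M0 + 1) <= d by rewrite ler_pdivrMr// ler_peMr ?(ltW d0)// lerDr.
have r1 : d / (M1 + 1) <= d by rewrite ler_pdivrMr// ler_peMr ?(ltW d0)// lerDr.
have p0 : 0 <= d / (M0 + 1) by rewrite divr_ge0 ?ltW.
have p1 : 0 <= d / (M1 + 1) by rewrite divr_ge0 ?ltW.
have s1 := smallM (ltW d0) p0 xx0 yy1.
have s2 := smallM M00 p0 bx0 yy1.
have s3 := smallM p1 M10 xx1 by1.
apply: small_le (smallD (smallD s1 s2) s3); first by lra.
have h1 : d * (d / (M0 + 1)) <= d by rewrite ler_piMr ?(ltW d0)// (le_trans r0).
have h2 : M0 * (d / (M0 + 1)) <= d.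
  by rewrite mulrA ler_pdivrMr// mulrC ler_wpM2l ?(ltW d0)// lerDl.
have h3 : d / (M1 + 1) * M1 <= d.
  by rewrite mulrAC ler_pdivrMr// ler_wpM2l ?(ltW d0)// lerDl.
lra.
Qed.

Definition LT_pairs : set (ExM_D R) := closure_acs_m (@step_pairs R).

Lemma LT_subalgebra : subalgebra LT_pairs.
Proof.
split.
- by apply: sub_closure; case: (step_pairs_subalgebra R).
- by move=> c x y; apply: closureZD; exact: step_pairs_subalgebra.
- move=> x y; apply: closureM; first exact: step_pairs_subalgebra.
  move=> _ [K [c [K0 ->]]]; exists (table_bound c K); first exact: table_bound_ge0.
  exact: step_pair_bounded.
Qed.

Lemma LT_sub_C_D : LT_pairs `<=` C_D R.
Proof.
move=> x /small_closureP h; apply: real_symbol_has_symbol.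
apply: (@real_symbol_closed R (@step_pairs R)) => // _ [K [c [K0 ->]]].
exact: step_real_symbol.
Qed.

End closure_algebra.

(** * Diagonal sampling matrices *)

Section sampling.
Variable R : realType.
Local Notation T := (measurableTypeR R * measurableTypeR R)%type.
Local Notation area := (fine (muD R (D R))).

Definition oscillates (h : R -> R) K (t : R) (p : nat) : Prop :=
  exists2 u, p%:R / K%:R <= u <= p.+1%:R / K%:R & t < `|h u - h (p%:R / K%:R)|.

Section few_oscillating_cells.
Variables (a : R -> R[i]) (P : R[i] -> R).
Hypothesis Pnorm : forall z, `|P z| <= normc z.
Hypothesis PB : forall z w, P (z - w) = P z - P w.
Hypothesis Psum : forall (I : Type) (s : seq I) (F : I -> R[i]),
  P (\sum_(i <- s) F i) = \sum_(i <- s) P (F i).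
Hypothesis PM : forall (c : R) z, P (c%:C * z) = c * P z.

(* Choosing the tags so that every oscillating cell contributes positively, two
   Riemann sums on the uniform partition differ by the total oscillation. *)
Lemma few_oscillating_cells (t e : R) : riemann_integrable01 a -> 0 < t -> 0 < e ->
  exists K0, forall K, (K0 <= K)%N ->
    (#|finset (fun p : 'I_K => `[< oscillates (P \o a) K t p >])|)%:R <= e * K%:R.
Proof.
move=> [I aI] t0 e0; have d0 : 0 < e * t / 2 by rewrite !mulr_gt0 ?invr_gt0.
have [delta delta0 h] := aI _ d0.
exists (Num.truncn delta^-1).+1 => K K0K.
have K0 : 0 < K%:R :> R by rewrite ltr0n (leq_trans _ K0K).
have Kd : K%:R^-1 < delta.
  rewrite -[ltRHS]invrK ltf_pV2 ?posrE ?invr_gt0//.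
  by apply: lt_le_trans (truncnS_gt _) _; rewrite ler_nat.
pose s := [seq (i.+1%:R / K%:R : R) | i <- iota 0 K].
have sz : size s = K by rewrite size_map size_iota.
have s_nth i : (i < K)%N -> s`_i = i.+1%:R / K%:R.
  by move=> iK; rewrite (nth_map 0%N) ?size_iota// nth_iota// add0n.
have s_nth0 i : (i < K)%N -> (0 :: s)`_i = i%:R / K%:R.
  by case: i => [|i] iK /=; rewrite ?mul0r// s_nth// ltnW.
have ps : itv_partition 0 1 s.
  split.
    apply/(pathP 0) => i; rewrite sz => iK; rewrite s_nth0// s_nth//.
    by rewrite ltr_pM2r ?invr_gt0// ltr_nat.
  rewrite (last_nth 0) sz; case: (K) sz s_nth K0 => [|k] sz' sn; first by rewrite ltxx.
  by move=> _ /=; rewrite sn// divff// pnatr_eq0.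
pose u p := xget (p%:R / K%:R) [set u | p%:R / K%:R <= u <= p.+1%:R / K%:R /\
   t < `|P (a u) - P (a (p%:R / K%:R))|].
have u_in p : p%:R / K%:R <= u p <= p.+1%:R / K%:R.
  rewrite /u; case: xgetP => [y _ []//|_].
  by rewrite lexx ler_pM2r ?invr_gt0// ler_nat leqnSn.
have u_osc p : oscillates (P \o a) K t p -> t < `|P (a (u p)) - P (a (p%:R / K%:R))|.
  move=> [v v1 v2]; rewrite /u; case: xgetP => [y _ []//|/(_ v) no].
  by exfalso; apply: no.
have l_in p : (p%:R / K%:R : R) <= p%:R / K%:R <= p.+1%:R / K%:R.
  by rewrite lexx /= ler_wpM2r ?invr_ge0// ler_nat.
pose up p := P (a (p%:R / K%:R)) <= P (a (u p)).
pose t1 p := if up p then u p else p%:R / K%:R.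
pose t2 p := if up p then p%:R / K%:R else u p.
have mesh i : (i < K)%N -> s`_i - (0 :: s)`_i = K%:R^-1.
  move=> iK; rewrite s_nth// s_nth0// -mulrBl -[i.+1]addn1 natrD.
  by rewrite addrAC subrr add0r mul1r.
have rs1 : normc (riemann_sum a s t1 - I) < e * t / 2.
  apply: h => // i; rewrite sz => iK; rewrite mesh//; split => //.
  by rewrite s_nth// s_nth0// /t1; case: ifP => _; [exact: u_in|exact: l_in].
have rs2 : normc (riemann_sum a s t2 - I) < e * t / 2.
  apply: h => // i; rewrite sz => iK; rewrite mesh//; split => //.
  by rewrite s_nth// s_nth0// /t2; case: ifP => _; [exact: l_in|exact: u_in].
have rs : P (riemann_sum a s t1 - riemann_sum a s t2) < e * t.
  apply: le_lt_trans (ler_norm _) _; apply: le_lt_trans (Pnorm _) _.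
  have -> : riemann_sum a s t1 - riemann_sum a s t2 =
    (riemann_sum a s t1 - I) + (- (riemann_sum a s t2 - I)) by ring.
  apply: le_lt_trans (le_normcD _ _) _; rewrite normcN; lra.
rewrite -ler_pdivrMr// -(ler_pM2r t0); apply/ltW; apply: le_lt_trans rs.
rewrite PB /riemann_sum sz !Psum -sumrB -sum1_card natr_sum -mulrA mulr_suml.
rewrite big_mkcond /=; apply: ler_sum => p _; rewrite mesh// !PM -mulrBr.
have -> : P (a (t1 p)) - P (a (t2 p)) = `|P (a (u p)) - P (a (p%:R / K%:R))|.
  rewrite /t1 /t2; case: ifP => up1; first by rewrite ger0_norm// subr_ge0.
  by rewrite distrC ger0_norm// subr_ge0 ltW// ltNge; move: up1; rewrite /up => ->.
case: ifP => [|_]; last by rewrite mulr_ge0// invr_ge0 ltW.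
rewrite inE => /asboolP/u_osc tu; rewrite mul1r ler_wpM2l// ?invr_ge0 ltW//.
Qed.

End few_oscillating_cells.

Definition bad_cell (a : R -> R[i]) K (t : R) (p : nat) : Prop :=
  exists2 u, p%:R / K%:R <= u <= p.+1%:R / K%:R & t < normc (a u - a (p%:R / K%:R)).

Lemma few_bad_cells (a : R -> R[i]) (t e : R) : riemann_integrable01 a -> 0 < t -> 0 < e ->
  exists2 K, (0 < K)%N &
    (#|finset (fun p : 'I_K => `[< bad_cell a K t p >])|)%:R <= e * K%:R.
Proof.
move=> ra t0 e0; have t2 : 0 < t / 2 by rewrite divr_gt0.
have e2 : 0 < e / 2 by rewrite divr_gt0.
have [K1 h1] := few_oscillating_cells (@normc_Re R) (@ReB R) (@Re_sum R) (@Re_realM R) ra t2 e2.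
have [K2 h2] := few_oscillating_cells (@normc_Im R) (@ImB R) (@Im_sum R) (@Im_realM R) ra t2 e2.
pose K := (maxn K1 K2).+1; exists K => //.
have := lerD (h1 K _) (h2 K _); rewrite -natrD -mulrDl -splitr => /(_ _ _) h.
apply: le_trans (h _ _); last 2 first.
- by rewrite ltnW// ltnS leq_maxl.
- by rewrite ltnW// ltnS leq_maxr.
rewrite ler_nat; apply: leq_trans (leq_card_setU _ _); apply: subset_leq_card.
apply/fintype.subsetP => p; rewrite !inE => -[u u1 u2].
have := lt_le_trans u2 (normc_le_ReIm _); rewrite ReB ImB => h'.
have [h3|h3] := ltP (t / 2) `|complex.Re (a u) - complex.Re (a (p%:R / K%:R))|.
  by apply/orP; left; apply/asboolP; exists u.
apply/orP; right; apply/asboolP; exists u => //=; lra.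
Qed.

Lemma dft_diag_block_constant n b (d : 'rV[R[i]]_n) : (0 < b)%N ->
  (forall i j : 'I_n, blk b i = blk b j -> d 0 i = d 0 j) ->
  dft_diag b d = diag_mx d.
Proof.
move=> b0 dc; have /unitarymxP U1 := @block_dft_unitary R n b b0.
have comm : diag_mx d *m block_dft R n b = block_dft R n b *m diag_mx d.
  rewrite mul_diag_mx mul_mx_diag; apply/matrixP => i j; rewrite !mxE.
  case: eqP => [bij|_]; last by rewrite mulr0 mul0r.
  by rewrite (dc _ _ bij) mulrC.
by rewrite /dft_diag -mulmxA comm mulmxA (mulmx1C U1) mul1mx.
Qed.

Lemma sampling_sub_LT : @sampling_pairs R `<=` @LT_pairs R.
Proof.
move=> [A k] [a [ra /= -> kE]]; apply/small_closureP => e e0.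
have e2 : 0 < e / 2 by rewrite divr_gt0.
have [K K0 badK] := few_bad_cells ra e0 e2.
have KR : 0 < K%:R :> R by rewrite ltr0n.
pose c (p r : nat) := a (p%:R / K%:R).
pose bad p := `[< bad_cell a K e p >].
have badE : \sum_(p < K) (bad p)%:R = (#|finset (fun p : 'I_K => bad p)|)%:R :> R.
  rewrite -sum1_card natr_sum [RHS]big_mkcond; apply: eq_bigr => p _.
  by rewrite inE; case: (bad p).
exists (step_pair K c); first by exists K, c.
split => /=.
  apply: filterS (block_count_small (3 * K.+1) e2) => n Cn.
  set N := n.+1; set b := bsz n; have b0 : (0 < b)%N := bsz_gt0 n.
  have N0 : (0 < N)%N by [].
  pose J0 := finset (fun i : 'I_N => (K * (blk b i * b)) %/ N != (K * (i + 0)) %/ N)%N.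
  pose J1 := finset (fun i : 'I_N => (K * (blk b i * b)) %/ N != (K * (i + 1)) %/ N)%N.
  pose J2 := finset (fun i : 'I_N => bad ((K * i) %/ N)%N).
  have cJ0 : (#|J0| <= K.+1 * b.+1)%N.
    by apply: (@card_cell_edges N b b0 K 0) => // i; rewrite inE => /eqP.
  have cJ1 : (#|J1| <= K.+1 * b.+1)%N.
    by apply: (@card_cell_edges N b b0 K 1) => // i; rewrite inE => /eqP.
  have cJ2 : #|J2|%:R <= e / 2 * N%:R + K%:R :> R.
    have := @sum_cells_bound R K K0 (fun p => (bad p)%:R) N N0.
    have -> : \sum_(s < N) (bad ((K * s) %/ N)%N)%:R = #|J2|%:R :> R.
      rewrite -sum1_card natr_sum [RHS]big_mkcond; apply: eq_bigr => p _.
      by rewrite inE; case: (bad _).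
    have -> : \sum_(r < K) `|(bad r)%:R : R| = \sum_(r < K) (bad r)%:R.
      by apply: eq_bigr => r _; rewrite ger0_norm.
    rewrite badE => h; have {}h := le_trans (ler_norm _) h.
    rewrite lerBlDr in h; apply: le_trans h _; rewrite addrC lerD//.
      set cb := (#|_|%:R : R).
      have -> : N%:R / K%:R * cb = cb / K%:R * N%:R by field; rewrite gt_eqF.
      by rewrite ler_wpM2r// ler_pdivrMr.
    by rewrite ler_nat; apply: leq_trans (max_card _) _; rewrite card_ord.
  exists #|J0 :|: J1 :|: J2|.
    apply: (@le_trans _ _ ((#|J0| + #|J1| + #|J2|)%:R)).
      rewrite ler_nat; apply: leq_trans (leq_card_setU _ _) _.
      by rewrite leq_add2r leq_card_setU.
    rewrite natrD; apply: le_trans (lerD (lexx _) cJ2) _.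
    have -> : e * N%:R = e / 2 * N%:R + e / 2 * N%:R by rewrite -mulrDl -splitr.
    rewrite addrCA lerD2l -natrD; apply: le_trans _ Cn; rewrite ler_nat.
    rewrite -/N -/b; move: cJ0 cJ1; move: (#|J0|) (#|J1|) (N %/ b)%N => x y z *; nia.
  rewrite -[X in sigma X]/(diag_sampling N a - dft_diag b (sample K c n)).
  rewrite dft_diag_block_constant//; last by move=> i j bij; rewrite !mxE bij.
  rewrite /diag_sampling; set d := \row_i _.
  have -> : diag_mx d - diag_mx (sample K c n) =
      (1%:M)^t* *m diag_mx (d - sample K c n) *m 1%:M.
    by rewrite trmx1 map_mx1 mul1mx mulmx1 raddfB.
  apply: (@sigma_unitary_diag_le _ _ _ _ _ (J0 :|: J1 :|: J2)) => //.
  - by apply/unitarymxP; rewrite trmx1 map_mx1 mulmx1.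
  - exact: ltW.
  move=> i; rewrite !finset.in_setU !negb_or => /andP[/andP[]].
  rewrite !finset.in_set !negbK addn0 => /eqP j0 /eqP j1 /negP j2.
  rewrite !mxE /c leNgt; apply/negP => h; apply: j2; apply/asboolP.
  have NR : 0 < N%:R :> R by rewrite ltr0n.
  rewrite -j0; exists (i.+1%:R / N%:R) => //.
  rewrite j1 addn1; set q := ((K * i.+1) %/ N)%N.
  rewrite ler_pdivrMr// mulrAC ler_pdivlMr// -!natrM ler_nat.
  rewrite ler_pdivrMr// [X in _ <= X]mulrAC ler_pdivlMr// -!natrM ler_nat.
  rewrite [(i.+1 * K)%N]mulnC leq_divM/=; apply/ltnW; exact: ltn_ceil.
pose B : set T := [set x | bad (cellx K x)].
have mB : measurable B.
  rewrite (_ : B = \bigcup_(p in [set p | bad p]) [set x | cellx K x = p]).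
    by apply: bigcup_measurable => p _; exact: measurable_cellx.
  by apply/seteqP; split => [x Bx|x [p /= bp xp]]; [exists (cellx K x)|rewrite /B /= xp].
exists B; split => //.
  have mD := @measurable_D R.
  have := @Rintegral_cells R K K0 (fun p r => (bad p)%:R) 1 (\1_B) (measurable_indic mB) _ _.
  have -> : \int[muD R]_(x in D R) \1_B x = fine (muD R B).
    by rewrite /Rintegral integral_indic//= /muD /= /mrestr -setIA setIid.
  move=> h; rewrite -[muD R B]fineK ?muD_fin_num// lee_fin h.
  - rewrite (eq_bigr (fun p : 'I_K => (bad p)%:R * K%:R)) => [|p _]; last first.
      by rewrite sumr_const card_ord mulr_natr.
    rewrite -mulr_suml badE natrX.
    have -> : area / K%:R ^+ 2 * (#|finset (fun p : 'I_K => bad p)|%:R * K%:R) =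
        #|finset (fun p : 'I_K => bad p)|%:R / K%:R * area by field; rewrite gt_eqF.
    rewrite ler_wpM2r ?(ltW (area_gt0 R))// ler_pdivrMr//; apply: le_trans badK _.
    by rewrite ler_wpM2r ?(ltW KR)//; lra.
  - by move=> x; rewrite indicE; case: (x \in B); rewrite ?normr1 ?normr0.
  - apply: nearW => x; rewrite indicE; have [xB|xB] := boolP (x \in B).
      by rewrite inE in xB; rewrite xB.
    by rewrite notin_setE in xB; case: (boolP (bad (cellx K x))) => [/xB[]|_].
have kE' : \forall x \ae muD R, k x = a x.1 by exact: ae_muDP kE.
have h1 := aeclassDE k (- step_class K c); have h2 := aeclassNE (step_class K c).
have h3 := step_classE K c; have h4 := ae_cell_lt R K0; have h5 := ae_muD R.
apply: filterS3 (filterI h1 h2) (filterI h3 kE') (filterI h4 h5).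
move=> x [-> ->] [-> ->] [[cK _] Dx] nBx; rewrite /step_fun /c leNgt.
apply/negP => h; apply: nBx; apply/asboolP; exists x.1 => //.
case: Dx => /=; rewrite in_itv /= => /andP[x0 _] _.
have := truncn_itv (mulr_ge0 (ler0n R K) x0); rewrite -/(cellx K x) => /andP[g1 g2].
by rewrite ler_pdivrMr// ler_pdivlMr// ![x.1 * _]mulrC g1 ltW.
exact: (ae_filter_ringOfSetsType (muD R)).
Qed.

End sampling.

(** * Density in L1 of algebras of bounded functions *)

Import HBSimple.

Section ereal_null_sequences.
Variable R : realType.

Lemma cvge0_small (u : (\bar R)^nat) : u @ \oo --> 0%E ->
  forall e : R, 0 < e -> \forall n \near \oo, (u n < e%:E)%E.
Proof.
move=> /fine_cvgP[uf /cvgrPdist_lt ucv] e e0; apply: filterS2 uf (ucv _ e0) => n un.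
rewrite sub0r normrN => h; rewrite -[u n]fineK// lte_fin; exact: le_lt_trans (ler_norm _) h.
Qed.

End ereal_null_sequences.

Section L1_density.
Context d (X : measurableType d) (R : realType).
Variables (mu : {measure set X -> \bar R}) (E : set X).
Hypothesis mE : measurable E.
Hypothesis Efin : (mu E < +oo)%E.
Variable V : set (X -> R).
Hypothesis V_measurable : forall v, V v -> measurable_fun E v.
Hypothesis V_bounded : forall v, V v -> exists M, forall x, E x -> `|v x| <= M.
Hypothesis V1 : V (cst 1).
Hypothesis VD : forall v w, V v -> V w -> V (fun x => v x + w x).
Hypothesis VZ : forall c v, V v -> V (fun x => c * v x).
Hypothesis VM : forall v w, V v -> V w -> V (fun x => v x * w x).

Implicit Types f g h v w y : X -> R.

Definition L1dist (f g : X -> R) : \bar R := (\int[mu]_(x in E) (`|f x - g x|)%:E)%E.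

Lemma L1dist_ge0 f g : (0 <= L1dist f g)%E.
Proof. by apply: integral_ge0 => x _; rewrite lee_fin. Qed.

Lemma measurable_dist f g : measurable_fun E f -> measurable_fun E g ->
  measurable_fun E (fun x => (`|f x - g x|)%:E).
Proof.
by move=> mf mg; apply/measurable_EFinP; apply: measurableT_comp => //; exact: measurable_funB.
Qed.

Lemma L1dist_triangle f g h : measurable_fun E f -> measurable_fun E g ->
  measurable_fun E h -> (L1dist f h <= L1dist f g + L1dist g h)%E.
Proof.
move=> mf mg mh; rewrite /L1dist -(ge0_integralD mu mE).
- apply: (ge0_le_integral mu mE).
  + by move=> x _; rewrite lee_fin.
  + exact: measurable_dist.
  + by apply: emeasurable_funD; exact: measurable_dist.
  move=> x _; rewrite -EFinD lee_fin.
  by apply: le_trans (ler_normD _ _); rewrite addrA subrK.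
- by move=> x _; rewrite lee_fin.
- exact: measurable_dist.
- by move=> x _; rewrite lee_fin.
- exact: measurable_dist.
Qed.

Lemma L1dist_add f g f' g' : measurable_fun E f -> measurable_fun E g ->
  measurable_fun E f' -> measurable_fun E g' ->
  (L1dist (fun x => f x + f' x)%R (fun x => g x + g' x)%R <= L1dist f g + L1dist f' g')%E.
Proof.
move=> mf mg mf' mg'; rewrite /L1dist -(ge0_integralD mu mE).
- apply: (ge0_le_integral mu mE).
  + by move=> x _; rewrite lee_fin.
  + by apply: measurable_dist; exact: measurable_funD.
  + by apply: emeasurable_funD; exact: measurable_dist.
  move=> x _; rewrite -EFinD lee_fin; apply: le_trans (ler_normD _ _).
  by rewrite opprD addrACA.
- by move=> x _; rewrite lee_fin.
- exact: measurable_dist.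
- by move=> x _; rewrite lee_fin.
- exact: measurable_dist.
Qed.

Lemma L1dist_scale c f g : measurable_fun E f -> measurable_fun E g ->
  L1dist (fun x => c * f x) (fun x => c * g x) = (`|c|%:E * L1dist f g)%E.
Proof.
move=> mf mg; rewrite /L1dist -(ge0_integralZl mu mE).
- by apply: eq_integral => x _; rewrite -EFinM -normrM mulrBr.
- exact: measurable_dist.
- by move=> x _; rewrite lee_fin.
- by rewrite lee_fin.
Qed.

Definition approximable (f : X -> R) : Prop :=
  measurable_fun E f /\ forall e, 0 < e -> exists2 v, V v & (L1dist f v < e%:E)%E.

Lemma approximableV v : V v -> approximable v.
Proof.
move=> Vv; split; first exact: V_measurable.
move=> e e0; exists v => //; rewrite /L1dist integral0_eq ?lte_fin// => x _.
by rewrite subrr normr0.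
Qed.

Lemma approximable_lim f : measurable_fun E f ->
  (forall e, 0 < e -> exists2 g, approximable g & (L1dist f g < e%:E)%E) -> approximable f.
Proof.
move=> mf h; split=> // e e0; have e2 : 0 < e / 2 by rewrite divr_gt0.
have [g [mg ag] fg] := h _ e2; have [v Vv gv] := ag _ e2; exists v => //.
apply: le_lt_trans (L1dist_triangle mf mg (V_measurable Vv)) _.
by rewrite [e]splitr EFinD lteD.
Qed.

Lemma approximableD f g : approximable f -> approximable g ->
  approximable (fun x => f x + g x).
Proof.
move=> [mf af] [mg ag]; split; first exact: measurable_funD.
move=> e e0; have e2 : 0 < e / 2 by rewrite divr_gt0.
have [v Vv fv] := af _ e2; have [w Vw gw] := ag _ e2.
exists (fun x => v x + w x); first exact: VD.
apply: le_lt_trans (L1dist_add mf (V_measurable Vv) mg (V_measurable Vw)) _.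
by rewrite [e]splitr EFinD lteD.
Qed.

Lemma approximableZ c f : approximable f -> approximable (fun x => c * f x).
Proof.
move=> [mf af]; split; first by apply: measurable_funM.
move=> e e0; have q0 : 0 < `|c| + 1 by rewrite ltr_wpDl.
have [v Vv fv] := af _ (divr_gt0 e0 q0).
exists (fun x => c * v x); first exact: VZ.
rewrite L1dist_scale//; last exact: V_measurable.
apply: (@le_lt_trans _ _ ((`|c| + 1)%:E * L1dist f v)%E).
  by apply: lee_wpmul2r; [exact: L1dist_ge0|rewrite lee_fin lerDl].
by rewrite -lte_pdivlMl// -EFinM mulrC.
Qed.

Lemma approximable0 : approximable (cst 0).
Proof.
have := approximableZ 0 (approximableV V1).
by rewrite (_ : (fun x => _) = cst 0)//; apply/funext => x; rewrite mul0r.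
Qed.

Lemma approximable_sum (I : Type) (s : seq I) (F : I -> X -> R) :
  (forall i, approximable (F i)) -> approximable (fun x => \sum_(i <- s) F i x).
Proof.
move=> aF; elim: s => [|i s IH].
  by under eq_fun do rewrite big_nil; exact: approximable0.
by under eq_fun do rewrite big_cons; exact: approximableD.
Qed.

Lemma eq_approximable f g : (forall x, E x -> f x = g x) -> approximable f -> approximable g.
Proof.
move=> fg [mf af]; split.
  by apply: eq_measurable_fun mf => x; rewrite inE => /fg.
move=> e /af[v Vv fv]; exists v => //; apply: le_lt_trans fv.
rewrite le_eqVlt; apply/orP; left; apply/eqP; apply: eq_integral => x.
by rewrite inE => /fg ->.
Qed.

Lemma ae_eq_approximable f g : measurable_fun E g ->
  (\forall x \ae mu, E x -> f x = g x) -> approximable f -> approximable g.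
Proof.
move=> mg fg af; apply: approximable_lim => // e e0; exists f => //.
have -> : L1dist g f = 0%E; last by rewrite lte_fin.
rewrite -(integral0 mu E); apply: ae_eq_integral => //.
  by apply: measurable_dist => //; case: af.
by apply: filterS fg => x h /h /= ->; rewrite subrr normr0.
Qed.

Lemma L1dist_bounded_cvg f (g : nat -> X -> R) M : measurable_fun E f ->
  (forall n, measurable_fun E (g n)) ->
  (\forall x \ae mu, E x -> g n x @[n --> \oo] --> f x) ->
  (forall n x, E x -> `|g n x| <= M) ->
  forall e, 0 < e -> exists n, (L1dist f (g n) < e%:E)%E.
Proof.
move=> mf mg gf gM e e0.
have [//|||||_ + _] := @dominated_convergence _ _ _ mu _ mE (fun n x => (g n x)%:E)
   (fun x => (f x)%:E) (fun x => M%:E).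
- by move=> n; exact/measurable_EFinP.
- exact/measurable_EFinP.
- by apply: filterS gf => x h Ex; apply: cvg_EFin; [exact: nearW|exact: h].
- apply/integrableP; split; first exact: measurable_cst.
  by rewrite integral_cst// lte_mul_pinfty.
- by apply: nearW => x n Ex; rewrite lee_fin gM.
move=> /cvge0_small/(_ _ e0)[N _ /(_ N (leqnn N)) /= qe]; exists N.
apply: le_lt_trans qe; rewrite le_eqVlt; apply/orP; left; apply/eqP.
by apply: eq_integral => x _ /=; rewrite distrC.
Qed.

Lemma approximable_seq f (g : nat -> X -> R) : measurable_fun E f ->
  (forall n, approximable (g n)) ->
  (forall e, 0 < e -> exists n, (L1dist f (g n) < e%:E)%E) -> approximable f.
Proof.
move=> mf ag h; apply: approximable_lim => // e /h[n fg].
by exists (g n).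
Qed.

Lemma V_exp v n : V v -> V (fun x => v x ^+ n).
Proof.
move=> Vv; elim: n => [|n IH].
  by rewrite (_ : (fun x => _) = cst 1)//; apply/funext => x; rewrite expr0.
by under eq_fun do rewrite exprS; exact: VM.
Qed.

Lemma bernoulli_exp (z : R) n : -1 <= z -> 1 + n%:R * z <= (1 + z) ^+ n.
Proof.
move=> z1; elim: n => [|n IH]; first by rewrite mul0r addr0 expr0.
have z0 : 0 <= 1 + z by lra.
apply: le_trans (_ : (1 + n%:R * z) * (1 + z) <= _); last by rewrite exprSr ler_wpM2r.
have : 0 <= n%:R * (z * z) by rewrite mulr_ge0// -expr2 sqr_ge0.
rewrite -[n.+1]addn1 natrD mulrDl mulrDr; nra.
Qed.

(* [(1 - y^n)^(2^n)] converges to the indicator of [y < 1/2] off [y = 1/2]. *)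
Lemma threshold_cvg (y : R) : 0 <= y <= 1 -> y != 2^-1 ->
  (fun n => (1 - y ^+ n) ^+ (2 ^ n)) @ \oo --> (((y < 2^-1)%R)%:R : R).
Proof.
move=> /andP[y0 y1] y2.
pose r := if y < 2^-1 then 2 * y else (2 * y)^-1.
have [r0 r1] : 0 <= r /\ r < 1.
  rewrite /r; case: ltP => h; first by split; lra.
  have h' : 2^-1 < y by rewrite lt_neqAle eq_sym y2.
  split; first by rewrite invr_ge0; lra.
  by rewrite invf_lt1; lra.
have key n : `|((y < 2^-1)%R)%:R - (1 - y ^+ n) ^+ (2 ^ n)| <= r ^+ n.
  have yn0 : 0 <= y ^+ n by rewrite exprn_ge0.
  have yn1 : y ^+ n <= 1 by rewrite exprn_ile1.
  have p0 : 0 <= (1 - y ^+ n) ^+ (2 ^ n) by rewrite exprn_ge0// subr_ge0.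
  have p1 : (1 - y ^+ n) ^+ (2 ^ n) <= 1 by rewrite exprn_ile1 ?subr_ge0//; lra.
  rewrite /r; case: ltP => h /=.
    rewrite ger0_norm ?subr_ge0// exprMn -natrX.
    have := @bernoulli_exp (- y ^+ n) (2 ^ n); rewrite lerNr opprK => /(_ yn1).
    by rewrite mulrN; lra.
  rewrite sub0r normrN ger0_norm// exprVn exprMn.
  have h' : 0 < y by apply: lt_le_trans h; rewrite invr_gt0.
  have yn : 0 < 2 ^+ n * y ^+ n by rewrite mulr_gt0// exprn_gt0.
  rewrite -[leRHS]mul1r ler_pdivlMr//.
  apply: (@le_trans _ _ ((1 - y ^+ n) ^+ (2 ^ n) * (1 + y ^+ n) ^+ (2 ^ n))).
    rewrite ler_wpM2l//; apply: le_trans (bernoulli_exp _ _); last by lra.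
    by rewrite natrX lerDr.
  rewrite -exprMn exprn_ile1//.
    by rewrite mulr_ge0// ?subr_ge0// addr_ge0.
  have := sqr_ge0 (y ^+ n); rewrite expr2; lra.
apply/cvgrPdist_le => e e0.
have rn1 : `|r| < 1 by rewrite ger0_norm.
have /cvgrPdist_le/(_ _ e0) := cvg_expr rn1; apply: filterS => n.
by rewrite sub0r normrN ger0_norm ?exprn_ge0//; exact: le_trans.
Qed.

Lemma approximable_threshold y w : V y -> V w ->
  (forall x, E x -> 0 <= y x <= 1) -> (\forall x \ae mu, E x -> y x != 2^-1) ->
  approximable (fun x => ((y x < 2^-1)%R)%:R * w x).
Proof.
move=> Vy Vw y01 y2; have my := V_measurable Vy; have mw := V_measurable Vw.
have mt : measurable_fun E (fun x => ((y x < 2^-1)%R)%:R * w x).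
  apply: measurable_funM => //.
  rewrite (_ : (fun x => _) = (fun b : bool => (b%:R : R)) \o (fun x => y x < 2^-1)) //.
  by apply: measurableT_comp => //; apply: measurable_fun_ltr.
pose q n x := (1 - y x ^+ n) ^+ (2 ^ n) * w x.
have Vq n : V (q n).
  apply: (VM _ Vw); apply: (@V_exp (fun x => 1 - y x ^+ n)).
  rewrite (_ : (fun x => _) = (fun x => cst 1 x + (-1) * y x ^+ n)).
    by apply: VD => //; apply: VZ; exact: V_exp.
  by apply/funext => x; rewrite mulN1r.
have [M wM] := V_bounded Vw; apply: (approximable_seq mt (fun n => approximableV (Vq n))).
apply: (@L1dist_bounded_cvg _ q M) => //.
- by move=> n; exact: V_measurable.
- apply: filterS y2 => x h Ex.
  by apply: cvgMr_tmp; apply: threshold_cvg; [exact: y01|exact: h].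
- move=> n x Ex; rewrite /q normrM; have /andP[y0 y1] := y01 _ Ex.
  apply: le_trans (wM _ Ex); rewrite ler_piMl// ger0_norm.
    by rewrite exprn_ile1 ?subr_ge0 ?exprn_ile1// lerBlDr lerDl exprn_ge0.
  by rewrite exprn_ge0// subr_ge0 exprn_ile1.
Qed.

Lemma approximable_dynkin d' (Y : measurableType d') (G : set (set Y)) (phi : X -> Y)
    (W : set X) :
  measurable_fun setT phi -> measurable W -> approximable \1_W ->
  @measurable _ Y = <<s G >> -> setI_closed G ->
  (forall A, G A -> approximable \1_(phi @^-1` A `&` W)) ->
  forall A, measurable A -> approximable \1_(phi @^-1` A `&` W).
Proof.
move=> mphi mW aW GE GI GA A mA.
have mpre B : measurable B -> measurable (phi @^-1` B `&` W).
  by move=> mB; apply: measurableI => //; rewrite -[X in measurable X]setTI; exact: mphi.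
apply: (dynkin_induction (P := fun A => approximable \1_(phi @^-1` A `&` W)) GE GI _ _ _ _ (S := A)) => //.
- by rewrite preimage_setT setTI.
- move=> S mS aS; apply: eq_approximable (approximableD aW (approximableZ (-1) aS)) => x _.
  rewrite !indicE; have [xW|xW] := boolP (x \in W); last first.
    rewrite !memNset ?mulr0 ?addr0//; rewrite notin_setE in xW; by move=> [].
  rewrite inE in xW; have [Sx|Sx] := pselect (S (phi x)).
    by rewrite mem_set// memNset ?mulr1 ?subrr// => -[].
  by rewrite memNset ?mulr0 ?addr0; [rewrite mem_set|case].
- move=> F mF tF aF; have mU : measurable (\bigcup_k F k) by exact: bigcup_measurable.
  pose H n := phi @^-1` F n `&` W.
  have mH n : measurable (H n) by exact: mpre.
  pose g n x : R := \sum_(i < n) \1_(H i) x.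
  have ag n : approximable (g n) by apply: approximable_sum => i; exact: aF.
  have tH i j x : H i x -> H j x -> i = j.
    by move=> [Fi _] [Fj _]; apply: (tF i j) => //; exists (phi x).
  have g1 n x i : H i x -> (i < n)%N -> g n x = 1.
    move=> Hi i_n; rewrite /g (bigD1 (Ordinal i_n))//= indicE mem_set// big1 ?addr0// => j ji.
    rewrite indicE memNset// => Hj; case/eqP: ji; apply/val_inj; exact: tH Hj Hi.
  have g0 n x : (forall i, ~ H i x) -> g n x = 0.
    by move=> nH; rewrite /g big1// => i _; rewrite indicE memNset.
  apply: (approximable_seq _ ag); first by apply: measurable_funTS; apply: measurable_indic; exact: mpre.
  apply: (@L1dist_bounded_cvg _ g 1) => //.
  + by apply: measurable_funTS; apply: measurable_indic; exact: mpre.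
  + by move=> n; case: (ag n).
  + apply: nearW => x _; have [[i Hi]|nH] := pselect (exists i, H i x).
      rewrite indicE mem_set; last by case: Hi => Fi Wx; split => //; exists i.
      apply: cvg_near_cst; exists i.+1 => // n /= i_n; exact: g1 Hi i_n.
    rewrite indicE memNset; last by move=> [[i _ Fi] Wx]; apply: nH; exists i.
    by apply: cvg_near_cst; apply: nearW => n; apply: g0 => i Hi; apply: nH; exists i.
  + move=> n x _; have [[i Hi i_n]|nH] := pselect (exists2 i, H i x & (i < n)%N).
      by rewrite (g1 _ _ _ Hi i_n) ger0_norm.
    rewrite /g big1 ?normr0// => i _; rewrite indicE memNset// => Hi.
    by apply: nH; exists i.
- by rewrite -GE.
Qed.

Lemma approximable_integrable f :
  (forall A, measurable A -> approximable \1_A) ->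
  mu.-integrable E (EFin \o f) -> approximable f.
Proof.
move=> aI fi; have mf : measurable_fun E f.
  by apply/measurable_EFinP; case/integrableP: fi.
have [s [_ _ sf]] := approximation_sfun_integrable mE fi.
refine (@approximable_seq f (fun n x => s n x) mf _ _).
  move=> n; have -> : (fun x => s n x) = fun x =>
      \sum_(y <- finmap.enum_fset (fset_set (range (s n)))) (y * \1_(s n @^-1` [set y]) x).
    by apply/funext => x; rewrite fimfunE fsbig_finite.
  apply: approximable_sum => i; apply: approximableZ; apply: aI.
  by rewrite -[X in measurable X]setTI; exact: measurable_funPT.
move=> e e0; have [N _ /(_ N (leqnn N)) /= qe] := cvge0_small sf e0; exists N.
apply: le_lt_trans qe; rewrite le_eqVlt; apply/orP; left; apply/eqP.
by [].
Qed.

End L1_density.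

(** * Toeplitz matrices *)

Section complex_integration.
Context d (X : measurableType d) (R : realType).
Variables (mu : {measure set X -> \bar R}) (D : set X).
Hypothesis mD : measurable D.
Implicit Types (g h : X -> R) (f : X -> R[i]).

Local Notation rintegrable g := (mu.-integrable D (EFin \o g)).

Lemma rintegrableD g h : rintegrable g -> rintegrable h -> rintegrable (fun x => g x + h x).
Proof. exact: integrableD. Qed.

Lemma rintegrableZ c g : rintegrable g -> rintegrable (fun x => c * g x).
Proof. exact: integrableZl. Qed.

Lemma rintegrableB g h : rintegrable g -> rintegrable h -> rintegrable (fun x => g x - h x).
Proof. exact: integrableB. Qed.

Lemma rintegrableM g h : rintegrable g -> measurable_fun D h ->
  (forall x, D x -> `|h x| <= 1) -> rintegrable (fun x => g x * h x).
Proof.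
move=> ig mh h1; apply: (le_integrable mD _ _ ig).
  apply/measurable_EFinP; apply: measurable_funM => //.
  by apply/measurable_EFinP; case/integrableP: ig.
by move=> x Dx /=; rewrite lee_fin normrM ler_piMr// h1.
Qed.

Lemma cintegrableD f1 f2 : cintegrable mu D f1 -> cintegrable mu D f2 ->
  cintegrable mu D (fun x => f1 x + f2 x).
Proof.
move=> [r1 i1] [r2 i2]; split.
  rewrite (_ : (fun x => _) = EFin \o (fun x => complex.Re (f1 x) + complex.Re (f2 x))).
    exact: rintegrableD.
  by apply/funext => x /=; congr EFin; case: (f1 x) (f2 x) => ? ? [].
rewrite (_ : (fun x => _) = EFin \o (fun x => complex.Im (f1 x) + complex.Im (f2 x))).
  exact: rintegrableD.
by apply/funext => x /=; congr EFin; case: (f1 x) (f2 x) => ? ? [].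
Qed.

Lemma cintegrableM f (h : X -> R[i]) : cintegrable mu D f ->
  measurable_fun D (fun x => complex.Re (h x)) -> measurable_fun D (fun x => complex.Im (h x)) ->
  (forall x, D x -> normc (h x) <= 1) -> cintegrable mu D (fun x => f x * h x).
Proof.
move=> [r i] mr mi h1.
have hr x : D x -> `|complex.Re (h x)| <= 1 by move=> /h1; exact: le_trans (normc_Re _).
have hi x : D x -> `|complex.Im (h x)| <= 1 by move=> /h1; exact: le_trans (normc_Im _).
split.
  rewrite (_ : (fun x => _) = EFin \o (fun x => complex.Re (f x) * complex.Re (h x) -
      complex.Im (f x) * complex.Im (h x))).
    by apply: rintegrableB; exact: rintegrableM.
  by apply/funext => x /=; congr EFin; case: (f x) (h x) => ? ? [].
rewrite (_ : (fun x => _) = EFin \o (fun x => complex.Re (f x) * complex.Im (h x) +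
    complex.Im (f x) * complex.Re (h x))).
  by apply: rintegrableD; exact: rintegrableM.
by apply/funext => x /=; congr EFin; case: (f x) (h x) => ? ? [].
Qed.

Lemma cintegrableZ c f : cintegrable mu D f -> cintegrable mu D (fun x => c * f x).
Proof.
case: c => a b [r i]; split.
  rewrite (_ : (fun x => _) = EFin \o (fun x => a * complex.Re (f x) - b * complex.Im (f x))).
    by apply: rintegrableB; exact: rintegrableZ.
  by apply/funext => x /=; congr EFin; case: (f x).
rewrite (_ : (fun x => _) = EFin \o (fun x => a * complex.Im (f x) + b * complex.Re (f x))).
  by apply: rintegrableD; exact: rintegrableZ.
by apply/funext => x /=; congr EFin; case: (f x).
Qed.

Lemma cintegralD f1 f2 : cintegrable mu D f1 -> cintegrable mu D f2 ->
  cintegral mu D (fun x => f1 x + f2 x) = cintegral mu D f1 + cintegral mu D f2.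
Proof.
move=> [r1 i1] [r2 i2]; rewrite /cintegral; congr Complex; rewrite -RintegralD//.
  by apply: eq_Rintegral => x _; case: (f1 x) (f2 x) => ? ? [].
by apply: eq_Rintegral => x _; case: (f1 x) (f2 x) => ? ? [].
Qed.

Lemma cintegralZ c f : cintegrable mu D f ->
  cintegral mu D (fun x => c * f x) = c * cintegral mu D f.
Proof.
case: c => a b [r i]; rewrite /cintegral; congr Complex; rewrite -!RintegralZl//.
  rewrite -RintegralB//; [|exact: rintegrableZ|exact: rintegrableZ].
  by apply: eq_Rintegral => x _; case: (f x).
rewrite -RintegralD//; [|exact: rintegrableZ|exact: rintegrableZ].
by apply: eq_Rintegral => x _; case: (f x).
Qed.

Lemma cintegrable0 : cintegrable mu D (fun=> 0).
Proof. by split; apply: integrable0. Qed.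

Lemma cintegral0 : cintegral mu D (fun=> 0) = 0.
Proof. by rewrite /cintegral !Rintegral_cst// !mul0r. Qed.

Lemma cintegrable_sum (I : Type) (s : seq I) (F : I -> X -> R[i]) :
  (forall i, cintegrable mu D (F i)) -> cintegrable mu D (fun x => \sum_(i <- s) F i x).
Proof.
move=> iF; elim: s => [|i s IH].
  by under eq_fun do rewrite big_nil; exact: cintegrable0.
by under eq_fun do rewrite big_cons; exact: cintegrableD.
Qed.

Lemma cintegral_sum (I : Type) (s : seq I) (F : I -> X -> R[i]) :
  (forall i, cintegrable mu D (F i)) ->
  cintegral mu D (fun x => \sum_(i <- s) F i x) = \sum_(i <- s) cintegral mu D (F i).
Proof.
move=> iF; elim: s => [|i s IH].
  by under eq_fun do rewrite big_nil; rewrite cintegral0 big_nil.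
under eq_fun do rewrite big_cons.
by rewrite big_cons cintegralD ?IH//; exact: cintegrable_sum.
Qed.

Lemma eq_cintegral f1 f2 : (forall x, D x -> f1 x = f2 x) ->
  cintegral mu D f1 = cintegral mu D f2.
Proof.
by move=> e; rewrite /cintegral; congr Complex; apply: eq_Rintegral => x; rewrite inE => /e ->.
Qed.

Lemma cintegral_conj f : cintegrable mu D f ->
  cintegral mu D (fun x => (f x)^*) = (cintegral mu D f)^*.
Proof.
move=> [r i]; rewrite /cintegral /=; congr Complex.
  by apply: eq_Rintegral => x _; case: (f x).
rewrite -mulN1r -RintegralZl//.
by apply: eq_Rintegral => x _; rewrite mulN1r; case: (f x).
Qed.

End complex_integration.

Section fourier.
Variable R : realType.
Local Notation leb := (@lebesgue_measure R).
Local Notation I := (`[(- pi)%R, (pi : R)]%classic).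

Let mI : measurable (I : set (measurableTypeR R)).
Proof. exact: measurable_itv. Qed.

Lemma leb_I : leb I = (2 * pi)%:E.
Proof.
rewrite lebesgue_measure_itv /= lte_fin gtrN ?pi_gt0// -EFinB opprK.
by congr EFin; ring.
Qed.

Lemma measurable_cosM (k : R) : measurable_fun (I : set (measurableTypeR R)) (fun t => cos (k * t)).
Proof.
apply: measurable_funTS; apply: (measurableT_comp (continuous_measurable_fun (@continuous_cos R))).
exact: measurable_funM.
Qed.

Lemma measurable_sinM (k : R) : measurable_fun (I : set (measurableTypeR R)) (fun t => sin (k * t)).
Proof.
apply: measurable_funTS; apply: (measurableT_comp (continuous_measurable_fun (@continuous_sin R))).
exact: measurable_funM.
Qed.

Lemma cintegrable_expiM (f : R -> R[i]) (k : R) :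
  cintegrable leb I f -> cintegrable leb I (fun t => f t * expi (k * t)).
Proof.
move=> cf; apply: (cintegrableM mI) => //.
- exact: measurable_cosM.
- exact: measurable_sinM.
- by move=> x _; rewrite normc_expi.
Qed.

Lemma cintegrable1 : cintegrable leb I (fun=> 1).
Proof.
have h (a : R) : leb.-integrable I (EFin \o cst a).
  apply: measurable_bounded_integrable => //; first by rewrite /= leb_I ltry.
  exists `|a|; split; first exact: num_real.
  by move=> M aM x _; exact: ltW.
by split; [exact: (h 1)|exact: (h 0)].
Qed.

Lemma cintegrable_expi (k : R) : cintegrable leb I (fun t => expi (k * t)).
Proof.
have -> : (fun t => expi (k * t)) = fun t => 1 * expi (k * t).
  by apply/funext => t; rewrite mul1r.
exact: cintegrable_expiM cintegrable1.
Qed.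

Lemma sin_int_pi (d : int) : sin (d%:~R * pi : R) = 0.
Proof.
have := expi_2pi_int R d; rewrite -mulrA mulr_natl mulr2n [pi * _]mulrC expiD.
rewrite /expi => /eqP; rewrite eq_complex /= => /andP[/eqP h _].
have h2 := cos2Dsin2 (d%:~R * pi : R); apply/eqP; rewrite -sqrf_eq0 expr2; apply/eqP.
by rewrite !expr2 in h2; lra.
Qed.

Lemma Rintegral_derive (F f : R -> R) : (forall x, is_derive x (1 : R) F (f x)) ->
  continuous f -> \int[leb]_(x in I) f x = F pi - F (- pi).
Proof.
move=> dF cf; have cF : continuous F.
  by move=> x; apply: differentiable_continuous; apply/derivable1_diffP; case: (dF x).
rewrite /Rintegral (@continuous_FTC2 R f F)//.
- by rewrite gtrN ?pi_gt0.
- exact: continuous_subspaceT.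
- split.
  + by move=> x _; case: (dF x).
  + by apply: cvg_at_right_filter; exact: cF.
  + by apply: cvg_at_left_filter; exact: cF.
- by move=> x _; rewrite derive1E; apply: derive_val.
Qed.

Lemma is_derive_scale (d x : R) : is_derive x (1 : R) (fun t => d * t) d.
Proof. by apply: is_derive_eq; rewrite [LHS]mulr1. Qed.

Lemma continuous_compM (f : R -> R) (d : R) : continuous f -> continuous (fun t => f (d * t)).
Proof.
by move=> cf x; apply: continuous_comp; [apply: cvgMl_tmp|exact: cf].
Qed.

Lemma Rintegral_cos_int (d : int) : d != 0 -> \int[leb]_(x in I) cos (d%:~R * x) = 0.
Proof.
move=> d0; have dR : d%:~R != 0 :> R by rewrite intr_eq0.
pose F : R -> R := d%:~R^-1 \*: (sin \o (fun t => d%:~R * t)).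
have dF x : is_derive x (1 : R) F (cos (d%:~R * x)).
  have h := @is_derive1_comp R (@sin R) (fun t => d%:~R * t) x _ _ (is_derive_sin _) (is_derive_scale _ x).
  by apply: is_derive_eq (is_deriveZ _ h) _; rewrite [LHS]mulrC mulfK.
rewrite (Rintegral_derive dF); last by apply: continuous_compM; exact: continuous_cos.
by rewrite /F /= mulrN sinN !sin_int_pi oppr0 subrr.
Qed.

Lemma Rintegral_sin_int (d : int) : d != 0 -> \int[leb]_(x in I) sin (d%:~R * x) = 0.
Proof.
move=> d0; have dR : d%:~R != 0 :> R by rewrite intr_eq0.
pose F : R -> R := (- d%:~R^-1) \*: (cos \o (fun t => d%:~R * t)).
have dF x : is_derive x (1 : R) F (sin (d%:~R * x)).
  have h := @is_derive1_comp R (@cos R) (fun t => d%:~R * t) x _ _ (is_derive_cos _) (is_derive_scale _ x).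
  by apply: is_derive_eq (is_deriveZ _ h) _; rewrite [LHS]mulNr mulNr mulrN opprK mulrC mulfK.
rewrite (Rintegral_derive dF); last by apply: continuous_compM; exact: continuous_sin.
by rewrite /F /= mulrN cosN subrr.
Qed.

Lemma cintegral_expi (d : int) :
  cintegral leb I (fun t => expi (d%:~R * t)) = (2 * pi * (d == 0)%:R)%:C.
Proof.
have [->|d0] := eqVneq d 0; last first.
  by rewrite mulr0 /cintegral Rintegral_cos_int// Rintegral_sin_int.
rewrite (@eq_cintegral _ _ _ _ _ _ (fun=> 1)); last by move=> t _; rewrite mul0r expi0.
by rewrite /cintegral !Rintegral_cst//= leb_I mul1r mul0r mulr1.
Qed.

Lemma fourier_coefZD c f g l : cintegrable leb I f -> cintegrable leb I g ->
  fourier_coef (fun t => c * f t + g t) l = c * fourier_coef f l + fourier_coef g l.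
Proof.
move=> cf cg; rewrite /fourier_coef mulrCA -mulrDr; congr (_ * _).
have e h : (fun t : R => h t * expi (- (l%:~R * t))) = fun t => h t * expi (- l%:~R * t).
  by apply/funext => t; rewrite mulNr.
rewrite !e -cintegralZ//; last exact: cintegrable_expiM.
rewrite -cintegralD//; [|by apply: cintegrableZ => //; exact: cintegrable_expiM|exact: cintegrable_expiM].
by apply: eq_cintegral => t _; rewrite mulrDl mulrA.
Qed.

Lemma fourier_coef_expi (k l : int) : fourier_coef (fun t : R => expi (k%:~R * t)) l = (k == l)%:R.
Proof.
rewrite /fourier_coef.
have -> : (fun t : R => expi (k%:~R * t) * expi (- (l%:~R * t))) = fun t => expi ((k - l)%:~R * t).
  by apply/funext => t; rewrite -expiD rmorphB mulrBl.
rewrite cintegral_expi -rmorphM mulrA mulVf ?mul1r ?subr_eq0; first by case: (k == l).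
by rewrite mulf_neq0// gt_eqF// pi_gt0.
Qed.

Lemma toeplitzZD n c f g : cintegrable leb I f -> cintegrable leb I g ->
  toeplitz n (fun t => c * f t + g t) = c *: toeplitz n f + toeplitz n g.
Proof. by move=> cf cg; apply/matrixP => i j; rewrite !mxE fourier_coefZD. Qed.

Lemma toeplitz_expi n (k : int) : toeplitz n (fun t : R => expi (k%:~R * t)) = shift_mx R n k.
Proof. by apply/matrixP => i j; rewrite !mxE fourier_coef_expi eq_sym. Qed.

Lemma toeplitz0 n : toeplitz n (fun _ : R => 0) = 0.
Proof.
apply/matrixP => i j; rewrite !mxE /fourier_coef.
rewrite (@eq_cintegral _ _ _ _ _ _ (fun=> 0)); last by move=> t _; rewrite mul0r.
have -> : cintegral leb I (fun=> 0) = 0 by exact: cintegral0.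
by rewrite mulr0.
Qed.

End fourier.

Section toeplitz_bounds.
Variable R : realType.
Local Notation leb := (@lebesgue_measure R).
Local Notation I := (`[(- pi)%R, (pi : R)]%classic).

Let mI : measurable (I : set (measurableTypeR R)).
Proof. exact: measurable_itv. Qed.

Section nonnegative.
Variable h : R -> R.
Hypothesis h_ge0 : forall t, 0 <= h t.
Hypothesis ih : leb.-integrable I (EFin \o h).
Local Notation hC := (fun t => (h t)%:C).

Lemma cintegrable_real : cintegrable leb I hC.
Proof. by split => //; exact: integrable0. Qed.

Lemma toeplitz_quadratic n (u : 'rV[R[i]]_n) :
  (u *m toeplitz n hC *m u^t*) 0 0 = (2 * pi)^-1%:C *
  cintegral leb I (fun t => (h t)%:C * `|\sum_i u 0 i * expi (- i%:R * t)| ^+ 2).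
Proof.
have icf (c : R[i]) (k : R) : cintegrable leb I (fun t => c * ((h t)%:C * expi (k * t))).
  by apply: cintegrableZ => //; apply: cintegrable_expiM; exact: cintegrable_real.
transitivity ((2 * pi)^-1%:C * \sum_(j < n) \sum_(i < n)
   cintegral leb I (fun t => (u 0 i * (u 0 j)^*) * ((h t)%:C * expi ((j%:R - i%:R) * t)))).
  rewrite mxE mulr_sumr; apply: eq_bigr => j _; rewrite !mxE mulr_suml mulr_sumr.
  apply: eq_bigr => i _; rewrite !mxE /fourier_coef.
  rewrite cintegralZ//; last by apply: cintegrable_expiM; exact: cintegrable_real.
  have -> : cintegral leb I (fun t => (h t)%:C * expi ((j%:R - i%:R) * t)) =
      cintegral leb I (fun t => (h t)%:C * expi (- ((i%:Z - j%:Z)%:~R * t))).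
    apply: eq_cintegral => t _; congr (_ * expi _).
    by rewrite -mulNr rmorphB /= opprB.
  rewrite -[Num.conj_op (u 0 j)]/((u 0 j)^*).
  move: (cintegral _ _ _) (u 0 i) ((u 0 j)^*) (_%:C) => a b c d; ring.
pose F (j i : 'I_n) t := (u 0 i * (u 0 j)^*) * ((h t)%:C * expi ((j%:R - i%:R) * t)).
have iF j i : cintegrable leb I (F j i) by exact: icf.
have e1 j : \sum_(i < n) cintegral leb I (F j i) = cintegral leb I (fun t => \sum_(i < n) F j i t).
  by rewrite cintegral_sum.
congr (_ * _); rewrite (eq_bigr _ (fun j _ => e1 j)).
rewrite -(@cintegral_sum _ _ _ leb I mI _ _ (fun j t => \sum_(i < n) F j i t)); last first.
  by move=> j; exact: cintegrable_sum.
apply: eq_cintegral => t _; rewrite normCK rmorph_sum /= mulr_sumr mulr_sumr.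
apply: eq_bigr => j _; rewrite mulr_suml mulr_sumr; apply: eq_bigr => i _.
rewrite rmorphM /= -[Num.conj_op (expi _)]/((expi _)^*) expi_conj /F.
rewrite -[Num.conj_op (u 0 j)]/((u 0 j)^*) mulrBl expiD !mulNr opprK.
move: (expi _) (expi _) (u 0 i) ((u 0 j)^*) => a b c d; ring.
Qed.

Lemma toeplitz_hermitian n : (toeplitz n hC)^t* = toeplitz n hC.
Proof.
apply/matrixP => i j; rewrite !mxE /fourier_coef rmorphM /=.
have realJ (a : R) : Num.conj_op (a%:C) = a%:C by exact: conjc_real.
have conjM (a : R) (z : R[i]) : conjc (a%:C * z) = a%:C * conjc z.
  by case: z => x y; congr Complex => /=; ring.
rewrite realJ; congr (_ * _).
rewrite -[LHS]/((cintegral _ _ _)^*).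
have e l : (fun t : R => (h t)%:C * expi (- (l%:~R * t))) = fun t => (h t)%:C * expi (- l%:~R * t).
  by apply/funext => t; rewrite mulNr.
rewrite e -cintegral_conj//; last by apply: cintegrable_expiM; exact: cintegrable_real.
apply: eq_cintegral => t _; rewrite conjM expi_conj; congr (_ * expi _).
by rewrite mulNr opprK -mulNr -rmorphN opprB.
Qed.

Local Notation mean := (\int[leb]_(t in I) h t / (2 * pi)).

Lemma toeplitz_quadratic_ge0 n (u : 'rV[R[i]]_n) : 0 <= (u *m toeplitz n hC *m u^t*) 0 0.
Proof.
rewrite toeplitz_quadratic mulr_ge0//.
  by rewrite ler0c invr_ge0 mulr_ge0// pi_ge0.
pose w t := normc (\sum_i u 0 i * expi (- i%:R * t)) ^+ 2.
have -> : cintegral leb I (fun t => (h t)%:C * `|\sum_i u 0 i * expi (- i%:R * t)| ^+ 2) =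
    (\int[leb]_(t in I) (h t * w t))%:C.
  transitivity (cintegral leb I (fun t => (h t * w t)%:C)).
    by apply: eq_cintegral => t _; rewrite rmorphM rmorphXn.
  rewrite /cintegral /=; congr Complex.
  by rewrite Rintegral_cst// mul0r.
rewrite ler0c; apply: Rintegral_ge0 => t _; rewrite mulr_ge0//.
by rewrite exprn_ge0// normc_ge0.
Qed.

Lemma toeplitz_trace n : \tr (toeplitz n hC) = (n%:R * mean)%:C.
Proof.
rewrite /mxtrace (eq_bigr (fun=> mean%:C)) => [|i _].
  by rewrite sumr_const card_ord [n%:R * _]mulr_natl (raddfMn (real_complex R)).
rewrite mxE subrr /fourier_coef mulrC rmorphM; congr (_ * _).
transitivity (cintegral leb I hC).
  by apply: eq_cintegral => t _; rewrite mul0r oppr0 expi0 mulr1.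
rewrite /cintegral /=; congr Complex.
by rewrite Rintegral_cst// mul0r.
Qed.

(* The matrix is positive semidefinite, so Markov's inequality for its
   eigenvalues bounds the number of singular values above [t]. *)
Lemma toeplitz_acs_small t : 0 < t -> acs_small (fun n => toeplitz n.+1 hC) (mean / t) t.
Proof.
move=> t0; apply: nearW => n; set T := toeplitz n.+1 hC.
have TE : T = (spectralmx T)^t* *m diag_mx (spectral_diag T) *m spectralmx T.
  rewrite -invmx_unitary ?spectral_unitarymx//; apply/orthomx_spectralP.
  by apply/normalmxP; rewrite toeplitz_hermitian.
have U := spectral_unitarymx T.
set P := spectralmx T in TE U; set d := spectral_diag T in TE.
have d0 j : 0 <= d 0 j.
  have := toeplitz_quadratic_ge0 (row j P); rewrite -/T {1}TE.
  have -> : row j P *m (P^t* *m diag_mx d *m P) *m (row j P)^t* =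
      delta_mx 0 j *m (P *m P^t*) *m diag_mx d *m (P *m P^t*) *m (delta_mx 0 j)^T.
    by rewrite rowE trmx_mul map_mxM /= trmx_delta map_delta_mx !mulmxA.
  by rewrite (unitarymxP U) !mulmx1 -rowE trmx_delta -colE !mxE eqxx mulr1n.
pose J := finset (fun j : 'I_n.+1 => t < normc (d 0 j)).
exists #|J|; last first.
  rewrite TE; apply: (sigma_unitary_diag_le U (ltW t0) (leqnn #|J|)) => j.
  by rewrite finset.in_set -leNgt.
have trE : \tr T = \sum_j d 0 j.
  by rewrite TE mxtrace_mulC mulmxA (unitarymxP U) mul1mx mxtrace_diag.
have dE j : d 0 j = (normc (d 0 j))%:C by rewrite -[LHS]ger0_norm.
have : \sum_j normc (d 0 j) = n.+1%:R * mean.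
  have := trE; rewrite toeplitz_trace (eq_bigr _ (fun j _ => dE j)) -rmorph_sum.
  by move=> /complexI.
move=> sumd; rewrite mulrAC ler_pdivlMr// [mean * _]mulrC -sumd.
rewrite mulr_natl -sumr_const [leLHS]big_mkcond /=; apply: ler_sum => j _.
by case: ifPn => [|_]; [rewrite finset.in_set => /ltW|exact: normc_ge0].
Qed.

End nonnegative.

End toeplitz_bounds.

Section trigonometric_pairs.
Variable R : realType.

Lemma expi_uniform_continuity (k e : R) : 0 < e -> exists2 d, 0 < d &
  forall x y, - pi <= x <= pi -> `|x - y| < d -> normc (expi (k * x) - expi (k * y)) <= e.
Proof.
move=> e0; have e2 : 0 < e / 2 by rewrite divr_gt0.
have [d1 d10 h1] := @uniform_continuity_segment R _ (- pi) pi _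
  (continuous_compM (d := k) (@continuous_cos R)) e2.
have [d2 d20 h2] := @uniform_continuity_segment R _ (- pi) pi _
  (continuous_compM (d := k) (@continuous_sin R)) e2.
exists (Num.min d1 d2) => [|x y xI]; first by rewrite lt_min d10.
rewrite lt_min => /andP[xy1 xy2]; apply: le_trans (normc_le_ReIm _) _.
by rewrite ReB ImB [e]splitr; apply: lerD; apply/ltW; [exact: h1|exact: h2].
Qed.

(* [u] is the position in [0, 1], and [-pi + 2 pi u] the corresponding angle. *)
Let grid_dist (K r : nat) (u d : R) : (0 < K)%N -> 2 * pi / K%:R < d ->
  r%:R <= K%:R * u -> K%:R * u < r.+1%:R ->
  `|(- pi + 2 * pi * u) - (- pi + 2 * pi * (r%:R / K%:R))| < d.
Proof.
move=> K0 Kd h1 h2; have KR : 0 < K%:R :> R by rewrite ltr0n.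
have -> : (- pi + 2 * pi * u) - (- pi + 2 * pi * (r%:R / K%:R)) =
    2 * pi / K%:R * (K%:R * u - r%:R) by field; rewrite gt_eqF.
have tp : 0 < 2 * pi / K%:R :> R by rewrite divr_gt0// mulr_gt0// pi_gt0.
apply: le_lt_trans Kd; rewrite normrM (ger0_norm (ltW tp)) ger_pMr//.
rewrite ger0_norm ?subr_ge0//; rewrite -addn1 natrD in h2; lra.
Qed.

Lemma expi_pair_LT (k : int) (g : M_D R) :
  (\forall p \ae muD R, g p = expi (k%:~R * p.2)) ->
  @LT_pairs R ((fun n => shift_mx R n.+1 k) : mxseq R, g).
Proof.
move=> gE; apply/small_closureP => e e0.
have [d d0 hd] := expi_uniform_continuity k%:~R e0.
have tp : 0 < 2 * pi :> R by rewrite mulr_gt0// pi_gt0.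
pose K := (Num.truncn (2 * pi / d)).+1.
have KR : 0 < K%:R :> R by rewrite ltr0n.
have Kd : 2 * pi / K%:R < d.
  by rewrite ltr_pdivrMr// [d * _]mulrC -ltr_pdivrMr// truncnS_gt.
pose c (p r : nat) : R[i] := expi (k%:~R * (- pi + 2 * pi * (r%:R / K%:R))).
exists (step_pair K c); first by exists K, c.
split => /=.
  apply: filterS (block_count_small (2 * `|k|) e0) => n Cn.
  set N := n.+1; set b := bsz n; have b0 : (0 < b)%N := bsz_gt0 n.
  pose J := finset (fun i : 'I_N => ~~ ((`|k| <= pos b i) && (pos b i + `|k| < bsize N b i))%N).
  have cJ : (#|J| <= 2 * (`|k| * (N %/ b).+1))%N.
    apply: card_block_edges => // i; rewrite finset.in_set negb_and -ltnNge -leqNgt.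
    by move=> /orP.
  pose v : 'rV[R[i]]_N := \row_i expi (k%:~R * angle R N b i).
  exists #|J|.
    by apply: le_trans Cn; rewrite ler_nat -/N -/b; move: cJ; move: (#|J|) (N %/ b)%N => x y; nia.
  rewrite -[X in sigma X]/(shift_mx R N k - dft_diag b (sample K c n)).
  have -> : shift_mx R N k - dft_diag b (sample K c n) =
      (shift_mx R N k - dft_diag b v) + dft_diag b (v - sample K c n).
    have -> : v - sample K c n = -1 *: sample K c n + v by rewrite scaleN1r addrC.
    by rewrite dft_diagZD scaleN1r [- _ + _]addrC addrA subrK.
  rewrite -[#|J|]addn0; apply: le_trans (sigmaD _ _ _ _) _.
  rewrite (@sigma_rows _ _ _ J)// ?add0r; last first.
    move=> i; rewrite finset.in_set negbK => /andP[i1 i2].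
    by rewrite linearB /= -(@dft_diag_expi_row R N b)// subrr.
  apply: (@sigma_unitary_diag_le _ _ _ _ _ finset.set0).
  - exact: block_dft_unitary.
  - exact: ltW.
  - by rewrite cards0.
  move=> i _; rewrite !mxE.
  have m0 := bsize_gt0 b0 (ltn_ord i); have mp := pos_lt b0 (ltn_ord i).
  set m := bsize N b i in m0 mp *; set s := pos b i in mp *.
  have mR : 0 < m%:R :> R by rewrite ltr0n.
  rewrite /c /angle -/m -/s -mulrA.
  apply: hd.
    have s0 : 0 <= s%:R / m%:R :> R by rewrite divr_ge0.
    have s1 : s%:R / m%:R <= 1 :> R by rewrite ler_pdivrMr// mul1r ler_nat ltnW.
    move: (s%:R / m%:R) s0 s1 => u u0 u1.
    have : 0 <= pi * u by rewrite mulr_ge0// pi_ge0.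
    have : pi * u <= pi by rewrite ler_piMr// pi_ge0.
    by rewrite -mulrA => *; apply/andP; split; lra.
  apply: grid_dist => //.
    by rewrite mulrA ler_pdivlMr// -!natrM ler_nat leq_divM.
  by rewrite mulrA ltr_pdivrMr// -!natrM ltr_nat ltn_ceil.
exists set0; split => //; first by rewrite measure0 lee_fin mulr_ge0 ?(ltW e0)// ltW// area_gt0.
have h1 := aeclassDE g (- step_class K c); have h2 := aeclassNE (step_class K c).
apply: filterS3 (filterI h1 h2) (filterI (step_classE K c) gE) (ae_muD R).
move=> x [-> ->] [-> ->] [_ /=]; rewrite in_itv /= => x2 _; rewrite /step_fun /c.
apply: hd => //.
have xE (y : R) : y = - pi + 2 * pi * ((y + pi) / (2 * pi)).
  by have : pi != 0 :> R := lt0r_neq0 (pi_gt0 R); move: (pi : R) => w w0; field.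
rewrite {1}(xE x.2); have u0 : 0 <= K%:R * ((x.2 + pi) / (2 * pi)).
  by rewrite mulr_ge0// divr_ge0 ?(ltW tp)//; lra.
have := truncn_itv u0; rewrite -/(cellt K x) => /andP[g1 g2].
exact: grid_dist.
Qed.

End trigonometric_pairs.

Section trigonometric_density.
Variable R : realType.
Local Notation leb := (@lebesgue_measure R).
Local Notation I := (`[(- pi)%R, (pi : R)]%classic).

Let mI : measurable (I : set (measurableTypeR R)).
Proof. exact: measurable_itv. Qed.

Definition trig_sum (s : seq (R[i] * int)) (t : R) : R[i] :=
  \sum_(x <- s) x.1 * expi (x.2%:~R * t).

Definition trig_fun : set (R -> R) :=
  [set v | exists s, forall t, (v t)%:C = trig_sum s t].

Lemma cintegrable_trig_sum s : cintegrable leb I (trig_sum s).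
Proof.
by apply: cintegrable_sum => // x; apply: cintegrableZ => //; exact: cintegrable_expi.
Qed.

Lemma trig_fun_measurable v : trig_fun v -> measurable_fun (I : set (measurableTypeR R)) v.
Proof.
move=> [s vs]; have [/integrableP[/measurable_EFinP + _] _] := cintegrable_trig_sum s.
by apply: eq_measurable_fun => t _; rewrite -vs.
Qed.

Lemma trig_fun_bounded v : trig_fun v -> exists M, forall t, I t -> `|v t| <= M.
Proof.
move=> [s vs]; exists (\sum_(x <- s) normc x.1) => t _.
rewrite -normc_real vs /trig_sum.
elim: s {vs} => [|x s IH]; first by rewrite !big_nil normc_real normr0.
rewrite !big_cons; apply: le_trans (le_normcD _ _) _.
by rewrite normcM normc_expi mulr1 lerD2l.
Qed.

Lemma trig_fun1 : trig_fun (cst 1).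
Proof.
by exists [:: (1, 0%R)] => t; rewrite /trig_sum big_seq1 mul0r expi0 mulr1.
Qed.

Lemma trig_funD v w : trig_fun v -> trig_fun w -> trig_fun (fun x => v x + w x).
Proof.
move=> [s vs] [r wr]; exists (s ++ r) => t.
by rewrite /trig_sum big_cat rmorphD /= vs wr.
Qed.

Lemma trig_sumZ c s t : trig_sum [seq (c * x.1, x.2) | x <- s] t = c * trig_sum s t.
Proof.
by rewrite /trig_sum big_map mulr_sumr; apply: eq_bigr => x _; rewrite mulrA.
Qed.

Lemma trig_funZ c v : trig_fun v -> trig_fun (fun x => c * v x).
Proof.
move=> [s vs]; exists [seq (c%:C * x.1, x.2) | x <- s] => t.
by rewrite trig_sumZ rmorphM /= vs.
Qed.

Lemma trig_funM v w : trig_fun v -> trig_fun w -> trig_fun (fun x => v x * w x).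
Proof.
move=> [s vs] [r wr]; exists [seq (x.1 * y.1, x.2 + y.2) | x <- s, y <- r] => t.
rewrite /trig_sum big_allpairs_dep /= rmorphM /= vs wr /trig_sum mulr_suml.
apply: eq_bigr => x _; rewrite mulr_sumr; apply: eq_bigr => y _ /=.
by rewrite rmorphD mulrDl expiD mulrACA.
Qed.

Local Notation approximable := (approximable leb I trig_fun).

(* For [- pi < t < pi], [y c t < 1/2] if and only if [t < c]. *)
Let y (c t : R) : R := 2^-1 - sin ((t + pi) / 2) * sin ((c - t) / 2) / 2.

Lemma trig_fun_threshold c : trig_fun (y c).
Proof.
pose h := (pi - c) / 2; pose k := cos ((pi + c) / 2).
exists [:: ((2^-1 + k / 4)%:C, 0%R); ((- 8^-1)%:C * expi h, 1%R); ((- 8^-1)%:C * expi (- h), -1)] => t.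
rewrite /trig_sum !big_cons big_nil /= mul0r expi0 mulr1 addr0 mul1r mulN1r.
rewrite -!mulrA -!expiD -opprD -mulrDr.
have -> : expi (h + t) + expi (- (h + t)) = (2 * cos (h + t))%:C.
  rewrite /expi cosN sinN; congr Complex; ring.
rewrite -rmorphM -rmorphD /=; congr (_%:C); rewrite /y /k.
have -> : h + t = (t + pi) / 2 - (c - t) / 2 by rewrite /h; field.
have -> : (pi + c) / 2 = (t + pi) / 2 + (c - t) / 2 by field.
by rewrite cosB cosD; field.
Qed.

Lemma approximable_ray (c : R) : - pi < c -> c <= pi -> approximable \1_(`]-oo, c[%classic).
Proof.
move=> c1 c2; have p0 := pi_gt0 R.
have fac (t : R) : - pi < t -> t < pi -> 0 < sin ((t + pi) / 2).
  by move=> t1 t2; apply: sin_gt0_pi; apply/andP; split; lra.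
have pos (t : R) : - pi < t -> t < c -> y c t < 2^-1.
  move=> t1 t2; have t3 : t < pi by lra.
  rewrite /y; have s2 : 0 < sin ((c - t) / 2) by apply: sin_gt0_pi; apply/andP; split; lra.
  by have := mulr_gt0 (fac _ t1 t3) s2; lra.
have neg (t : R) : c < t -> t < pi -> 2^-1 < y c t.
  move=> t1 t2; have t3 : - pi < t by lra.
  rewrite /y; have s2 : 0 < sin ((t - c) / 2) by apply: sin_gt0_pi; apply/andP; split; lra.
  have -> : (c - t) / 2 = - ((t - c) / 2) by field.
  by rewrite sinN; have := mulr_gt0 (fac _ t3 t2) s2; lra.
have Ifin : (leb I < +oo)%E by rewrite leb_I ltry.
have aeF : Filter (nbhs (almost_everywhere leb)) by exact: ae_filter_ringOfSetsType.
have := @approximable_threshold _ _ R leb I mI Ifin trig_fun trig_fun_measurable trig_fun_bounded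
  trig_fun1 trig_funD trig_funZ trig_funM (y c) (cst 1) (trig_fun_threshold c) trig_fun1.
case=> [t _||mt ap].
- have : `|sin ((t + pi) / 2) * sin ((c - t) / 2)| <= 1.
    by rewrite normrM mulr_ile1// sin_max.
  by rewrite ler_norml => /andP[h1 h2]; rewrite /y; apply/andP; split; lra.
- apply: filterS3 (ae_leb_neq (- pi)) (ae_leb_neq c) (ae_leb_neq pi) => t /eqP t1 /eqP t2 /eqP t3.
  rewrite /= in_itv /= => /andP[t4 t5].
  have {}t4 : - pi < t by rewrite lt_neqAle eq_sym t1.
  have {}t5 : t < pi by rewrite lt_neqAle t3.
  have [tc|ct] := ltP t c; first by rewrite lt_eqF// pos.
  by rewrite gt_eqF// neg// lt_neqAle eq_sym t2.
apply: (ae_eq_approximable mI trig_fun_measurable _ _ (conj mt ap)).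
  by apply: measurable_funTS; apply: measurable_indic; exact: measurable_itv.
apply: filterS3 (ae_leb_neq (- pi)) (ae_leb_neq c) (ae_leb_neq pi) => t /eqP t1 /eqP t2 /eqP t3.
rewrite /= in_itv /= => /andP[t4 t5].
have {}t4 : - pi < t by rewrite lt_neqAle eq_sym t1.
have {}t5 : t < pi by rewrite lt_neqAle t3.
rewrite mulr1 indicE; have [tc|ct] := ltP t c.
  by rewrite mem_set ?pos//= in_itv.
rewrite memNset /=; last by rewrite in_itv /= ltNge ct.
by rewrite ltNge ltW// neg// lt_neqAle eq_sym t2.
Qed.

Lemma approximable_Borel (A : set (measurableTypeR R)) : measurable A -> approximable \1_A.
Proof.
move=> mA; have Ifin : (leb I < +oo)%E by rewrite leb_I ltry.
have E1 : approximable \1_(setT : set (measurableTypeR R)).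
  apply: (@eq_approximable _ _ R leb I trig_fun (cst 1)); last exact: (approximableV leb trig_fun_measurable trig_fun1).
  by move=> t _; rewrite indicE mem_set.
have -> : A = id @^-1` A `&` setT by rewrite setIT.
apply: (@approximable_dynkin _ _ R leb I mI Ifin trig_fun trig_fun_measurable trig_fun1
  trig_funD trig_funZ _ _ (@RGenInftyO.G R)) => //.
- exact: RGenInftyO.measurableE.
- move=> _ _ [a ->] [b ->]; exists (Num.min a b).
  by apply/seteqP; split => x /=; rewrite !in_itv /= lt_min => /andP.
move=> _ [c ->]; rewrite setIT /=.
have [c1|c1] := leP c (- pi).
  have := approximableZ mI trig_fun_measurable trig_funZ 0 E1.
  apply: (@eq_approximable _ _ R leb I trig_fun) => t /=; rewrite in_itv /= => /andP[t1 _].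
  by rewrite mul0r indicE memNset//= in_itv /= ltNge (le_trans c1).
have [c2|c2] := leP c pi; first exact: approximable_ray.
apply: (@eq_approximable _ _ R leb I trig_fun) E1 => t /=; rewrite in_itv /= => /andP[_ t2].
by rewrite !indicE !mem_set//= in_itv /= (le_lt_trans t2).
Qed.

Lemma trig_dense (f : R -> R) (e : R) : leb.-integrable I (EFin \o f) -> 0 < e ->
  exists2 v, trig_fun v & (L1dist leb I f v < e%:E)%E.
Proof.
move=> fi e0; have [_ /(_ _ e0)//] := approximable_integrable mI trig_fun_measurable trig_fun1
  trig_funD trig_funZ approximable_Borel fi.
Qed.

End trigonometric_density.

Section toeplitz_model.
Variable R : realType.
Local Notation leb := (@lebesgue_measure R).
Local Notation I := (`[(- pi)%R, (pi : R)]%classic).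
Local Notation T := (measurableTypeR R * measurableTypeR R)%type.
Local Notation area := (fine (muD R (D R))).
Local Notation toep f := ((fun n => toeplitz n.+1 f) : mxseq R).

Let mI : measurable (I : set (measurableTypeR R)).
Proof. exact: measurable_itv. Qed.

Let tp : 0 < 2 * pi :> R.
Proof. by rewrite mulr_gt0// pi_gt0. Qed.

Lemma acs_small_le (A : mxseq R) a t a' t' : a <= a' -> t <= t' ->
  acs_small A a t -> acs_small A a' t'.
Proof.
move=> aa tt; apply: filterS => n [i i1 i2]; exists i; last exact: le_trans tt.
by apply: le_trans i1 _; rewrite ler_wpM2r.
Qed.

Lemma toeplitz_real_acs_small (h : R -> R) (t M : R) : 0 < t -> leb.-integrable I (EFin \o h) ->
  (\int[leb]_(x in I) (`|h x|)%:E <= M%:E)%E ->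
  acs_small (toep (fun x => (h x)%:C)) (3 * M / (2 * pi) / t) (2 * t).
Proof.
move=> t0 ih hM; have ia : leb.-integrable I (EFin \o (fun x => `|h x|)) by exact: integrable_norm.
have ib : leb.-integrable I (EFin \o (fun x => `|h x| - h x)) by exact: rintegrableB.
have aM : \int[leb]_(x in I) `|h x| <= M.
  by rewrite /Rintegral -lee_fin fineK// integrable_fin_num.
have bM : \int[leb]_(x in I) (`|h x| - h x) <= 2 * M.
  rewrite RintegralB//; have := le_normr_Rintegral mI ih; rewrite ler_norml => /andP[h1 _]; lra.
have a0 x : 0 <= `|h x| by [].
have b0 x : 0 <= `|h x| - h x by rewrite subr_ge0 ler_norm.
have tt : 1 * t + t <= 2 * t by lra.
have ab : \int[leb]_(x in I) (`|h x| - h x) + \int[leb]_(x in I) `|h x| <= 3 * M by lra.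
have e : toep (fun x => (h x)%:C) =
    -1 *: toep (fun x => (`|h x| - h x)%:C) + toep (fun x => (`|h x|)%:C).
  apply: functional_extensionality_dep => n.
  rewrite -[RHS]/(-1 *: toeplitz n.+1 (fun x => (`|h x| - h x)%:C) +
     toeplitz n.+1 (fun x => (`|h x|)%:C)) -toeplitzZD; [|exact: cintegrable_real..].
  by congr toeplitz; apply/funext => x; rewrite mulN1r -rmorphN -rmorphD /=; congr (_%:C); ring.
rewrite e; apply: acs_small_le (acs_smallD (acs_smallZ _ (toeplitz_acs_small b0 ib t0))
  (toeplitz_acs_small a0 ia t0)).
  by rewrite -mulrDl ler_pM2r ?invr_gt0// -mulrDl ler_pM2r ?invr_gt0.
by rewrite normcN normc1.
Qed.

Lemma toeplitz_cplx_acs_small (q : R -> R[i]) (t M : R) : 0 < t -> cintegrable leb I q ->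
  (\int[leb]_(x in I) (`|complex.Re (q x)|)%:E <= M%:E)%E ->
  (\int[leb]_(x in I) (`|complex.Im (q x)|)%:E <= M%:E)%E ->
  acs_small (toep q) (6 * M / (2 * pi) / t) (4 * t).
Proof.
move=> t0 [ir ii] hr hi; have tt : 1 * (2 * t) + 2 * t <= 4 * t by lra.
have MM : 3 * M + 3 * M <= 6 * M by lra.
have -> : toep q = 'i%C *: toep (fun x => (complex.Im (q x))%:C) + toep (fun x => (complex.Re (q x))%:C).
  apply: functional_extensionality_dep => n.
  rewrite -[RHS]/('i%C *: toeplitz n.+1 (fun x => (complex.Im (q x))%:C) +
     toeplitz n.+1 (fun x => (complex.Re (q x))%:C)) -toeplitzZD; [|exact: cintegrable_real..].
  by congr toeplitz; apply/funext => x; case: (q x) => a b; congr Complex => /=; ring.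
apply: acs_small_le (acs_smallD (acs_smallZ _ (toeplitz_real_acs_small t0 ii hi))
  (toeplitz_real_acs_small t0 ir hr)).
  by rewrite -mulrDl ler_pM2r ?invr_gt0// -mulrDl ler_pM2r ?invr_gt0.
by rewrite /normc /= expr0n expr1n add0r sqrtr1.
Qed.

Lemma markov_snd (h : R -> R) (t M : R) : 0 < t -> measurable_fun (I : set (measurableTypeR R)) h ->
  (\int[leb]_(x in I) (`|h x|)%:E <= M%:E)%E ->
  exists B : set T, [/\ measurable B, (muD R B <= (M / t)%:E)%E &
    forall x, D R x -> ~ B x -> `|h x.2| <= t].
Proof.
move=> t0 mh hM; pose S : set (measurableTypeR R) := I `&` [set x | t%:E <= `|(h x)%:E|]%E.
have mh' : measurable_fun (I : set (measurableTypeR R)) (fun x => (h x)%:E) by exact/measurable_EFinP.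
have mS : measurable S.
  by apply: emeasurable_fun_c_infty => //; exact: measurableT_comp.
exists (setT `*` S); split.
- exact: measurableX.
- rewrite muD_rect// setTI lebesgue_measure_itv /= lte_fin ltr01 sube0 mul1e.
  have -> : S `&` I = S by apply/setIidPl => x [].
  have := le_integral_abse leb mI mh' t0; rewrite -/S => /le_trans/(_ hM).
  by rewrite mulrC EFinM lee_pdivlMl.
- move=> x [_ Ix] nS; rewrite leNgt; apply/negP => ht; apply: nS; split => //; split => //.
  by rewrite /= lee_fin ltW.
Qed.

Lemma measure_small_snd (g : M_D R) (q : R -> R[i]) (t M : R) : 0 < t -> cintegrable leb I q ->
  (\forall x \ae muD R, g x = q x.2) ->
  (\int[leb]_(x in I) (`|complex.Re (q x)|)%:E <= M%:E)%E ->
  (\int[leb]_(x in I) (`|complex.Im (q x)|)%:E <= M%:E)%E ->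
  measure_small g (2 * M / (2 * pi) / t) (2 * t).
Proof.
move=> t0 [/integrableP[/measurable_EFinP mr _] /integrableP[/measurable_EFinP mi _]] gE hr hi.
have [B1 [mB1 B1M B1t]] := markov_snd t0 mr hr.
have [B2 [mB2 B2M B2t]] := markov_snd t0 mi hi.
exists (B1 `|` B2); split; first exact: measurableU.
  apply: le_trans (measureU2 _ _ _) _ => //; apply: le_trans (leeD B1M B2M) _.
  rewrite -EFinD lee_fin muDE /= le_eqVlt; apply/orP; left; apply/eqP.
  by move: (2 * pi : R) (lt0r_neq0 tp) (lt0r_neq0 t0) => p p0 t1; field; rewrite t1.
apply: filterS2 gE (ae_muD R) => x -> Dx /not_orP[n1 n2].
apply: le_trans (normc_le_ReIm _) _.
by have := B1t _ Dx n1; have := B2t _ Dx n2; lra.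
Qed.

Lemma expi_class (k : R) : exists g : M_D R, \forall x \ae muD R, g x = expi (k * x.2).
Proof.
have mf : measurable_fun setT (fun x : T => expi (k * x.2)).
  have m2 : measurable_fun setT (fun x : T => k * x.2) by exact: measurable_funM.
  apply/measurable_fun_complexP; split.
    exact: measurableT_comp (continuous_measurable_fun (@continuous_cos R)) m2.
  exact: measurableT_comp (continuous_measurable_fun (@continuous_sin R)) m2.
exists (aeclass_of (muD R) mf).
by apply: filterS (aeclass_ofE (muD R) mf) => x; apply.
Qed.

Lemma trig_sum_pair_LT s : exists2 g : M_D R, (\forall x \ae muD R, g x = trig_sum s x.2) &
  @LT_pairs R (toep (trig_sum s), g).
Proof.
have [LT0 LTZD _] := LT_subalgebra R.
elim: s => [|[c k] s [g gE LTg]].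
  exists 0; first by apply: filterS (aeclass0E (muD R)) => x ->; rewrite /trig_sum big_nil.
  rewrite (_ : (_, _) = 0)//; congr pair; apply: functional_extensionality_dep => n.
  rewrite (_ : trig_sum [::] = fun=> 0) ?toeplitz0//.
  by apply/funext => t; rewrite /trig_sum big_nil.
have [h hE] := expi_class k%:~R.
exists (c *: h + g).
  apply: filterS3 (filterI (aeclassDE (c *: h) g) (aeclassZE c h)) hE gE => x [-> ->] -> ->.
  by rewrite /trig_sum big_cons.
have := LTZD c _ _ (expi_pair_LT hE) LTg; congr (LT_pairs _); congr pair.
apply: functional_extensionality_dep => n.
rewrite (_ : trig_sum ((c, k) :: s) = fun t => c * expi (k%:~R * t) + trig_sum s t); last first.
  by apply/funext => t; rewrite /trig_sum big_cons.
by rewrite toeplitzZD ?toeplitz_expi//; [exact: cintegrable_expi|exact: cintegrable_trig_sum].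
Qed.

Lemma toeplitz_sub_LT : @toeplitz_pairs R `<=` @LT_pairs R.
Proof.
move=> [A k] [f [cf /= -> kE]]; apply: closure_idem; apply/small_closureP => e e0.
have [fr fi] := cf.
pose t := e / 4; have t0 : 0 < t by rewrite divr_gt0.
pose M := e * t * (2 * pi) / 6; have M0 : 0 < M by rewrite divr_gt0// !mulr_gt0// pi_gt0.
have [v1 [s1 v1E] fv1] := trig_dense fr M0.
have [v2 [s2 v2E] fv2] := trig_dense fi M0.
pose s := s1 ++ [seq ('i%C * x.1, x.2) | x <- s2].
have sE x : trig_sum s x = (v1 x)%:C + 'i%C * (v2 x)%:C.
  by rewrite v1E v2E -trig_sumZ /trig_sum big_cat.
have [g gE LTg] := trig_sum_pair_LT s.
exists (toep (trig_sum s), g) => //.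
pose q x := -1 * trig_sum s x + f x.
have cq : cintegrable leb I q.
  apply: cintegrableD => //; apply: cintegrableZ => //; exact: cintegrable_trig_sum.
have qr : (\int[leb]_(x in I) (`|complex.Re (q x)|)%:E <= M%:E)%E.
  apply/ltW; apply: le_lt_trans fv1; rewrite le_eqVlt; apply/orP; left; apply/eqP.
  apply: eq_integral => x _; rewrite /q sE; case: (f x) => a b /=.
  by congr (`|_|%:E); ring.
have qi : (\int[leb]_(x in I) (`|complex.Im (q x)|)%:E <= M%:E)%E.
  apply/ltW; apply: le_lt_trans fv2; rewrite le_eqVlt; apply/orP; left; apply/eqP.
  apply: eq_integral => x _; rewrite /q sE; case: (f x) => a b /=.
  by congr (`|_|%:E); ring.
have Me (c : R) : 0 <= c -> c <= 6 -> c * M / (2 * pi) / t <= e.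
  move=> c0 c6; have -> : c * M / (2 * pi) / t = c / 6 * e.
    by rewrite /M; move: (2 * pi : R) (lt0r_neq0 tp) (lt0r_neq0 t0) => p p0 t1; field; rewrite t1.
  by rewrite ler_piMl ?(ltW e0)//; lra.
split => /=.
  have -> : (toep f : mxseq R) - toep (trig_sum s) = toep q.
    apply: functional_extensionality_dep => n.
    rewrite -[LHS]/(toeplitz n.+1 f - toeplitz n.+1 (trig_sum s)) /q toeplitzZD//.
      by rewrite scaleN1r addrC.
    exact: cintegrable_trig_sum.
  apply: acs_small_le (toeplitz_cplx_acs_small t0 cq qr qi); first exact: Me.
  by rewrite /t mulrC divfK.
have gq : \forall x \ae muD R, (k - g : M_D R) x = q x.2.
  apply: filterS3 (filterI (aeclassDE k (- g)) (aeclassNE g)) gE (ae_muDP kE) => x [-> ->] -> ->.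
  by rewrite /q mulN1r addrC.
have [B [mB B1 B2]] := measure_small_snd t0 cq gq qr qi; exists B; split => //.
  apply: le_trans B1 _; rewrite lee_fin ler_wpM2r ?(ltW (area_gt0 R))//.
  by apply: Me; lra.
by apply: filterS B2 => x h /h /le_trans; apply; rewrite /t; lra.
Qed.

End toeplitz_model.

(** * Density of the second components *)

Section density.
Variable R : realType.
Local Notation leb := (@lebesgue_measure R).
Local Notation Y := (measurableTypeR R).
Local Notation T := (measurableTypeR R * measurableTypeR R)%type.
Local Notation area := (fine (muD R (D R))).
Local Notation Alg := (smallest (@subalgebra R) (@toeplitz_pairs R `|` @sampling_pairs R)).

Lemma riemann_sum_id (s : seq R) (t : nat -> R) : itv_partition 0 1 s ->
  riemann_sum (fun x => x%:C) s t - 2^-1%:C =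
  (\sum_(i < size s) (s`_i - (0 :: s)`_i) * (t i - (s`_i + (0 :: s)`_i) / 2))%:C.
Proof.
move=> [_ /eqP sl]; rewrite /riemann_sum.
have tel (f : R -> R) : \sum_(i < size s) (f s`_i - f (0 :: s)`_i) = f 1 - f 0.
  rewrite -(big_mkord xpredT (fun i => f s`_i - f (0 :: s)`_i)).
  rewrite (@telescope_sumr _ 0 (size s) (fun i => f (0 :: s)`_i))//.
  by rewrite -last_nth sl.
under eq_bigr do rewrite -rmorphM /=.
rewrite -rmorph_sum -rmorphB /=; congr (_%:C).
under [in RHS]eq_bigr do rewrite mulrBr.
rewrite sumrB; congr (_ - _).
transitivity ((1 ^+ 2 - 0 ^+ 2) / 2 : R); first by rewrite expr1n expr0n subr0 mul1r.
by rewrite -(tel (fun x => x ^+ 2)) mulr_suml; apply: eq_bigr => i _; field.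
Qed.

Lemma riemann_integrable01_id : riemann_integrable01 (fun x : R => x%:C).
Proof.
exists 2^-1%:C => e e0; exists e => // s t ps ts.
rewrite riemann_sum_id// normc_real.
apply: le_lt_trans (ler_norm_sum _ _ _) _.
apply: (@le_lt_trans _ _ (\sum_(i < size s) (s`_i - (0 :: s)`_i) * (e / 2))).
  apply: ler_sum => i _; have [/andP[h1 h2] h3] := ts i (ltn_ord i).
  have d0 : 0 <= s`_i - (0 :: s)`_i by rewrite subr_ge0 (le_trans h1).
  rewrite normrM (ger0_norm d0) ler_wpM2l// ler_norml.
  move: h1 h2 h3; move: s`_i (0 :: s)`_i (t i) => a b c h1 h2 h3 {d0 ts}.
  by apply/andP; split; lra.
rewrite -mulr_suml -(big_mkord xpredT (fun i => s`_i - (0 :: s)`_i)).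
rewrite (@telescope_sumr _ 0 (size s) (fun i => (0 :: s)`_i))// -last_nth.
by case: ps => _ /eqP -> /=; lra.
Qed.

Lemma Alg_subalgebra : subalgebra Alg.
Proof.
split.
- by move=> S [[S0 _ _] _].
- by move=> c x y Ax Ay S hS; have [[_ SZD _] _] := hS; apply: SZD; [exact: Ax|exact: Ay].
- by move=> x y Ax Ay S hS; have [[_ _ SM] _] := hS; apply: SM; [exact: Ax|exact: Ay].
Qed.

Lemma real_class (v : T -> R) : measurable_fun setT v ->
  exists g : M_D R, \forall x \ae muD R, g x = (v x)%:C.
Proof.
move=> mv; have mf : measurable_fun setT (fun x : T => (v x)%:C).
  by apply/measurable_fun_complexP; split => //=; exact: measurable_cst.
exists (aeclass_of (muD R) mf).
by apply: filterS (aeclass_ofE (muD R) mf) => x; apply.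
Qed.

Definition symbol_fun : set (T -> R) := [set v : T -> R | [/\ measurable_fun setT v,
  exists M, forall x, D R x -> `|v x| <= M &
  exists2 z, Alg z & \forall x \ae muD R, z.2 x = (v x)%:C]].

Lemma symbol_fun_measurable v : symbol_fun v -> measurable_fun (D R) v.
Proof. by move=> [mv _ _]; exact: measurable_funTS. Qed.

Lemma symbol_fun_bounded v : symbol_fun v -> exists M, forall x, D R x -> `|v x| <= M.
Proof. by case. Qed.

Lemma symbol_funD v w : symbol_fun v -> symbol_fun w -> symbol_fun (fun x => v x + w x).
Proof.
move=> [mv [M vM] [z Az zv]] [mw [N wN] [y Ay yw]]; split; first exact: measurable_funD.
  exists (M + N) => x Dx; apply: le_trans (ler_normD _ _) _.
  by apply: lerD; [exact: vM|exact: wN].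
have [_ AZD _] := Alg_subalgebra.
exists (1 *: z + y); first exact: AZD.
rewrite scale1r; apply: filterS3 (aeclassDE z.2 y.2) zv yw => x /= -> -> ->.
by rewrite rmorphD.
Qed.

Lemma symbol_funZ c v : symbol_fun v -> symbol_fun (fun x => c * v x).
Proof.
move=> [mv [M vM] [z Az zv]]; split; first exact: measurable_funM.
  exists (`|c| * M) => x Dx; rewrite normrM; apply: ler_wpM2l => //; exact: vM.
have [A0 AZD _] := Alg_subalgebra.
exists (c%:C *: z + 0); first exact: AZD.
rewrite addr0; apply: filterS2 (aeclassZE c%:C z.2) zv => x /= -> ->.
by rewrite rmorphM.
Qed.

Lemma symbol_funM v w : symbol_fun v -> symbol_fun w -> symbol_fun (fun x => v x * w x).
Proof.
move=> [mv [M vM] [z Az zv]] [mw [N wN] [y Ay yw]]; split; first exact: measurable_funM.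
  exists (M * N) => x Dx; rewrite normrM; apply: ler_pM => //; [exact: vM|exact: wN].
have [_ _ AM] := Alg_subalgebra.
exists (z * y); first exact: AM.
apply: filterS3 (aeclassME z.2 y.2) zv yw => x /= -> -> ->.
by rewrite rmorphM.
Qed.

Lemma symbol_fun_snd (B : set Y) : measurable B -> symbol_fun (fun x => \1_B x.2).
Proof.
move=> mB; have mv : measurable_fun setT (fun x : T => \1_B x.2 : R).
  exact: (measurableT_comp (measurable_indic mB) measurable_snd).
split => //.
  by exists 1 => x _; rewrite indicE; case: (_ \in _); rewrite ?normr1 ?normr0.
have [g gE] := real_class mv; exists ((fun n => toeplitz n.+1 (fun t => (\1_B t)%:C)) : mxseq R, g) => //.
move=> S [_]; apply; left; exists (fun t => (\1_B t)%:C); split => //=.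
  apply: cintegrable_real; apply: measurable_bounded_integrable => //.
  - by rewrite /= leb_I ltry.
  - exists 1; split; first exact: num_real.
    move=> M M1 x _; apply: le_trans (ltW M1).
    by rewrite /= indicE; case: (_ \in _); rewrite ?normr1 ?normr0.
by apply: filterS gE => x ->.
Qed.

Lemma symbol_fun1 : symbol_fun (cst 1).
Proof.
have := symbol_fun_snd measurableT; congr symbol_fun.
by apply/funext => x; rewrite indicE mem_set.
Qed.

Lemma symbol_fun_fst : symbol_fun (fun x => x.1).
Proof.
have mv : measurable_fun setT (fun x : T => x.1 : R) by exact: measurable_fst.
split => //.
  exists 1 => x [/=]; rewrite in_itv /= => /andP[x0 x1] _.
  by rewrite ger0_norm.
have [g gE] := real_class mv; exists ((fun n => diag_sampling n.+1 (fun t => t%:C)) : mxseq R, g) => //.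
move=> S [_]; apply; right; exists (fun t => t%:C); split => //=.
  exact: riemann_integrable01_id.
by apply: filterS gE => x ->.
Qed.

Local Notation approximable := (approximable (muD R) (D R) symbol_fun).

Let mD : measurable (D R). Proof. exact: measurable_D. Qed.

Let Dfin : (muD R (D R) < +oo)%E. Proof. by rewrite muDE ltry. Qed.

Lemma approximable_ray_strip (c : R) (B : set Y) : measurable B ->
  approximable \1_(fst @^-1` `]-oo, c[%classic `&` snd @^-1` B).
Proof.
move=> mB; have VB := symbol_fun_snd mB.
have VBE (x : T) : \1_(snd @^-1` B) x = \1_B x.2 :> R by [].
have D1 (x : T) : D R x -> 0 <= x.1 <= 1 by case=> /=; rewrite in_itv.
have [c0|c0] := ltP c 0.
  apply: (@eq_approximable _ _ R (muD R) (D R) symbol_fun (fun x => 0 * \1_B x.2)).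
    move=> x /D1 /andP[x0 _]; rewrite mul0r indicE memNset// => -[/=].
    by rewrite in_itv /= => /(le_lt_trans x0)/(lt_trans c0); rewrite ltxx.
  by apply: (approximableV (muD R) symbol_fun_measurable); exact: symbol_funZ.
have [c1|c1] := ltP 1 c.
  apply: (@eq_approximable _ _ R (muD R) (D R) symbol_fun (fun x => \1_B x.2)).
    move=> x /D1 /andP[_ x1]; rewrite !indicE; congr (nat_of_bool _)%:R.
    apply/idP/idP; rewrite !inE; last by case.
    by move=> Bx; split => //=; rewrite in_itv /= (le_lt_trans x1).
  exact: (approximableV (muD R) symbol_fun_measurable).
pose y (x : T) : R := 2^-1 * x.1 + ((1 - c) / 2) * 1.
have Vy : symbol_fun y.
  exact: symbol_funD (symbol_funZ _ symbol_fun_fst) (symbol_funZ _ symbol_fun1).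
have [||m a] := @approximable_threshold _ _ R (muD R) (D R) mD Dfin symbol_fun
    symbol_fun_measurable symbol_fun_bounded symbol_fun1 symbol_funD symbol_funZ symbol_funM
    y _ Vy VB.
- by move=> x /D1 /andP[x0 x1]; rewrite /y; apply/andP; split; lra.
- apply: filterS (ae_fst (ae_leb_neq c)) => x xc _; apply/eqP => yx; apply: xc.
  by move: yx; rewrite /y => yx; lra.
apply: (@eq_approximable _ _ R (muD R) (D R) symbol_fun _ _ _ (conj m a)) => x _.
have -> : (y x < 2^-1) = (x.1 < c) by rewrite /y; apply/idP/idP => h; lra.
rewrite !indicE -natrM mulnb; congr (nat_of_bool _)%:R.
apply/andP/idP; rewrite !inE /= in_itv /=; first by case.
by case.
Qed.

Lemma approximable_rectangle (A B : set Y) : measurable A -> measurable B ->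
  approximable \1_(fst @^-1` A `&` snd @^-1` B).
Proof.
move=> mA mB.
apply: (@approximable_dynkin _ _ R (muD R) (D R) mD Dfin symbol_fun symbol_fun_measurable
  symbol_fun1 symbol_funD symbol_funZ _ _ (@RGenInftyO.G R)) => //.
- by rewrite -[X in measurable X]setTI; exact: measurable_snd.
- exact: (approximableV (muD R) symbol_fun_measurable (symbol_fun_snd mB)).
- exact: RGenInftyO.measurableE.
- move=> _ _ [a ->] [b ->]; exists (Num.min a b).
  by apply/seteqP; split => x /=; rewrite !in_itv /= lt_min => /andP.
by move=> _ [c ->]; exact: approximable_ray_strip.
Qed.

Lemma approximable_measurable (A : set T) : measurable A -> approximable \1_A.
Proof.
move=> mA; have E1 : approximable \1_(setT : set T).
  apply: (@eq_approximable _ _ R (muD R) (D R) symbol_fun (cst 1)).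
    by move=> t _; rewrite indicE mem_set.
  exact: (approximableV (muD R) symbol_fun_measurable symbol_fun1).
have -> : A = id @^-1` A `&` setT by rewrite setIT.
apply: (@approximable_dynkin _ _ R (muD R) (D R) mD Dfin symbol_fun symbol_fun_measurable
  symbol_fun1 symbol_funD symbol_funZ _ _ [set A `*` B | A in measurable & B in measurable]) => //.
- by rewrite measurable_prod_measurableType.
- move=> _ _ [A1 mA1 [B1 mB1 <-]] [A2 mA2 [B2 mB2 <-]].
  exists (A1 `&` A2); first exact: measurableI.
  by exists (B1 `&` B2); [exact: measurableI|rewrite setXI].
move=> _ [A1 mA1 [B1 mB1 <-]]; rewrite setIT; exact: approximable_rectangle.
Qed.

Lemma measurable_tail (h : T -> R) (r : R) : measurable_fun setT h ->
  measurable [set x | (r < `|h x|)%R].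
Proof.
move=> mh; have mn : measurable_fun setT (fun x => `|h x|) by exact: measurableT_comp.
rewrite (_ : [set x | _] = (fun x => `|h x|) @^-1` `]r, +oo[%classic).
  by rewrite -[X in measurable X]setTI; apply: mn => //; exact: measurable_itv.
by apply/seteqP; split => x /=; rewrite in_itv /= andbT.
Qed.

Lemma tail_small (h : T -> R) (e : R) : measurable_fun setT h -> 0 < e ->
  exists n : nat, (muD R [set x | (n%:R < `|h x|)%R] < e%:E)%E.
Proof.
move=> mh e0; pose F n : set T := [set x | (n%:R < `|h x|)%R].
have mF n : measurable (F n) by exact: measurable_tail.
have F0 : \bigcap_n F n = set0.
  apply/seteqP; split => // x Fx; have := Fx (Num.truncn `|h x|).+1 Logic.I.
  by rewrite /F /= ltNge (ltW (truncnS_gt _)).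
have := @nonincreasing_cvg_mu _ _ _ (muD R) F _ mF _ _.
rewrite F0 measure0 => /(_ _ _ _)/cvge0_small h'.
have [] := h' _ _ _ e e0.
- by apply: le_lt_trans (muD_le_area (mF _)) _; rewrite ltry.
- exact: measurable0.
- move=> m n mn; apply/subsetPset => x; apply: le_lt_trans; by rewrite ler_nat.
by move=> N _ /(_ N (leqnn N)) /= FN; exists N.
Qed.

Lemma real_density (h : T -> R) (e : R) : measurable_fun setT h -> 0 < e ->
  exists v B, [/\ symbol_fun v, measurable B, (muD R B <= (e * area)%:E)%E &
    forall x, D R x -> ~ B x -> `|h x - v x| <= e].
Proof.
move=> mh e0; have a0 := area_gt0 R.
have e1 : 0 < e / 2 * area by rewrite mulr_gt0// divr_gt0.
have [n hn] := tail_small mh e1.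
pose F : set T := [set x | (n%:R < `|h x|)%R].
have mF : measurable F by exact: measurable_tail.
pose g x := h x * \1_(~` F) x.
have mg : measurable_fun setT g.
  by apply: measurable_funM => //; apply: measurable_indic; exact: measurableC.
have ig : (muD R).-integrable (D R) (EFin \o g).
  apply: (@integrable_bounded R g n%:R) => // x; rewrite /g indicE.
  have [xF|xF] := boolP (x \in ~` F); last by rewrite mulr0 normr0.
  by rewrite mulr1; rewrite inE in xF; rewrite leNgt; apply/negP.
have [_ /(_ _ (mulr_gt0 e0 e1))[v Vv gv]] :=
  @approximable_integrable _ _ R (muD R) (D R) mD symbol_fun symbol_fun_measurable
    symbol_fun1 symbol_funD symbol_funZ g approximable_measurable ig.
have [mv _ _] := Vv.
pose S : set T := D R `&` [set x | e%:E <= `|(g x - v x)%:E|]%E.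
have md : measurable_fun (D R) (fun x => (g x - v x)%:E).
  by apply/measurable_EFinP; apply: measurable_funTS; exact: measurable_funB.
have mS : measurable S by apply: emeasurable_fun_c_infty => //; exact: measurableT_comp.
exists v, (F `|` S); split => //; first exact: measurableU.
  apply: le_trans (measureU2 _ _ _) _ => //.
  have -> : e * area = e / 2 * area + e / 2 * area by rewrite -mulrDl -splitr.
  rewrite EFinD; apply: leeD; first exact: ltW.
  have := le_integral_abse (muD R) mD md e0; rewrite -/S => /le_trans/(_ (ltW gv)).
  by rewrite EFinM lee_pmul2l.
move=> x Dx /not_orP[nF nS]; have -> : h x = g x.
  by rewrite /g indicE mem_set// mulr1.
by rewrite leNgt; apply/negP => ev; apply: nS; split => //=; rewrite lee_fin ltW.
Qed.

Lemma Alg_dense (k : M_D R) (e : R) : 0 < e ->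
  exists2 z, Alg z & measure_small (k - z.2) e e.
Proof.
move=> e0; have e2 : 0 < e / 2 by rewrite divr_gt0.
have [mr mi] := (measurable_fun_complexP k).1 (measurable_aeclass k).
have [v [B [[_ _ [z Az zv]] mB B1 B2]]] := real_density mr e2.
have [w [B' [[_ _ [y Ay yw]] mB' B1' B2']]] := real_density mi e2.
have [_ AZD _] := Alg_subalgebra.
exists ('i%C *: y + z); first exact: AZD.
exists (B `|` B'); split; first exact: measurableU.
  apply: le_trans (measureU2 _ _ _) _ => //.
  by rewrite [e]splitr mulrDl EFinD leeD.
have h1 := aeclassDE k (- ('i%C *: y + z).2); have h2 := aeclassNE ('i%C *: y + z).2.
have h3 := aeclassDE ('i%C *: y).2 z.2; have h4 := aeclassZE 'i%C y.2.
apply: filterS3 (filterI h1 h2) (filterI h3 h4) (filterI (filterI zv yw) (ae_muD R)).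
move=> x [-> ->] [/= -> ->] [[-> ->] Dx] /not_orP[nB nB'].
apply: le_trans (normc_le_ReIm _) _; rewrite [leRHS]splitr.
apply: lerD; [apply: le_trans (B2 _ Dx nB)|apply: le_trans (B2' _ Dx nB')].
  by case: (k x) => a b /=; rewrite le_eqVlt; apply/orP; left; apply/eqP; congr `|_|; ring.
by case: (k x) => a b /=; rewrite le_eqVlt; apply/orP; left; apply/eqP; congr `|_|; ring.
Qed.

End density.

Theorem corollary3p3 (R : realType) :
  S_D R (GLT R) /\
  forall G : set (ExM_D R), S_D R G -> GLT R `<=` G -> G = GLT R.
Proof.
have [A0 AZD AM] := Alg_subalgebra R.
have GLT_CD : GLT R `<=` C_D R.
  apply: subset_trans (@LT_sub_C_D R); apply: subset_trans (@closure_idem R _).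
  apply: closure_sub; apply: smallest_sub; first exact: LT_subalgebra.
  by rewrite subUset; split; [exact: toeplitz_sub_LT|exact: sampling_sub_LT].
have GLT0 : GLT R 0 by apply: sub_closure.
have GLTZD c x y : GLT R x -> GLT R y -> GLT R (c *: x + y).
  exact: closureZD (Alg_subalgebra R).
split=> [|G [_ GC GD GN] GLTG].
  split; [by exists 0|exact: GLT_CD| |].
    by move=> a b Ga Gb; have := GLTZD 1 _ _ Ga Gb; rewrite scale1r.
  by move=> a Ga; have := GLTZD (-1) _ _ Ga GLT0; rewrite scaleN1r addr0.
apply/seteqP; split=> [x Gx|]; last exact: GLTG.
apply: closure_idem; apply/small_closureP => e e0.
have e4 : 0 < e / 4 by rewrite divr_gt0.
have [z Az zk] := Alg_dense x.2 e4.
have Gz : GLT R z by exact: sub_closure.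
exists z => //; split.
  have := symbol_acs_small e4 e4 (GC _ (GD _ _ Gx (GN _ (GLTG _ Gz)))) zk.
  by apply: acs_small_le; lra.
case: zk => B [mB B1 B2]; exists B; split => //.
  by apply: le_trans B1 _; rewrite lee_fin ler_wpM2r ?(ltW (area_gt0 R))//; lra.
by apply: filterS B2 => p h /h /le_trans; apply; lra.
Qed.
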